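(* Let $n\ge 1$ be an integer and let $\mathbb B^{n+1}$ be the open unit ball in $\mathbb C^{n+1}$. There is a family $\{u_\lambda\}_{\lambda\in(0,1)}$ of pairwise distinct continuous plurisubharmonic functions on $\mathbb B^{n+1}$ with the following properties: (i) for every $\lambda\in(0,1)$, $(\mathrm{dd^c}u_\lambda)^{n+1}=0$ on $\mathbb B^{n+1}$ and $$P_{\mathbb B^{n+1},e_1}\le u_\lambda\le e^{-\lambda}P_{\mathbb B^{n+1},e_1}\quad\text{on }\mathbb B^{n+1};$$ (ii) for every $\lambda\in(0,1)$, $u_\lambda$ is not a constant multiple of $P_{\mathbb B^{n+1},e_1}$.
   Context: $e_1=(1,0,\ldots,0)\in\partial\mathbb B^{n+1}$. $P_{\mathbb B^{n+1},e_1}$ is the pluricomplex Poisson kernel of $\mathbb B^{n+1}$ with singularity at $e_1$, which is given explicitly by $P_{\mathbb B^{n+1},e_1}(z)=-\dfrac{1-|z|^2}{|1-z_1|^2}$ for $z=(z_1,\ldots,z_{n+1})\in\mathbb B^{n+1}$. For a locally bounded plurisubharmonic function $u$, $(\mathrm{dd^c}u)^{n+1}$ denotes the complex Monge–Ampère measure in the sense of Bedford–Taylor. *)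

(* Defs.v *)
From HB Require Import structures.
From mathcomp Require Import all_boot all_order all_algebra.
From mathcomp Require Import all_classical all_reals all_analysis.
From mathcomp.real_closed Require Import complex.
Set Implicit Arguments.
Unset Strict Implicit.
Unset Printing Implicit Defensive.
Import Order.TTheory GRing.Theory Num.Theory numFieldNormedType.Exports.
Local Open Scope classical_set_scope.
Local Open Scope ring_scope.

(* The complex numbers R[i], packaged so that the topology carried by every
   [numClosedFieldType] is inferred on C and on row vectors over C. *)
Definition cplx (R : realType) : numClosedFieldType := R[i].

Notation "''CV[' R ]_ N" := ('rV[cplx R]_N)
  (at level 0, N at level 2, format "''CV[' R ]_ N") : type_scope.

Section Complex.
Context {R : realType}.

Definition ReC (w : cplx R) : R := complex.Re w.
Definition ImC (w : cplx R) : R := complex.Im w.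
Definition mkC (x y : R) : cplx R := (x +i* y)%C.
Definition RtoC (x : R) : cplx R := mkC x 0.
Definition Ci : cplx R := mkC 0 1.

Definition normC2 (w : cplx R) : R := ReC w ^+ 2 + ImC w ^+ 2.

End Complex.

(* C^N with its Borel sigma-algebra. *)
Notation borelCV R N := (g_sigma_algebraType (@open 'CV[R]_N)).

Section Geometry.
Context {R : realType}.

(* The square of the Hermitian norm (the library norm on row vectors is the
   maximum of the moduli of the coordinates). *)
Definition normCV2 {N} (z : 'CV[R]_N) : R := \sum_(j < N) normC2 (z 0 j).

Definition unit_ballCV N : set 'CV[R]_N := [set z | normCV2 z < 1].

(* Negative, with singularity at the boundary point e_1 = (1, 0, ..., 0). *)
Definition poisson_kernel {n} (z : 'CV[R]_n.+1) : R :=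
  - ((1 - normCV2 z) / normC2 (1 - z 0 ord0)).

End Geometry.

Arguments unit_ballCV : clear implicits.

Section Plurisubharmonic.
Context {R : realType} {N : nat}.
Local Open Scope ereal_scope.

Definition expi (t : R) : cplx R := mkC (cos t) (sin t).

(* The mean value inequality is tested on the closed discs a + w b, |w| <= 1,
   lying in Om.  The integral is an extended-real one and may be -oo. *)
Definition plurisubharmonic (Om : set 'CV[R]_N) (u : 'CV[R]_N -> \bar R) :=
  [/\ forall z, Om z -> u z < +oo,
      forall z, Om z -> forall c : R, u z < c%:E ->
        \forall w \near z, u w < c%:E
    & forall a b : 'CV[R]_N,
        (forall w : cplx R, (normC2 w <= 1)%R -> Om (a + w *: b)%R) ->
        u a <= ((2 * pi)^-1)%:E *
          \int[lebesgue_measure]_(t in `[0%R, (2 * pi)%R])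
             u (a + expi t *: b)%R].

End Plurisubharmonic.

Section TestFunctions.
Context {R : realType} {N : nat}.
Implicit Types (f : 'CV[R]_N -> R) (F : 'CV[R]_N -> cplx R).

Definition real_line f (a v : 'CV[R]_N) : R -> R :=
  fun t => f (a + RtoC t *: v).

Definition dirD v f : 'CV[R]_N -> R := fun a => derive1 (real_line f a v) 0.

Fixpoint Cclass (k : nat) f : Prop :=
  if k is k'.+1 then
    continuous f /\
    forall v, (forall a, derivable (real_line f a v) 0 1) /\
              Cclass k' (dirD v f)
  else continuous f.

Definition test_function (Om : set 'CV[R]_N) f :=
  (forall k, Cclass k f) /\
  exists K, [/\ compact K, K `<=` Om & forall z, ~ K z -> f z = 0].

Definition dirDC v F : 'CV[R]_N -> cplx R := fun z =>
  mkC (dirD v (fun w => ReC (F w)) z) (dirD v (fun w => ImC (F w)) z).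

(* Wirtinger operators d/dz_j and d/d\bar z_j. *)
Definition dz (j : 'I_N) F : 'CV[R]_N -> cplx R := fun z =>
  2^-1 * (dirDC (delta_mx 0 j) F z - Ci * dirDC (Ci *: delta_mx 0 j) F z).
Definition dzbar (j : 'I_N) F : 'CV[R]_N -> cplx R := fun z =>
  2^-1 * (dirDC (delta_mx 0 j) F z + Ci * dirDC (Ci *: delta_mx 0 j) F z).

(* With d^c = i(\bar\partial - \partial) and the (1,1)-forms
     b_{jk} = (i/2) dz_j /\ d\bar z_k,
   one has dd^c f = 2i \partial\bar\partial f = \sum_{j,k} ddc f j k b_{jk}. *)
Definition ddc f (j k : 'I_N) : 'CV[R]_N -> cplx R := fun z =>
  4 * dz j (dzbar k (fun w => RtoC (f w))) z.

End TestFunctions.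

Section MongeAmpere.
Context {R : realType} {N : nat}.

Definition Cintegral (mu : {measure set (borelCV R N) -> \bar R})
    (D : set 'CV[R]_N) (F : 'CV[R]_N -> cplx R) : cplx R :=
  mkC (Rintegral mu D (fun z => ReC (F z)))
      (Rintegral mu D (fun z => ImC (F z))).

(* The Lebesgue measure of C^N = R^{2N}, characterized as the Borel measure
   with the right value on every closed box. *)
Definition is_lebesgueCV (mu : {measure set (borelCV R N) -> \bar R}) :=
  forall a b : 'CV[R]_N,
    (forall j, ReC (a 0 j) <= ReC (b 0 j) /\
               ImC (a 0 j) <= ImC (b 0 j)) ->
    mu [set z | forall j,
          ReC (a 0 j) <= ReC (z 0 j) <= ReC (b 0 j) /\
          ImC (a 0 j) <= ImC (z 0 j) <= ImC (b 0 j)] =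
    (\prod_(j < N) ((ReC (b 0 j) - ReC (a 0 j)) *
                    (ImC (b 0 j) - ImC (a 0 j))))%:E.

Definition Clocally_integrable (Om : set 'CV[R]_N)
    (mu : {measure set (borelCV R N) -> \bar R}) (F : 'CV[R]_N -> cplx R) :=
  forall K : set 'CV[R]_N, compact K -> K `<=` Om ->
    mu.-integrable K (fun z : borelCV R N => (ReC (F z))%:E) /\
    mu.-integrable K (fun z : borelCV R N => (ImC (F z))%:E).

(* A current T on Om of bidegree (N - p, N - p) with measure coefficients.
   T is recorded by the complex measures
     T /\ b_{j_1 k_1} /\ ... /\ b_{j_p k_p},
   one for each s = ((j_1,k_1), ..., (j_p,k_p)), written as
   (coef s) . cmeas for a single positive Radon measure cmeas.  The forms
   b_{j_1 k_1} /\ ... /\ b_{j_p k_p} span all forms of bidegree (p,p) over the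
   functions, and working with blocks b_{jk}, which commute, removes the signs
   of the exterior algebra from the formulas below.  The antisymmetry in the
   j's and in the k's is not part of the record: it holds for the current of
   integration and is inherited along [is_ddc_mul]. *)
Record current (Om : set 'CV[R]_N) (p : nat) := Current {
  cmeas : {measure set (borelCV R N) -> \bar R};
  coef : p.-tuple ('I_N * 'I_N) -> 'CV[R]_N -> cplx R;
  cmeas_finite : forall K : set 'CV[R]_N, compact K -> K `<=` Om ->
    (cmeas K < +oo)%E;
  coef_integrable : forall s, Clocally_integrable Om cmeas (coef s)
}.

(* The value of T on the test form f b_{j_1 k_1} /\ ... /\ b_{j_p k_p}; f need
   not be smooth, since T has measure coefficients. *)
Definition ceval Om p (T : current Om p) (s : p.-tuple ('I_N * 'I_N))
    (f : 'CV[R]_N -> cplx R) : cplx R :=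
  Cintegral (cmeas T) Om (fun z => f z * coef T s z).

(* The sign of j_1, ..., j_N if it is a permutation of the indices, and 0
   otherwise. *)
Definition levi_civita (j : N.-tuple 'I_N) : R :=
  \det (\matrix_(a < N, b < N) (tnth j a == b)%:R).

(* The current of integration [Om], i.e. (dd^c u)^0 = 1: one has
   b_{j_1 k_1} /\ ... /\ b_{j_N k_N} = eps(j) eps(k) dLeb. *)
Definition is_integration_current Om (T : current Om N) :=
  is_lebesgueCV (cmeas T) /\
  forall s z, coef T s z =
    RtoC (levi_civita [tuple of map fst s] *
          levi_civita [tuple of map snd s]).

(* S = dd^c (u T). *)
Definition is_ddc_mul Om p (u : 'CV[R]_N -> R) (T : current Om p.+1)
    (S : current Om p) :=
  forall (s : p.-tuple ('I_N * 'I_N)) (f : 'CV[R]_N -> R),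
    test_function Om f ->
    ceval S s (fun z => RtoC (f z)) =
    \sum_(j < N) \sum_(k < N)
      ceval T (cons_tuple (j, k) s) (fun z => RtoC (u z) * ddc f j k z).

(* For u locally bounded and plurisubharmonic on Om: mu is the Monge-Ampere
   measure (dd^c u)^N on Om of Bedford and Taylor, who define inductively
   (dd^c u)^0 = 1 and (dd^c u)^{k+1} = dd^c (u (dd^c u)^k).  Here T p is
   (dd^c u)^{N-p}. *)
Definition is_monge_ampere (Om : set 'CV[R]_N) (u : 'CV[R]_N -> R)
    (mu : {measure set (borelCV R N) -> \bar R}) :=
  exists T : forall p, current Om p,
    [/\ is_integration_current (T N),
        forall p, (p < N)%N -> is_ddc_mul u (T p.+1) (T p),
        forall K : set 'CV[R]_N, compact K -> K `<=` Om -> (mu K < +oo)%E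
      & forall f, test_function Om f ->
          ceval (T 0%N) [tuple] (fun z => RtoC (f z)) =
          RtoC (Rintegral mu Om f)].

End MongeAmpere.

(* Main.v *)
(* The Cayley transform zeta_k = z_(k+1) / (1 - z_1), omega = (1 + z_1) / (1 - z_1)
   carries the ball to the Siegel domain q < y, where q = |zeta_1|^2 and
   y = Re omega - sum_{l > 1} |zeta_l|^2, and the Poisson kernel to q - y.
   For c = exp (- lambda) put m(E) = c + (1 - c) / (1 + E) and let
     u = max_{E >= 0} m(E) (E + E log (q / E) - y).
   The maximum is attained at the unique E in [0, y[ solving the critical equation
   q = E exp (- s(E) (y - E)), where s = - m' / (E m)', which makes E, hence u, a
   smooth function of q and y.  The Levi form of u is a nonnegative combination of the
   squared moduli of the n forms d zeta_2, ..., d zeta_n and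
   d zeta_1 + s(E) zeta_1 dy^(1,0) on C^(n+1), so it is positive semidefinite with
   determinant 0.  As u is smooth, its Bedford-Taylor powers have smooth coefficients,
   as one sees by integrating by parts.
   The mean value inequality on a disc a + e^tau b, Re tau < 0, holds because the circle
   mean is a bounded convex function of Re tau, hence nondecreasing.  Since c <= m <= 1,
   u lies between q - y and c (q - y); it equals q - y only where q = 0, and it
   decreases strictly with c where q > 0. *)

(* For fixed E > 0 the function m(E) (E + E log (q / E) - y) is plurisubharmonic where q > 0, since
   log q is pluriharmonic there and - y is - Re omega plus squared moduli. It is affine in Re omega
   along the discs on which zeta_2, ..., zeta_n are constant and zeta_1 is a constant times exp (-
   s(E) omega / 2). Such discs sweep out the hypersurface q = E exp (- s(E) (y - E)), on which the
   maximum is attained at E: this explains both the shape of the critical equation and the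
   degenerate direction of the Levi form.

   The obstacle is the divisor q = 0, where log q is singular. The construction therefore starts
   from the critical equation, which contains no logarithm, solves it for E by monotonicity, and
   differentiates the solution. What it asks of m is that s be positive and decreasing, so that the
   right-hand side increases with E on [0, y]. The choice of m, falling from 1 at E = 0 towards c at
   infinity, gives s = (1 - c) / (1 - c + c (1 + E)^2) and keeps the identities in E rational. *)
Require Import Defs.
From HB Require Import structures.
From mathcomp Require Import all_boot all_order all_algebra.
From mathcomp Require Import all_classical all_reals all_analysis.
From mathcomp.real_closed Require Import complex.
From mathcomp Require Import perm ring lra zify measurable_realfun.
Import Order.TTheory GRing.Theory Num.Theory numFieldNormedType.Exports.
Local Open Scope classical_set_scope.
Local Open Scope ring_scope.
Set Implicit Arguments.
Unset Strict Implicit.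
Unset Printing Implicit Defensive.

(** * Complex coordinates *)

Section ComplexAlgebra.
Context {R : realType}.
Implicit Types z w : cplx R.

Lemma ReCD z w : ReC (z + w) = ReC z + ReC w. Proof. by case: z; case: w. Qed.
Lemma ImCD z w : ImC (z + w) = ImC z + ImC w. Proof. by case: z; case: w. Qed.
Lemma ReCN z : ReC (- z) = - ReC z. Proof. by case: z. Qed.
Lemma ImCN z : ImC (- z) = - ImC z. Proof. by case: z. Qed.
Lemma ReCM z w : ReC (z * w) = ReC z * ReC w - ImC z * ImC w.
Proof. by case: z; case: w. Qed.
Lemma ImCM z w : ImC (z * w) = ReC z * ImC w + ImC z * ReC w.
Proof. by case: z => a b; case: w => c d; rewrite /ReC /ImC /=. Qed.
Lemma mkCK z : mkC (ReC z) (ImC z) = z. Proof. by case: z. Qed.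
Lemma ReC_mk (x y : R) : ReC (mkC x y) = x. Proof. by []. Qed.
Lemma ImC_mk (x y : R) : ImC (mkC x y) = y. Proof. by []. Qed.
Lemma ReC0 : ReC (0 : cplx R) = 0. Proof. by []. Qed.
Lemma ImC0 : ImC (0 : cplx R) = 0. Proof. by []. Qed.
Lemma ReC1 : ReC (1 : cplx R) = 1. Proof. by []. Qed.
Lemma ImC1 : ImC (1 : cplx R) = 0. Proof. by []. Qed.
Lemma cplx_eq z w : ReC z = ReC w -> ImC z = ImC w -> z = w.
Proof. by case: z => a b; case: w => c d; rewrite /ReC /ImC /= => -> ->. Qed.

Lemma normC_sqr z : `|z| = RtoC (Num.sqrt (normC2 z)).
Proof. by rewrite [LHS]normc_def. Qed.

Lemma normC2_ge0 z : 0 <= normC2 z.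
Proof. by rewrite addr_ge0 ?sqr_ge0. Qed.

Lemma normC2M z w : normC2 (z * w) = normC2 z * normC2 w.
Proof. by rewrite /normC2 ReCM ImCM; ring. Qed.

Lemma normC2_eq0 z : (normC2 z == 0) = (z == 0).
Proof.
apply/idP/eqP => [|->]; last by rewrite /normC2 ReC0 ImC0 expr0n/= addr0.
by rewrite /normC2 paddr_eq0 ?sqr_ge0// !sqrf_eq0 => /andP[/eqP ? /eqP ?]; exact: cplx_eq.
Qed.

Lemma ltC_RtoC (x y : R) : (RtoC x < RtoC y :> cplx R) = (x < y).
Proof. exact: ltcR. Qed.

(** In the partial order of R[i] only real numbers are comparable with 0. This turns the complex
    epsilons of limits in [cplx R] into real ones. *)
Lemma RtoC_gt0P (e : cplx R) : 0 < e -> exists2 x : R, 0 < x & e = RtoC x.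
Proof.
case: e => a b; rewrite ltcE /= => /andP[/eqP -> a0].
by exists a.
Qed.

Lemma normr_ReC z : `|ReC z| <= Num.sqrt (normC2 z).
Proof. by rewrite -sqrtr_sqr ler_wsqrtr// lerDl sqr_ge0. Qed.
Lemma normr_ImC z : `|ImC z| <= Num.sqrt (normC2 z).
Proof. by rewrite -sqrtr_sqr ler_wsqrtr// lerDr sqr_ge0. Qed.

Lemma sqrt_normC2 z : Num.sqrt (normC2 z) <= `|ReC z| + `|ImC z|.
Proof.
rewrite -(@ler_pXn2r _ 2)// ?nnegrE ?addr_ge0 ?sqrtr_ge0//.
rewrite sqr_sqrtr ?normC2_ge0// /normC2 sqrrD !real_normK ?num_real//.
by rewrite lerD2r lerDl mulrn_wge0 ?mulr_ge0.
Qed.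

Lemma ReC_sum I (r : seq I) (P : pred I) (F : I -> cplx R) :
  ReC (\sum_(i <- r | P i) F i) = \sum_(i <- r | P i) ReC (F i).
Proof. by apply: (big_morph _ ReCD ReC0). Qed.
Lemma ImC_sum I (r : seq I) (P : pred I) (F : I -> cplx R) :
  ImC (\sum_(i <- r | P i) F i) = \sum_(i <- r | P i) ImC (F i).
Proof. by apply: (big_morph _ ImCD ImC0). Qed.

Lemma continuous_ReC : continuous (@ReC R).
Proof.
move=> z; pose F := nbhs z; have FF : Filter F by exact: _.
apply: (proj2 (@cvgrPdist_lt _ _ _ F FF _ _)) => e e0; apply/nbhs_ballP.
(* Balls of [cplx R] have radii in [cplx R] itself, hence the cast. *)
exists (RtoC e) => /= [|w]; first by rewrite ltC_RtoC.
rewrite -ball_normE /= normC_sqr ltC_RtoC => zw.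
by apply: le_lt_trans zw; rewrite -ReCN -ReCD normr_ReC.
Qed.

Lemma continuous_ImC : continuous (@ImC R).
Proof.
move=> z; pose F := nbhs z; have FF : Filter F by exact: _.
apply: (proj2 (@cvgrPdist_lt _ _ _ F FF _ _)) => e e0; apply/nbhs_ballP.
exists (RtoC e) => /= [|w]; first by rewrite ltC_RtoC.
rewrite -ball_normE /= normC_sqr ltC_RtoC => zw.
by apply: le_lt_trans zw; rewrite -ImCN -ImCD normr_ImC.
Qed.

Lemma cvg_mkC (T : Type) (F : set_system T) (FF : Filter F) (f g : T -> R) (a b : R) :
  f @ F --> a -> g @ F --> b -> (fun x => mkC (f x) (g x)) @ F --> (mkC a b : cplx R).
Proof.
move=> /cvgrPdist_lt fa /cvgrPdist_lt gb; apply/cvgrPdist_lt => e /RtoC_gt0P[x x0 ->].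
have x20 : 0 < x / 2 by rewrite divr_gt0.
near=> t; rewrite normC_sqr ltC_RtoC (le_lt_trans (sqrt_normC2 _))//.
rewrite ReCD ImCD ReCN ImCN !ReC_mk !ImC_mk (splitr x) ltrD//.
  by near: t; exact: fa.
by near: t; exact: gb.
Unshelve. all: by end_near. Qed.

End ComplexAlgebra.

Section Lines.
Context {R : realType} {N : nat}.
Implicit Types (a v w : 'CV[R]_N) (f g : 'CV[R]_N -> R).

Lemma cvg_rV (T : Type) (F : set_system T) (FF : Filter F) (h : T -> 'CV[R]_N) a :
  (forall j, (fun x => h x 0 j) @ F --> a 0 j) -> h @ F --> a.
Proof.
move=> ha A [P aP PA].
suff : \near F, forall j, P 0 j (h F 0 j).
  by apply: filterS => x Px; apply: PA => i j; rewrite ord1.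
by apply: filter_forall => j; apply: ha; exact: aP.
Qed.

Lemma cvg_ReCoord (T : Type) (F : set_system T) (FF : Filter F) (h : T -> 'CV[R]_N) a j :
  h @ F --> a -> (fun x => ReC (h x 0 j)) @ F --> ReC (a 0 j).
Proof.
move=> ha.
have h1 : (fun z : 'CV[R]_N => z 0 j) @ nbhs a --> a 0 j by exact: coord_continuous.
have h2 : ReC x @[x --> a 0 j] --> ReC (a 0 j) by exact: continuous_ReC.
exact: (cvg_trans (cvg_app (fun z : 'CV[R]_N => ReC (z 0 j)) ha)
        (cvg_trans (cvg_app (@ReC R) h1) h2)).
Qed.

Lemma cvg_ImCoord (T : Type) (F : set_system T) (FF : Filter F) (h : T -> 'CV[R]_N) a j :
  h @ F --> a -> (fun x => ImC (h x 0 j)) @ F --> ImC (a 0 j).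
Proof.
move=> ha.
have h1 : (fun z : 'CV[R]_N => z 0 j) @ nbhs a --> a 0 j by exact: coord_continuous.
have h2 : ImC x @[x --> a 0 j] --> ImC (a 0 j) by exact: continuous_ImC.
exact: (cvg_trans (cvg_app (fun z : 'CV[R]_N => ImC (z 0 j)) ha)
        (cvg_trans (cvg_app (@ImC R) h1) h2)).
Qed.

Lemma cvg_CV (T : Type) (F : set_system T) (FF : Filter F) (h : T -> 'CV[R]_N) a :
  (forall j, (fun x => ReC (h x 0 j)) @ F --> ReC (a 0 j)) ->
  (forall j, (fun x => ImC (h x 0 j)) @ F --> ImC (a 0 j)) -> h @ F --> a.
Proof.
move=> hr hi; apply: cvg_rV => j.
rewrite -(mkCK (a 0 j)); under eq_fun do rewrite -(mkCK (h _ _ _)).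
exact: cvg_mkC.
Qed.

(* Locked, as [rewrite] would otherwise unfold it while searching a redex. *)
Fact line_key : unit. Proof. by []. Qed.
Definition line := locked_with line_key
  (fun a v (t : R) => a + RtoC t *: v : 'CV[R]_N).

Lemma lineE a v t : line a v t = a + RtoC t *: v.
Proof. by rewrite [line]unlock. Qed.

Lemma real_lineE f a v : real_line f a v = fun t => f (line a v t).
Proof. by apply/funext => t; rewrite lineE. Qed.

Lemma ReC_line a v t j : ReC (line a v t 0 j) = ReC (a 0 j) + t * ReC (v 0 j).
Proof. by rewrite lineE !mxE ReCD ReCM /= mul0r subr0. Qed.
Lemma ImC_line a v t j : ImC (line a v t 0 j) = ImC (a 0 j) + t * ImC (v 0 j).
Proof. by rewrite lineE !mxE ImCD ImCM /= mul0r addr0. Qed.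

Lemma eqCV (a b : 'CV[R]_N) : (forall j, ReC (a 0 j) = ReC (b 0 j)) ->
  (forall j, ImC (a 0 j) = ImC (b 0 j)) -> a = b.
Proof. by move=> h1 h2; apply/rowP => j; exact: (cplx_eq (h1 j) (h2 j)). Qed.

Lemma line0 a v : line a v 0 = a.
Proof. by apply: eqCV => j; rewrite ?ReC_line ?ImC_line mul0r addr0. Qed.

Lemma lineD a v s t : line (line a v s) v t = line a v (s + t).
Proof. by apply: eqCV => j; rewrite ?ReC_line ?ImC_line mulrDl addrA. Qed.

Lemma line_comm a v w s t : line (line a v s) w t = line (line a w t) v s.
Proof. by apply: eqCV => j; rewrite ?ReC_line ?ImC_line addrAC. Qed.

Lemma cvg_line (T : Type) (F : set_system T) (FF : Filter F) (h : T -> 'CV[R]_N)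
    (s : T -> R) a v t :
  h @ F --> a -> s @ F --> t -> (fun x => line (h x) v (s x)) @ F --> line a v t.
Proof.
move=> ha st; apply: cvg_CV => j; rewrite ?ReC_line ?ImC_line;
  (under eq_fun do rewrite ?ReC_line ?ImC_line); (apply: cvgD; last by apply: cvgMl).
- exact: cvg_ReCoord.
- exact: cvg_ImCoord.
Qed.

Lemma continuous_line a v : continuous (line a v).
Proof. by move=> t; apply: cvg_line; [exact: cvg_cst|exact: cvg_id]. Qed.

Lemma near_line (Om : set 'CV[R]_N) a v : open Om -> Om a -> \forall t \near 0, Om (line a v t).
Proof.
move=> oOm Oma.
have : line a v t @[t --> 0] --> line a v 0 by exact: continuous_line.
by apply; rewrite line0; exact: open_nbhs_nbhs.
Qed.

Lemma dirDE v f a : dirD v f a = 'D_1 (real_line f a v) 0.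
Proof. by rewrite /dirD derive1E. Qed.

Lemma isDP v f a : derivable (real_line f a v) 0 1 ->
  is_derive (0 : R) (1 : R) (real_line f a v) (dirD v f a).
Proof. by move=> h; rewrite dirDE; exact: derivableP. Qed.

Lemma isD_dirD v f a l : is_derive (0 : R) (1 : R) (real_line f a v) l -> dirD v f a = l.
Proof. by move=> h; rewrite dirDE; exact: derive_val. Qed.

(** [dirD] differentiates at parameter 0 only. Moving the base point along the line gives the
    derivative at every parameter, as the mean value theorem requires. *)
Lemma isD_shift v f a s : derivable (real_line f (line a v s) v) 0 1 ->
  is_derive s (1 : R) (real_line f a v) (dirD v f (line a v s)).
Proof.
move=> /isDP h.
have E : real_line f (line a v s) v = (fun t => real_line f a v (t + s)).
  by apply/funext => t; rewrite !real_lineE lineD addrC.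
rewrite E in h.
have h' : is_derive (s - s) 1 (fun t => real_line f a v (t + s)) (dirD v f (line a v s)).
  by rewrite subrr.
have := @is_derive1_comp _ (fun t => real_line f a v (t + s)) (fun t => t - s) s
  (dirD v f (line a v s)) 1 h'.
rewrite mulr1.
have -> : (fun t => real_line f a v (t + s)) \o (fun t => t - s) = real_line f a v.
  by apply/funext => t /=; rewrite subrK.
apply. by apply: is_derive_eq; rewrite subr0.
Qed.

Section OnOpen.
Variable Om : set 'CV[R]_N.
Hypothesis oOm : open Om.

Lemma derivable_eq_on f g v a : (forall z, Om z -> f z = g z) -> Om a ->
  derivable (real_line f a v) 0 1 -> derivable (real_line g a v) 0 1.
Proof.
move=> fg Oma; apply: near_eq_derivable.
by near=> t; rewrite !real_lineE; apply: fg; near: t; exact: near_line.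
Unshelve. all: by end_near. Qed.

Lemma dirD_eq_on f g v a : (forall z, Om z -> f z = g z) -> Om a -> dirD v f a = dirD v g a.
Proof.
move=> fg Oma; rewrite !dirDE; apply: near_eq_derive.
by near=> t; rewrite !real_lineE; apply: fg; near: t; exact: near_line.
Unshelve. all: by end_near. Qed.

Lemma continuous_eq_on f g a : (forall z, Om z -> f z = g z) -> Om a ->
  {for a, continuous f} -> {for a, continuous g}.
Proof.
move=> fg Oma; rewrite /prop_for /continuous_at -(fg _ Oma) => h; apply: cvg_trans h.
have E : {near nbhs a, f =1 g} by apply: filterS (open_nbhs_nbhs (conj oOm Oma)) => z /fg.
exact: (near_eq_cvg E).
Qed.

End OnOpen.
End Lines.

(** * Smooth functions *)

Section Ck.
Context {R : realType} {N : nat}.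
Variable Om : set 'CV[R]_N.
Hypothesis oOm : open Om.
Implicit Types (f g : 'CV[R]_N -> R) (v : 'CV[R]_N).

(** The counterpart of [Cclass] relative to [Om]: the potential is known to be smooth on the ball
    only, although it is a function on the whole space. *)
Fixpoint Ck (k : nat) f : Prop :=
  (forall z, Om z -> {for z, continuous f}) /\
  (if k is k'.+1 then
    forall v, (forall z, Om z -> derivable (real_line f z v) 0 1) /\ Ck k' (dirD v f)
   else True).

Lemma Ck_ext k f g : (forall z, Om z -> f z = g z) -> Ck k f -> Ck k g.
Proof.
elim: k f g => [|k IH] f g fg /= [cf df].
  by split => // z Oz; apply: (continuous_eq_on oOm fg) => //; exact: cf.
split=> [z Oz|v]; first by apply: (continuous_eq_on oOm fg) => //; exact: cf.
have [dfv Ckf] := df v; split=> [z Oz|].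
  by apply: (derivable_eq_on oOm fg) => //; exact: dfv.
by apply: IH Ckf => z Oz; exact: (dirD_eq_on oOm).
Qed.

(** The values of [dirD v f] matter on [Om] only, so an explicit [g] with the right values there may
    replace it. Inductions on [k] then run on formulas. *)
Lemma CkSI k f : (forall z, Om z -> {for z, continuous f}) ->
  (forall v, exists g, (forall z, Om z -> is_derive (0 : R) (1 : R) (real_line f z v) (g z))
    /\ Ck k g) -> Ck k.+1 f.
Proof.
move=> cf fE; split => // v; have [g [fg Ckg]] := fE v; split=> [z /fg[]//|].
by apply: Ck_ext Ckg => z Oz; rewrite (isD_dirD (fg _ Oz)).
Qed.

Lemma Ck_cont k f z : Ck k f -> Om z -> {for z, continuous f}.
Proof. by case: k => [|k] [cf _] Oz; exact: cf. Qed.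

Lemma Ck_cvg k f z : Ck k f -> Om z -> f x @[x --> z] --> f z.
Proof. exact: Ck_cont. Qed.

Lemma Ck_pred k f : Ck k.+1 f -> Ck k f.
Proof.
elim: k f => [|k IH] f; first by case=> cf _; split.
by move=> [cf df]; split => // v; have [dv /IH] := df v.
Qed.

Lemma CkS_derive k f z v : Ck k.+1 f -> Om z ->
  is_derive (0 : R) (1 : R) (real_line f z v) (dirD v f z).
Proof. by move=> [_ df] Oz; apply: isDP; have [dv _] := df v; exact: dv. Qed.

Lemma CkS_dirD k f v : Ck k.+1 f -> Ck k (dirD v f).
Proof. by move=> [_ df]; have [_ h] := df v; exact: h. Qed.

Lemma Ck_cst k (c : R) : Ck k (fun _ => c).
Proof.
elim: k c => [|k IH] c; first by split => // z _; exact: cst_continuous.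
apply CkSI => [z _|v]; first exact: cst_continuous.
by exists (fun _ => 0); split => [z _|]; [exact: is_derive_cst|exact: IH].
Qed.

Lemma CkD k f g : Ck k f -> Ck k g -> Ck k (fun z => f z + g z).
Proof.
elim: k f g => [|k IH] f g Ckf Ckg.
  by split => // z Oz; exact: (cvgD (Ck_cvg Ckf Oz) (Ck_cvg Ckg Oz)).
apply CkSI => [z Oz|v].
  exact: (cvgD (Ck_cvg Ckf Oz) (Ck_cvg Ckg Oz)).
exists (fun z => dirD v f z + dirD v g z); split=> [z Oz|].
  have h1 := CkS_derive v Ckf Oz; have h2 := CkS_derive v Ckg Oz.
  exact: (is_deriveD h1 h2).
by apply: IH; exact: CkS_dirD.
Qed.

Lemma CkM k f g : Ck k f -> Ck k g -> Ck k (fun z => f z * g z).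
Proof.
elim: k f g => [|k IH] f g Ckf Ckg.
  by split => // z Oz; exact: (cvgM (Ck_cvg Ckf Oz) (Ck_cvg Ckg Oz)).
apply CkSI => [z Oz|v].
  exact: (cvgM (Ck_cvg Ckf Oz) (Ck_cvg Ckg Oz)).
exists (fun z => f z * dirD v g z + g z * dirD v f z); split=> [z Oz|].
  have h1 := CkS_derive v Ckf Oz; have h2 := CkS_derive v Ckg Oz.
  have := is_deriveM h1 h2; rewrite {3 4}/real_line !scale0r addr0.
  exact.
by apply: CkD; apply: IH; [exact: Ck_pred| exact: CkS_dirD |exact: Ck_pred| exact: CkS_dirD].
Qed.

(** [phi i] is the i-th derivative of one function. The whole tower is carried along because the
    chain rule moves from [phi i] to [phi i.+1] while [k] drops by one. *)
Lemma Ck_comp k f (phi : nat -> R -> R) (D : set R) :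
  (forall i x, D x -> is_derive x (1 : R) (phi i) (phi i.+1 x)) ->
  (forall z, Om z -> D (f z)) ->
  Ck k f -> forall i, Ck k (fun z => phi i (f z)).
Proof.
move=> dphi fD Ckf.
have cphi i z : Om z -> {for z, continuous (fun z => phi i (f z))}.
  move=> Oz; apply: continuous_comp; first exact: Ck_cont Ckf Oz.
  have [+ _] := dphi i _ (fD _ Oz).
  by move=> /derivable1_diffP/differentiable_continuous.
elim: k Ckf => [|k IH] Ckf i; first by split => // z; exact: cphi.
apply CkSI => [z Oz|v]; first exact: cphi.
exists (fun z => phi i.+1 (f z) * dirD v f z); split=> [z Oz|].
  have h := CkS_derive v Ckf Oz.
  have E : real_line f z v 0 = f z by rewrite real_lineE line0.
  have h' : is_derive (real_line f z v 0) 1 (phi i) (phi i.+1 (f z)).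
    by rewrite E; apply: dphi; exact: fD.
  exact: (@is_derive1_comp _ (phi i) (real_line f z v) 0 _ _ h' h).
by apply: CkM; [apply: IH; exact: Ck_pred|exact: CkS_dirD].
Qed.

Definition Cinf f := forall k, Ck k f.

Lemma Cinf_ext f g : (forall z, Om z -> f z = g z) -> Cinf f -> Cinf g.
Proof. by move=> fg h k; exact: Ck_ext fg (h k). Qed.

Lemma Cinf_cst (c : R) : Cinf (fun _ => c). Proof. by move=> k; exact: Ck_cst. Qed.

Lemma CinfD f g : Cinf f -> Cinf g -> Cinf (fun z => f z + g z).
Proof. by move=> hf hg k; exact: CkD. Qed.

Lemma CinfM f g : Cinf f -> Cinf g -> Cinf (fun z => f z * g z).
Proof. by move=> hf hg k; exact: CkM. Qed.

Lemma CinfN f : Cinf f -> Cinf (fun z => - f z).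
Proof.
move=> hf; apply: (@Cinf_ext (fun z => (-1) * f z)) => [z _|]; first by rewrite mulN1r.
by apply: CinfM => //; exact: Cinf_cst.
Qed.

Lemma CinfB f g : Cinf f -> Cinf g -> Cinf (fun z => f z - g z).
Proof. by move=> hf hg; apply: CinfD => //; exact: CinfN. Qed.

Lemma CkV k f : (forall z, Om z -> f z != 0) -> Ck k f -> Ck k (fun z => (f z)^-1).
Proof.
move=> f0; have cV j z : Ck j f -> Om z -> {for z, continuous (fun z => (f z)^-1)}.
  move=> hf Oz; exact: (cvgV (f0 _ Oz) (Ck_cvg hf Oz)).
elim: k => [|k IH] hf; first by split => // z; exact: cV hf.
apply CkSI => [z|v]; first exact: cV hf.
exists (fun z => - ((f z)^-1 * (f z)^-1 * dirD v f z)); split=> [z Oz|].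
  have h := CkS_derive v hf Oz.
  have E : real_line f z v 0 = f z by rewrite real_lineE line0.
  have nz : real_line f z v 0 != 0 by rewrite E f0.
  have := is_deriveV nz h; rewrite E => h'.
  apply: is_derive_eq h' _.
  by rewrite -mulNr -exprVn expr2.
apply: (@Ck_ext _ (fun z => (-1) * ((f z)^-1 * (f z)^-1 * dirD v f z))) => [z _|].
  by rewrite mulN1r.
have fk := Ck_pred hf.
apply: CkM; first exact: Ck_cst.
by apply: CkM; [apply: CkM; exact: IH|exact: CkS_dirD].
Qed.

Lemma CinfV f : (forall z, Om z -> f z != 0) -> Cinf f -> Cinf (fun z => (f z)^-1).
Proof. by move=> f0 hf k; exact: CkV. Qed.

Lemma Ck_expR k f : Ck k f -> Ck k (fun z => expR (f z)).
Proof.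
by move=> hf; apply: (@Ck_comp k f (fun=> expR) setT) => // i x _; exact: is_derive_expR.
Qed.

Lemma Cinf_expR f : Cinf f -> Cinf (fun z => expR (f z)).
Proof. by move=> hf k; exact: Ck_expR. Qed.

Lemma Cinf_sin f : Cinf f -> Cinf (fun z => sin (f z)).
Proof.
move=> hf k.
(* The derivatives of the sine repeat with period 4. *)
pose phi (i : nat) : R -> R := nth (@sin R) [:: @sin R; @cos R; (fun x => - sin x); (fun x => - cos x)] (i %% 4)%N.
apply: (@Ck_comp k f phi setT _ _ (hf k) 0%N) => // i x _.
have : (i %% 4 < 4)%N by rewrite ltn_mod.
have -> : phi i.+1 = nth (@sin R) [:: @sin R; @cos R; (fun x => - sin x); (fun x => - cos x)] (((i %% 4).+1 %% 4)%N).
  by rewrite /phi -addn1 -modnDml addn1.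
rewrite /phi; case: (i %% 4)%N => [|[|[|[|//]]]] _ /=.
- exact: is_derive_sin.
- exact: is_derive_cos.
- exact: is_deriveN.
- by rewrite -[sin x]opprK; exact: is_deriveN.
Qed.

Lemma Cinf_cos f : Cinf f -> Cinf (fun z => cos (f z)).
Proof.
move=> hf; apply: (@Cinf_ext (fun z => sin (f z + pi / 2))) => [z _|].
  by rewrite sinD cos_pihalf sin_pihalf mulr0 mulr1 add0r.
by apply: Cinf_sin; apply: CinfD => //; exact: Cinf_cst.
Qed.

Lemma Cinf_dirD f v : Cinf f -> Cinf (dirD v f).
Proof. by move=> hf k; exact: CkS_dirD (hf k.+1). Qed.

Lemma Cinf_sum I (r : seq I) (P : pred I) (F : I -> 'CV[R]_N -> R) :
  (forall i, Cinf (F i)) -> Cinf (fun z => \sum_(i <- r | P i) F i z).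
Proof.
move=> hF; elim: r => [|i r IH].
  by apply: Cinf_ext (Cinf_cst 0) => z _; rewrite big_nil.
have [Pi|nPi] := boolP (P i).
  by apply: Cinf_ext (CinfD (hF i) IH) => z _; rewrite big_cons Pi.
by apply: Cinf_ext IH => z _; rewrite big_cons (negbTE nPi).
Qed.

Lemma dirDM f g v z : Ck 1 f -> Ck 1 g -> Om z ->
  dirD v (fun z => f z * g z) z = dirD v f z * g z + f z * dirD v g z.
Proof.
move=> hf hg Oz; apply: isD_dirD.
have := is_deriveM (CkS_derive v hf Oz) (CkS_derive v hg Oz).
rewrite !real_lineE line0 => h; apply: is_derive_eq h _.
by rewrite addrC; congr (_ + _); rewrite mulrC.
Qed.

Lemma dirDD f g v z : Ck 1 f -> Ck 1 g -> Om z ->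
  dirD v (fun z => f z + g z) z = dirD v f z + dirD v g z.
Proof.
move=> hf hg Oz; apply: isD_dirD.
exact: is_deriveD (CkS_derive v hf Oz) (CkS_derive v hg Oz).
Qed.

Lemma dirD_cst (c : R) v z : dirD v (fun _ => c) z = 0.
Proof. by apply: isD_dirD; exact: is_derive_cst. Qed.

Lemma dirD_comp f (phi : R -> R) l v z : Ck 1 f -> Om z -> is_derive (f z) (1 : R) phi l ->
  dirD v (fun z => phi (f z)) z = l * dirD v f z.
Proof.
move=> hf Oz dphi; apply: isD_dirD.
have h' : is_derive (real_line f z v 0) 1 phi l by rewrite real_lineE line0.
exact: (@is_derive1_comp _ phi (real_line f z v) 0 _ _ h' (CkS_derive v hf Oz)).
Qed.

End Ck.

Lemma MVT_line {R : realType} (f df : R -> R) (d : R) : 0 < d ->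
  (forall x, 0 <= x <= d -> is_derive x (1 : R) f (df x)) ->
  exists2 c, 0 <= c <= d & f d - f 0 = df c * d.
Proof.
move=> d0 fdf.
have h1 x : x \in `]0, d[ -> is_derive x (1 : R) f (df x).
  by rewrite in_itv/= => /andP[x0 xd]; apply: fdf; rewrite !ltW.
have h2 : {within `[0, d], continuous f}.
  by apply: derivable_within_continuous => x; rewrite in_itv/= => /fdf [].
have [c] := MVT_segment (ltW d0) h1 h2.
by rewrite in_itv/= subr0 => c0d ->; exists c.
Qed.

(** * Symmetry of second derivatives *)

Section Clairaut.
Context {R : realType} {N : nat}.
Variable Om : set 'CV[R]_N.
Hypothesis oOm : open Om.
Implicit Types (f g : 'CV[R]_N -> R) (v w : 'CV[R]_N).

(** The mean value theorem is used twice: along [v] for the increment of [f] in direction [w], then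
    along [w] for [dirD v f]. The left-hand side is symmetric in [v] and [w], the right-hand side is
    not. *)
Lemma second_difference f v w z (d : R) : Ck Om 2 f -> 0 < d ->
  (forall s t, 0 <= s <= d -> 0 <= t <= d -> Om (line (line z v s) w t)) ->
  exists s t, [/\ 0 <= s <= d, 0 <= t <= d &
    f (line (line z v d) w d) - f (line z v d) - f (line z w d) + f z =
    d ^+ 2 * dirD w (dirD v f) (line (line z v s) w t)].
Proof.
move=> hf d0 hOm.
have d00 : 0 <= (0 : R) <= d by rewrite lexx ltW.
have ddd : 0 <= d <= d by rewrite lexx ltW.
have h1 s : 0 <= s <= d -> is_derive s (1 : R)
    (fun s => f (line (line z v s) w d) - f (line z v s))
    (dirD v f (line (line z v s) w d) - dirD v f (line z v s)).
  move=> s0d; apply: is_deriveB.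
    have -> : (fun s => f (line (line z v s) w d)) = real_line f (line z w d) v.
      by apply/funext => x; rewrite real_lineE line_comm.
    rewrite line_comm; apply: isD_shift; rewrite -line_comm.
    by have [] := CkS_derive v (Ck_pred hf) (hOm _ _ s0d ddd).
  rewrite -real_lineE; apply: isD_shift.
  have := hOm _ _ s0d d00; rewrite line0 => O1.
  by have [] := CkS_derive v (Ck_pred hf) O1.
have [s s0d sE] := MVT_line d0 h1.
have h2 t : 0 <= t <= d -> is_derive t (1 : R)
    (fun t => dirD v f (line (line z v s) w t)) (dirD w (dirD v f) (line (line z v s) w t)).
  move=> t0d; rewrite -real_lineE; apply: isD_shift.
  by have [] := CkS_derive w (CkS_dirD v hf) (hOm _ _ s0d t0d).
have [t t0d tE] := MVT_line d0 h2.
exists s, t; split => //.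
move: tE sE; rewrite !line0 => -> E.
transitivity (f (line (line z v d) w d) - f (line z v d) - (f (line z w d) - f z)).
  by ring.
by rewrite E; ring.
Qed.

Lemma near_line2 (P : set 'CV[R]_N) z v w : nbhs z P ->
  exists2 d : R, 0 < d & forall s t, 0 <= s <= d -> 0 <= t <= d -> P (line (line z v s) w t).
Proof.
move=> zP.
have : line (line z v x.1) w x.2 @[x --> ((0, 0) : R * R)] --> z.
  have := @cvg_line R N (R * R)%type (nbhs ((0, 0) : R * R)) _
    (fun x => line z v x.1) (fun x => x.2) (line z v 0) w 0.
  rewrite !line0; apply; last exact: cvg_snd.
  have := @cvg_line R N (R * R)%type (nbhs ((0, 0) : R * R)) _
    (fun x => z) (fun x => x.1) z v 0.
  by rewrite line0; apply; [exact: cvg_cst|exact: cvg_fst].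
move=> /(_ P zP) /nbhs_ballP [e /= e0 he].
exists (e / 2) => [|s t /andP[s0 se] /andP[t0 te]]; first by rewrite divr_gt0.
apply: (he (s, t)); split; rewrite -ball_normE /= sub0r normrN ger0_norm//.
  by rewrite (le_lt_trans se)// ltr_pdivrMr// ltr_pMr// ltr1n.
by rewrite (le_lt_trans te)// ltr_pdivrMr// ltr_pMr// ltr1n.
Qed.

(** Applied in both orders, [second_difference] makes the two mixed derivatives equal at two points
    of a small parallelogram. By continuity each value is within [e / 2] of the value at [z]. *)
Lemma Clairaut f v w z : Ck Om 2 f -> Om z -> dirD v (dirD w f) z = dirD w (dirD v f) z.
Proof.
move=> hf Oz.
apply/eqP; rewrite -subr_eq0 -normr_le0; apply/ler_addgt0Pr => e e0; rewrite add0r.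
have e20 : 0 < e / 2 by rewrite divr_gt0.
have cB : dirD w (dirD v f) x @[x --> z] --> dirD w (dirD v f) z.
  exact: (Ck_cvg (CkS_dirD w (CkS_dirD v hf)) Oz).
have cA : dirD v (dirD w f) x @[x --> z] --> dirD v (dirD w f) z.
  exact: (Ck_cvg (CkS_dirD v (CkS_dirD w hf)) Oz).
pose P x := [/\ Om x, `|dirD w (dirD v f) z - dirD w (dirD v f) x| < e / 2 &
  `|dirD v (dirD w f) z - dirD v (dirD w f) x| < e / 2].
have zP : nbhs z P.
  have FF : Filter (nbhs z) by exact: nbhs_filter.
  have h1 : nbhs z Om by exact: open_nbhs_nbhs.
  have h2 := proj1 (@cvgrPdist_lt _ _ _ (nbhs z) FF _ _) cB _ e20.
  have h3 := proj1 (@cvgrPdist_lt _ _ _ (nbhs z) FF _ _) cA _ e20.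
  refine (@filterS3 _ (nbhs z) FF _ _ _ _ _ h1 h2 h3).
  by move=> x a b c; exact: And3 a b c.
have [d1 d10 h1] := near_line2 v w zP.
have [s [t [s0 t0 E1]]] := second_difference hf d10 (fun s t hs ht => let: And3 o _ _ := h1 s t hs ht in o).
have h2 s' t' : 0 <= s' <= d1 -> 0 <= t' <= d1 -> Om (line (line z w s') v t').
  by move=> hs ht; rewrite line_comm; have [] := h1 _ _ ht hs.
have [t' [s' [t0' s0' E2]]] := second_difference hf d10 h2.
have E : dirD w (dirD v f) (line (line z v s) w t) = dirD v (dirD w f) (line (line z w t') v s').
  have d2 : d1 ^+ 2 != 0 by rewrite expf_neq0// gt_eqF.
  apply: (mulfI d2); apply: etrans (esym E1) _; apply: etrans _ E2.
  by rewrite (line_comm z v w); ring.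
have [_ hB _] := h1 s t s0 t0.
have := h1 s' t' s0' t0'; rewrite (line_comm z v w) => -[_ _ hA].
rewrite E in hB.
set m := dirD v (dirD w f) _ in hA hB.
rewrite (splitr e); apply: le_trans (lerD (ltW hA) (ltW hB)).
by rewrite [X in _ <= _ + X]distrC; exact: ler_distD.
Qed.

End Clairaut.

(** * Wirtinger derivatives *)

Lemma wdD_subproof (K : comPzRingType) (c s a b x y : K) :
  c * ((a + b) + s * (x + y)) = c * (a + s * x) + c * (b + s * y).
Proof. by ring. Qed.

Lemma wdM_subproof (K : comPzRingType) (c s a a' b b' f g : K) :
  c * ((a * g + f * a') + s * (b * g + f * b')) =
  c * (a + s * b) * g + f * (c * (a' + s * b')).
Proof. by ring. Qed.

Section ComplexCalculus.
Context {R : realType} {N : nat}.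
Variable Om : set 'CV[R]_N.
Hypothesis oOm : open Om.
Implicit Types (F G : 'CV[R]_N -> cplx R) (v w : 'CV[R]_N) (s t c : cplx R).

Definition cj c : cplx R := mkC (ReC c) (- ImC c).

Lemma cjM c s : cj (c * s) = cj c * cj s.
Proof. by apply: cplx_eq; rewrite ?(ReCM, ImCM, ReC_mk, ImC_mk); ring. Qed.
Lemma cjD c s : cj (c + s) = cj c + cj s.
Proof. by apply: cplx_eq; rewrite ?(ReCD, ImCD, ReC_mk, ImC_mk); ring. Qed.
Lemma cjN c : cj (- c) = - cj c.
Proof. by apply: cplx_eq; rewrite ?(ReCN, ImCN, ReC_mk, ImC_mk); ring. Qed.
Lemma cjK c : cj (cj c) = c.
Proof. by apply: cplx_eq; rewrite ?(ReC_mk, ImC_mk); ring. Qed.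

Definition CinfC F := Cinf Om (fun z => ReC (F z)) /\ Cinf Om (fun z => ImC (F z)).

Lemma CinfC_ext F G : (forall z, Om z -> F z = G z) -> CinfC F -> CinfC G.
Proof.
by move=> FG [h1 h2]; split;
  [apply: Cinf_ext h1|apply: Cinf_ext h2] => // z Oz; rewrite FG.
Qed.

Lemma CinfC_cst c : CinfC (fun _ => c).
Proof. by split; exact: Cinf_cst. Qed.

Lemma CinfC_RtoC f : Cinf Om f -> CinfC (fun z => RtoC (f z)).
Proof. by move=> hf; split => //; exact: Cinf_cst. Qed.

Lemma CinfC_cj F : CinfC F -> CinfC (fun z => cj (F z)).
Proof. by move=> [h1 h2]; split => //; exact: CinfN. Qed.

Lemma CinfCD F G : CinfC F -> CinfC G -> CinfC (fun z => F z + G z).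
Proof.
move=> [f1 f2] [g1 g2]; split.
  by apply: Cinf_ext (CinfD oOm f1 g1) => // z _; rewrite ReCD.
by apply: Cinf_ext (CinfD oOm f2 g2) => // z _; rewrite ImCD.
Qed.

Lemma CinfCN F : CinfC F -> CinfC (fun z => - F z).
Proof.
move=> [f1 f2]; split.
  by apply: Cinf_ext (CinfN oOm f1) => // z _; rewrite ReCN.
by apply: Cinf_ext (CinfN oOm f2) => // z _; rewrite ImCN.
Qed.

Lemma CinfCM F G : CinfC F -> CinfC G -> CinfC (fun z => F z * G z).
Proof.
move=> [f1 f2] [g1 g2]; split.
  by apply: Cinf_ext (CinfB oOm (CinfM oOm f1 g1) (CinfM oOm f2 g2)) => // z _; rewrite ReCM.
by apply: Cinf_ext (CinfD oOm (CinfM oOm f1 g2) (CinfM oOm f2 g1)) => // z _; rewrite ImCM.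
Qed.

Lemma CinfC_normC2 F : CinfC F -> Cinf Om (fun z => normC2 (F z)).
Proof.
move=> [f1 f2].
by apply: Cinf_ext (CinfD oOm (CinfM oOm f1 f1) (CinfM oOm f2 f2)) => // z _; rewrite /normC2 !expr2.
Qed.

Lemma mulC_cj c : c * cj c = RtoC (normC2 c).
Proof. by apply: cplx_eq; rewrite ?(ReCM, ImCM, ReC_mk, ImC_mk) /normC2; ring. Qed.

Lemma invC_cj c : c != 0 -> c^-1 = cj c * RtoC (normC2 c)^-1.
Proof.
move=> c0; apply: (mulfI c0); rewrite mulfV// mulrA mulC_cj.
by apply: cplx_eq; rewrite ?(ReCM, ImCM, ReC_mk, ImC_mk) mul0r ?mulr0 ?subr0 ?addr0// mulfV// normC2_eq0.
Qed.

Lemma CinfCV F : (forall z, Om z -> F z != 0) -> CinfC F -> CinfC (fun z => (F z)^-1).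
Proof.
move=> F0 hF; apply: (@CinfC_ext (fun z => cj (F z) * RtoC (normC2 (F z))^-1)).
  by move=> z Oz; rewrite invC_cj ?F0.
apply: CinfCM; first exact: CinfC_cj.
apply: CinfC_RtoC; apply: CinfV => //; last exact: CinfC_normC2.
by move=> z Oz; rewrite normC2_eq0 F0.
Qed.

Lemma CinfC_sum I (r : seq I) (P : pred I) (F : I -> 'CV[R]_N -> cplx R) :
  (forall i, CinfC (F i)) -> CinfC (fun z => \sum_(i <- r | P i) F i z).
Proof.
move=> hF; split.
  apply: (@Cinf_ext _ _ _ oOm (fun z => \sum_(i <- r | P i) ReC (F i z))).
    by move=> z _; rewrite ReC_sum.
  by apply: Cinf_sum => // i; exact: (hF i).1.
apply: (@Cinf_ext _ _ _ oOm (fun z => \sum_(i <- r | P i) ImC (F i z))).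
  by move=> z _; rewrite ImC_sum.
by apply: Cinf_sum => // i; exact: (hF i).2.
Qed.

(* Locked, to prevent conversion tests between derivatives from unfolding limits. *)
Fact cder_key : unit. Proof. by []. Qed.
Definition cder := locked_with cder_key (@dirDC R N).

Lemma cder_ext F G v z : (forall z, Om z -> F z = G z) -> Om z -> cder v F z = cder v G z.
Proof.
by move=> FG Oz; rewrite [cder]unlock; congr mkC; apply: (dirD_eq_on oOm) => // x Ox; rewrite FG.
Qed.

Lemma cder_cst c v z : cder v (fun _ => c) z = 0.
Proof. by rewrite [cder]unlock /dirDC !dirD_cst. Qed.

Lemma cderD F G v z : CinfC F -> CinfC G -> Om z ->
  cder v (fun z => F z + G z) z = cder v F z + cder v G z.
Proof.
move=> [f1 f2] [g1 g2] Oz; rewrite [cder]unlock; apply: cplx_eq; rewrite ?(ReCD, ImCD, ReC_mk, ImC_mk).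
  rewrite -(dirDD v (f1 1%N) (g1 1%N) Oz); apply: (dirD_eq_on oOm) => // x _.
  exact: ReCD.
rewrite -(dirDD v (f2 1%N) (g2 1%N) Oz); apply: (dirD_eq_on oOm) => // x _.
exact: ImCD.
Qed.

Lemma dirDB f g v z : Cinf Om f -> Cinf Om g -> Om z ->
  dirD v (fun z => f z - g z) z = dirD v f z - dirD v g z.
Proof.
move=> hf hg Oz; apply: isD_dirD.
exact: is_deriveB (CkS_derive v (hf 1%N) Oz) (CkS_derive v (hg 1%N) Oz).
Qed.

Lemma cderM F G v z : CinfC F -> CinfC G -> Om z ->
  cder v (fun z => F z * G z) z = cder v F z * G z + F z * cder v G z.
Proof.
move=> [f1 f2] [g1 g2] Oz; rewrite [cder]unlock; apply: cplx_eq; rewrite ?(ReCD, ImCD, ReCM, ImCM, ReC_mk, ImC_mk).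
  transitivity (dirD v (fun x => ReC (F x) * ReC (G x) - ImC (F x) * ImC (G x)) z).
    by apply: (dirD_eq_on oOm) => // x _; exact: ReCM.
  rewrite dirDB//; [|exact: CinfM|exact: CinfM].
  by rewrite !(@dirDM _ _ Om)//; ring.
transitivity (dirD v (fun x => ReC (F x) * ImC (G x) + ImC (F x) * ReC (G x)) z).
  by apply: (dirD_eq_on oOm) => // x _; exact: ImCM.
rewrite (@dirDD _ _ Om)//; [|exact: CinfM|exact: CinfM].
by rewrite !(@dirDM _ _ Om)//; ring.
Qed.

Lemma CinfC_cder v F : CinfC F -> CinfC (cder v F).
Proof. by rewrite [cder]unlock => -[f1 f2]; split; exact: Cinf_dirD. Qed.

Lemma cder_comm v w F z : CinfC F -> Om z -> cder v (cder w F) z = cder w (cder v F) z.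
Proof.
rewrite [cder]unlock => -[f1 f2] Oz.
have e1 := Clairaut oOm v w (f1 2%N) Oz.
have e2 := Clairaut oOm v w (f2 2%N) Oz.
exact (congr2 mkC e1 e2).
Qed.

(* [d] is a pair of real directions; the locked pair [ej j] spans the [j]-th
   coordinate line, and then [wd s] is [dz j] for [s = - Ci] and [dzbar j] for
   [s = Ci]. *)
Definition wd s (d : 'CV[R]_N * 'CV[R]_N) F : 'CV[R]_N -> cplx R := fun z =>
  2^-1 * (cder d.1 F z + s * cder d.2 F z).

Fact ej_key : unit. Proof. by []. Qed.
Definition ej := locked_with ej_key
  (fun j : 'I_N => (delta_mx 0 j, Ci *: delta_mx 0 j) : 'CV[R]_N * 'CV[R]_N).

Lemma dzE j F z : dz j F z = wd (- Ci) (ej j) F z.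
Proof. by rewrite /dz /wd [ej]unlock [cder]unlock mulNr. Qed.
Lemma dzbarE j F z : dzbar j F z = wd Ci (ej j) F z.
Proof. by rewrite /wd [ej]unlock [cder]unlock. Qed.

Lemma wd_ext s d F G z : (forall z, Om z -> F z = G z) -> Om z -> wd s d F z = wd s d G z.
Proof.
move=> FG Oz; rewrite /wd (cder_ext d.1 FG Oz).
by rewrite (cder_ext d.2 FG Oz).
Qed.

Lemma wd_cst s d c z : wd s d (fun _ => c) z = 0.
Proof. by rewrite /wd !cder_cst mulr0 addr0 mulr0. Qed.

Lemma wdD s d F G z : CinfC F -> CinfC G -> Om z ->
  wd s d (fun z => F z + G z) z = wd s d F z + wd s d G z.
Proof. move=> hF hG Oz; rewrite /wd (cderD d.1 hF hG Oz).
rewrite (cderD d.2 hF hG Oz); exact: wdD_subproof. Qed.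

Lemma wdM s d F G z : CinfC F -> CinfC G -> Om z ->
  wd s d (fun z => F z * G z) z = wd s d F z * G z + F z * wd s d G z.
Proof. move=> hF hG Oz; rewrite /wd (cderM d.1 hF hG Oz).
rewrite (cderM d.2 hF hG Oz); exact: wdM_subproof. Qed.

Lemma wdMl s d c G z : CinfC G -> Om z -> wd s d (fun z => c * G z) z = c * wd s d G z.
Proof.
by move=> hG Oz; rewrite (wdM s d (CinfC_cst c) hG Oz) wd_cst mul0r add0r.
Qed.

Lemma wdN s d G z : CinfC G -> Om z -> wd s d (fun z => - G z) z = - wd s d G z.
Proof.
move=> hG Oz; rewrite -[RHS]mulN1r -(wdMl s d (-1) hG Oz).
by apply: wd_ext => // x _; rewrite mulN1r.
Qed.

Lemma wd_sum s d I (r : seq I) (P : pred I) (F : I -> 'CV[R]_N -> cplx R) z :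
  (forall i, CinfC (F i)) -> Om z ->
  wd s d (fun z => \sum_(i <- r | P i) F i z) z = \sum_(i <- r | P i) wd s d (F i) z.
Proof.
move=> hF Oz; elim: r => [|i r IH].
  rewrite big_nil -[RHS](wd_cst s d 0 z); apply: wd_ext => // x _.
  by rewrite big_nil.
rewrite big_cons -IH; have [Pi|nPi] := boolP (P i).
  rewrite -(wdD s d (hF i) (CinfC_sum r P hF) Oz).
  by apply: wd_ext => // x _; rewrite big_cons Pi.
by apply: wd_ext => // x _; rewrite big_cons (negbTE nPi).
Qed.

Lemma CinfC_wd s d F : CinfC F -> CinfC (wd s d F).
Proof.
move=> hF; apply: CinfCM; first exact: CinfC_cst.
apply: CinfCD; first exact: CinfC_cder.
by apply: CinfCM; [exact: CinfC_cst|exact: CinfC_cder].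
Qed.

Lemma cderMl v c G z : CinfC G -> Om z -> cder v (fun z => c * G z) z = c * cder v G z.
Proof.
by move=> hG Oz; rewrite (cderM v (CinfC_cst c) hG Oz) cder_cst mul0r add0r.
Qed.

Lemma cder_wd v s d F z : CinfC F -> Om z -> cder v (wd s d F) z = wd s d (cder v F) z.
Proof.
move=> hF Oz.
have h1 := CinfC_cder d.1 hF.
have h2 := CinfC_cder d.2 hF.
have h3 := CinfCM (CinfC_cst s) h2.
rewrite /wd (cderMl v 2^-1 (CinfCD h1 h3) Oz) (cderD v h1 h3 Oz) (cderMl v s h2 Oz).
by rewrite (cder_comm v d.1 hF Oz) (cder_comm v d.2 hF Oz).
Qed.

Lemma wd_comm s t d k F z : CinfC F -> Om z -> wd s d (wd t k F) z = wd t k (wd s d F) z.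
Proof.
move=> hF Oz.
have h1 := CinfC_cder d.1 hF.
have h2 := CinfC_cder d.2 hF.
have h3 := CinfCM (CinfC_cst s) h2.
have E : wd t k (wd s d F) z = 2^-1 * (wd t k (cder d.1 F) z +
    s * wd t k (cder d.2 F) z).
  transitivity (2^-1 * wd t k (fun z => cder d.1 F z +
     s * cder d.2 F z) z).
    exact: (wdMl t k 2^-1 (CinfCD h1 h3) Oz).
  by rewrite (wdD t k h1 h3 Oz) (wdMl t k s h2 Oz).
rewrite E {1}/wd (cder_wd d.1 _ _ hF Oz).
by rewrite (cder_wd d.2 _ _ hF Oz).
Qed.

(** The directions in [d] are real, so conjugation only acts on the scalar [s]; for [s = Ci] this
    exchanges [dz] and [dzbar]. *)
Lemma wd_cj s d F z : CinfC F -> Om z -> wd s d (fun z => cj (F z)) z = cj (wd (cj s) d F z).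
Proof.
move=> [f1 f2] Oz.
have E v : cder v (fun z => cj (F z)) z = cj (cder v F z).
  rewrite [cder]unlock; congr mkC; apply: isD_dirD; exact: is_deriveN (CkS_derive v (f2 1%N) Oz).
rewrite /wd !E cjM cjD cjM cjK; congr (_ * _).
by apply: cplx_eq; rewrite ?invC_cj ?normC2_eq0 ?pnatr_eq0//= /normC2 ?(ReCM, ImCM, ReC_mk, ImC_mk)/=; ring.
Qed.

End ComplexCalculus.

Lemma Cclass_Ck {R : realType} {N : nat} (Om : set 'CV[R]_N) k (f : 'CV[R]_N -> R) :
  Cclass k f -> Ck Om k f.
Proof.
elim: k f => [|k IH] f /=; first by move=> cf; split => // z _; exact: cf.
move=> [cf df]; split => [z _|v]; first exact: cf.
have [dv Cv] := df v; split; last exact: IH.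
by move=> z _; exact: dv.
Qed.

(** * Lebesgue measure *)

Section LebesgueTranslation.
Context {R : realType}.

Lemma measurable_shift (h : R) :
  measurable_fun [set: measurableTypeR R] (fun t : measurableTypeR R => t + h : measurableTypeR R).
Proof.
apply: continuous_measurable_fun => t; apply: cvgD; [exact: cvg_id|exact: cvg_cst].
Qed.

Lemma lebesgue_measure_shift (h : R) (A : set (measurableTypeR R)) : measurable A ->
  lebesgue_measure [set t : R | A (t + h)] = lebesgue_measure A.
Proof.
move=> mA; symmetry.
pose m := measure_function_pushforward__canonical__measure_function_Measure
  (@lebesgue_measure R) (measurable_shift h).
rewrite -[RHS]/(m A); apply: lebesgue_measure_unique => // _ [[a b] _ <-] /=.
rewrite /pushforward (_ : _ @^-1` _ = `]a - h, b - h]%classic); last first.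
  by apply/seteqP; split => t /=; rewrite !in_itv/= ltrBlDr lerBrDr.
rewrite !lebesgue_measure_itv/= !lte_fin ltrD2r; case: ifP => // _.
by rewrite -!EFinD opprB addrA subrK.
Qed.

End LebesgueTranslation.

Section OpenProduct.
Context {R : realType} {N : nat}.

(** A countable base of the real factor suffices. Over each rational interval, [U] collects all open
    sets whose product with that interval lies in [O]; it is open, and [O] is the countable union of
    the resulting products. *)
Lemma open_prod_measurable (O : set ('CV[R]_N * R)) : open O ->
  measurable (O : set (borelCV R N * measurableTypeR R)).
Proof.
move=> oO.
pose U (pq : rat * rat) : set 'CV[R]_N :=
  \bigcup_(V in [set V | open V /\ V `*` `]ratr pq.1, ratr pq.2[%classic `<=` O]) V.
rewrite (_ : O = \bigcup_(pq in [set: rat * rat]) (U pq `*` `]ratr pq.1, ratr pq.2[%classic)); last first.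
  apply/seteqP; split => [[z t] Ozt|[z t] [pq _ [[V [oV VO] Vz] tpq]]]; last exact: (VO (z, t)).
  have : nbhs (z, t) O by exact: open_nbhs_nbhs.
  move=> [[/= P Q] [zP tQ] PQO].
  move: tQ => /nbhs_ballP[e /= e0 teQ].
  have /rat_in_itvoo[p] : t - e < t by rewrite ltrBlDr ltrDl.
  rewrite in_itv/= => /andP[ep pt].
  have /rat_in_itvoo[q] : t < t + e by rewrite ltrDl.
  rewrite in_itv/= => /andP[tq qe].
  exists (p, q) => //; split; last by rewrite /= in_itv/= pt tq.
  exists (@interior 'CV[R]_N P); last exact: zP.
  split; first exact: open_interior.
  move=> [x y] [/= Px]; rewrite in_itv/= => /andP[py yq].
  apply: PQO; split => /=; first exact: interior_subset.
  apply: teQ; rewrite -ball_normE /= ltr_norml; apply/andP; split.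
    by rewrite ltrNl opprB ltrBlDl (lt_trans yq).
  by rewrite ltrBlDr -ltrBlDl (lt_trans ep).
apply: countable_bigcupT_measurable => // pq; apply: measurableX.
  apply: sub_sigma_algebra; apply: bigcup_open => V [oV _]; exact: oV.
exact: measurable_itv.
Qed.

Lemma continuous_measurable_CV (f : 'CV[R]_N -> 'CV[R]_N) : continuous f ->
  measurable_fun [set: borelCV R N] (f : borelCV R N -> borelCV R N).
Proof.
move=> cf; apply: (@measurability _ _ (borelCV R N) (borelCV R N) setT f (@open 'CV[R]_N)) ; first by [].
move=> A [V oV <-].
rewrite setTI; apply: sub_sigma_algebra.
by move/continuousP : cf; apply.
Qed.

Lemma continuous_measurable_prod (f : 'CV[R]_N * R -> 'CV[R]_N) : continuous f ->
  measurable_fun [set: borelCV R N * measurableTypeR R]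
    (f : (borelCV R N * measurableTypeR R)%type -> borelCV R N).
Proof.
move=> cf; apply: (@measurability _ _ (borelCV R N * measurableTypeR R)%type (borelCV R N) setT f (@open 'CV[R]_N)) ; first by [].
move=> A [V oV <-].
rewrite setTI; apply: open_prod_measurable.
by move/continuousP : cf; apply.
Qed.

End OpenProduct.

Section LebesgueCV.
Context {R : realType} {N : nat}.
Local Open Scope ereal_scope.
Let X := borelCV R N.
Let leb := @lebesgue_measure R.

(* [(j, false)] and [(j, true)] index the real and imaginary parts of z_j. *)
Definition rcoord (i : 'I_N * bool) (z : 'CV[R]_N) : R :=
  if i.2 then ImC (z ord0 i.1) else ReC (z ord0 i.1).

Definition rvec (i : 'I_N * bool) : 'CV[R]_N := if i.2 then (ej i.1).2 else (ej i.1).1.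

Lemma rcoord_line i k z t : rcoord i (line z (rvec k) t) = (rcoord i z + t * (i == k)%:R)%R.
Proof.
case: i => i b; case: k => k c.
have -> : ((i, b) == (k, c)) = (i == k) && (b == c) by rewrite xpair_eqE.
rewrite /rcoord /rvec [ej]unlock /=.
have E : (delta_mx (0%R : 'I_1) k : 'CV[R]_N) (0%R : 'I_1) i = RtoC (i == k)%:R.
  by rewrite mxE eqxx /=; case: (i == k).
have E2 : ((Ci : cplx R) *: (delta_mx (0%R : 'I_1) k : 'CV[R]_N))%R (0%R : 'I_1) i = (Ci * RtoC (i == k)%:R)%R.
  by rewrite mxE E.
case: b; case: c => /=; rewrite ?ReC_line ?ImC_line; congr (_ + t * _)%R;
  rewrite ?E2 ?E ?ReCM ?ImCM /= ?mulr0 ?mul0r ?mulr1 ?mul1r ?subr0 ?addr0 ?add0r ?mulr0 ?andbT ?andbF //.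
Qed.

Lemma continuous_on_measurable (Om : set 'CV[R]_N) (f : 'CV[R]_N -> R) : open Om ->
  (forall z, Om z -> {for z, continuous f}) ->
  measurable_fun (Om : set X) (f : X -> measurableTypeR R).
Proof.
move=> oOm cf; apply: (@measurability _ _ X (measurableTypeR R) Om _ (@RGenOpens.G R)).
  exact: RGenOpens.measurableE.
move=> A [V [x [y ->]] <-]; apply: sub_sigma_algebra.
rewrite openE => z /= [Oz fz]; apply: filterI; first exact: open_nbhs_nbhs.
apply: (cf z Oz); apply: open_nbhs_nbhs; split => //.
Qed.

Lemma measurable_rcoord i : measurable_fun [set: X] (rcoord i : X -> measurableTypeR R).
Proof.
apply: continuous_on_measurable; first exact: openT.
move=> z _; case: i => i [].
  exact: (@cvg_ImCoord R N _ (nbhs z) _ id z i (@cvg_id _ _)).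
exact: (@cvg_ReCoord R N _ (nbhs z) _ id z i (@cvg_id _ _)).
Qed.

Lemma measurable_line v : measurable_fun [set: X * measurableTypeR R]
  ((fun x => line x.1 v x.2) : (X * measurableTypeR R)%type -> X).
Proof.
apply: (continuous_measurable_prod (f := fun x : 'CV[R]_N * R => line x.1 v x.2)) => -[a b].
exact: (@cvg_line R N _ (nbhs (a, b)) _ (fun x => x.1) (fun x => x.2) a v b cvg_fst cvg_snd).
Qed.

Lemma measurable_shiftCV v h : measurable_fun [set: X] ((fun z => line z v h) : X -> X).
Proof.
apply: (continuous_measurable_CV (f := fun z => line z v h)) => z.
exact: (@cvg_line R N _ (nbhs z) _ id (cst h) z v h (@cvg_id _ _) (cvg_cst _)).
Qed.

(** Spreads [m] along the lines of direction [v] with Lebesgue measure on each of them. All measures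
    stay on C^N, so no identification with a product of real lines enters. *)
Definition extM (v : 'CV[R]_N) (m : {measure set X -> \bar R}) : {measure set X -> \bar R} :=
  measure_function_pushforward__canonical__measure_function_Measure
    (m \x leb)%E (measurable_line v).

Lemma extME v m A : extM v m A = \int[m]_z leb [set t : R | A (line z v t)].
Proof.
rewrite /extM /= /pushforward /product_measure1; apply: eq_integral => z _ /=.
by congr leb; apply/seteqP; split => t; rewrite /xsection /= ?inE.
Qed.

(** Lebesgue measure of the real coordinate subspace spanned by the directions in [s], regarded as a
    measure on C^N. The recursion starts from the Dirac mass at the origin. *)
Fixpoint lebs (s : seq ('I_N * bool)) : {measure set X -> \bar R} :=
  if s is k :: s' then extM (rvec k) (lebs s') else @dirac _ X (0%R : 'CV[R]_N) R.

(** A coordinate outside [s] still carries a Dirac mass at 0, which accounts for the second kind of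
    factor. When [k] is added, its side is first opened to the whole line ([A']), so that its Dirac
    factor becomes 1 in the induction hypothesis. *)
Lemma lebs_box (s : seq ('I_N * bool)) (A : 'I_N * bool -> set (measurableTypeR R)) : uniq s ->
  (forall i, measurable (A i)) ->
  lebs s [set z | forall i, A i (rcoord i z)] =
  \prod_i (if i \in s then leb (A i) else \d_(0%R : measurableTypeR R) (A i)).
Proof.
elim: s A => [|k s IH] A /=.
  move=> _ mA; rewrite /dirac indicE.
  have r0 i : rcoord i (0%R : 'CV[R]_N) = 0%R.
    by rewrite /rcoord !mxE; case: ifP.
  have [|] := boolP (_ \in _).
    rewrite inE /= => h; rewrite big1// => i _.
    by rewrite indicE mem_set// -(r0 i).
  rewrite notin_setE /= => /existsNP[i0]; rewrite r0 => Ai.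
  by rewrite (bigD1 i0)//= indicE memNset// mul0e.
move=> /andP[ks us] mA.
pose A' i := if i == k then setT else A i.
have mA' i : measurable (A' i) by rewrite /A'; case: ifP.
rewrite extME.
have E z : leb [set t : R | forall i, A i (rcoord i (line z (rvec k) t))] =
    leb (A k) * (\1_[set z : 'CV[R]_N | forall i, A' i (rcoord i z)] z)%:E.
  rewrite indicE; have [|] := boolP (_ \in _).
    rewrite inE /= => h; rewrite mule1 -[RHS](lebesgue_measure_shift (rcoord k z) (mA k)).
    congr leb; apply/seteqP; split => t /=.
      by move=> /(_ k); rewrite rcoord_line eqxx mulr1 addrC.
    move=> Ak i; rewrite rcoord_line; have := h i; rewrite /A'.
    by case: eqP => [->|_]; rewrite ?mulr1 ?mulr0 ?addr0// addrC.
  rewrite notin_setE /= mule0 => /existsNP[i0 Ai].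
  rewrite (_ : [set t | _] = set0) ?measure0//; apply/seteqP; split => t //= /(_ i0).
  rewrite rcoord_line => Ait; apply: Ai; rewrite /A'; case: eqP Ait => // _.
  by rewrite mulr0 addr0.
under eq_integral do rewrite E.
have mB : measurable ([set z | forall i, A' i (rcoord i z)] : set X).
  rewrite (_ : [set z | _] = \big[setI/setT]_i ((rcoord i) @^-1` A' i)).
    apply: bigsetI_measurable => i _; rewrite -[X in measurable X]setTI.
    exact: measurable_rcoord.
  apply/seteqP; split => z /=.
    by move=> h; elim/big_ind: _ => [//|B C Bz Cz|j _]; [split|exact: h].
  move=> h i; move: h; rewrite (bigD1 i)//= => -[]//.
rewrite ge0_integralZl//; last exact: measurableT_comp.
rewrite integral_indic// setIT IH// (bigD1 k)//= [RHS](bigD1 k)//= mem_head.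
rewrite (negbTE ks) /A' eqxx {1}/dirac indicE mem_set//= mul1e; congr (_ * _).
by apply: eq_bigr => i ik; rewrite (negbTE ik) inE (negbTE ik).
Qed.

(** A shift along the direction just added acts inside each fibre, where one-dimensional translation
    invariance applies. A shift along an earlier direction permutes the fibres, and the induction
    hypothesis changes the variable in the outer integral. *)
Lemma lebs_shift (s : seq ('I_N * bool)) i h (A : set X) : i \in s -> measurable A ->
  lebs s [set z | A (line z (rvec i) h)] = lebs s A.
Proof.
elim: s A => [//|k s IH] A; rewrite inE => ks mA /=; rewrite !extME.
pose B : set (X * measurableTypeR R) := (fun x => line x.1 (rvec k) x.2) @^-1` A.
have mB : measurable B by have := measurable_line (rvec k) measurableT mA; rewrite setTI.
have BE z : [set t : R | A (line z (rvec k) t)] = xsection B (z : X).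
  by apply/seteqP; split => t; rewrite /xsection /= inE.
have mAz z : measurable [set t : measurableTypeR R | A (line z (rvec k) t)].
  by rewrite BE; exact: measurable_xsection.
have [->|ik] := eqVneq i k.
  apply: eq_integral => z _; rewrite -[RHS](lebesgue_measure_shift h (mAz z)).
  by congr leb; apply/seteqP; split => t /=; rewrite lineD.
have {ks} : i \in s by move: ks; rewrite (negbTE ik).
move=> /IH {}IH.
pose f (z : X) : \bar R := leb [set t : R | A (line z (rvec k) t)].
have mf : measurable_fun setT f.
  rewrite (_ : f = leb \o xsection B); first exact: measurable_fun_xsection.
  by apply/funext => z; rewrite /f BE.
pose m := measure_function_pushforward__canonical__measure_function_Measure
  (lebs s) (measurable_shiftCV (rvec i) h).
transitivity (\int[lebs s]_z f (line z (rvec i) h)).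
  apply: eq_integral => z _; rewrite /f; congr leb.
  by apply/seteqP; split => t /=; rewrite line_comm.
transitivity (\int[m]_z f z).
  apply/esym; rewrite (ge0_integral_pushforward (measurable_shiftCV (rvec i) h) (lebs s))//.
by apply: eq_measure_integral => C mC _; rewrite /m /= /pushforward; exact: IH.
Qed.

Definition lebesgueCV : {measure set X -> \bar R} := lebs (enum {: 'I_N * bool}).

Lemma lebesgueCV_shift i h (A : set X) : measurable A ->
  lebesgueCV [set z | A (line z (rvec i) h)] = lebesgueCV A.
Proof. by move=> mA; apply: lebs_shift => //; rewrite mem_enum. Qed.

Lemma is_lebesgueCV_lebesgueCV : is_lebesgueCV lebesgueCV.
Proof.
move=> a b ab.
pose A (i : 'I_N * bool) : set (measurableTypeR R) := [set` `[rcoord i a, rcoord i b]].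
rewrite [X in lebesgueCV X](_ : _ = [set z | forall i, A i (rcoord i z)]); last first.
  apply/seteqP; split => z h.
    case=> j [] /=; rewrite /A /= in_itv/=; have [] := h j; rewrite /rcoord/=; by [].
  move=> j; have := (h (j, false), h (j, true)).
  by rewrite /A /= !in_itv/= /rcoord/= => -[].
rewrite lebs_box; [|exact: enum_uniq|by move=> i; exact: measurable_itv].
transitivity (\prod_(i : 'I_N * bool) (rcoord i b - rcoord i a)%:E).
  apply: eq_bigr => -[j c] _; rewrite mem_enum inE /= /leb /A lebesgue_measure_itv/= lte_fin.
  have [abR abI] := ab j.
  case: ltP => [//|]; case: c; rewrite /rcoord /= => ba.
    by rewrite (@le_anti _ _ (ImC (b 0%R j)) (ImC (a 0%R j))) ?ba ?abI// subrr.
  by rewrite (@le_anti _ _ (ReC (b 0%R j)) (ReC (a 0%R j))) ?ba ?abR// subrr.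
rewrite -(big_morph EFin (@EFinM R) erefl); congr EFin.
rewrite (eq_bigr (fun p => (fun j c => rcoord (j, c) b - rcoord (j, c) a) p.1 p.2)%R); last by case.
rewrite -(pair_bigA _ (fun j c => rcoord (j, c) b - rcoord (j, c) a)%R) /=.
by apply: eq_bigr => j _; rewrite big_bool/= /rcoord/= mulrC.
Qed.

End LebesgueCV.

(** * Integration by parts *)

Section CompactSupport.
Context {R : realType} {N : nat}.
Let X := borelCV R N.
Let mu := @lebesgueCV R N.
Implicit Types (f g h : 'CV[R]_N -> R) (K Om : set 'CV[R]_N).

Lemma compact_fbound K f : compact K -> (forall z, K z -> {for z, continuous f}) ->
  exists2 M, 0 <= M & forall z, K z -> `|f z| <= M.
Proof.
move=> cK cf.
have wf : {within K, continuous f}.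
  by apply: continuous_in_subspaceT => z /set_mem; exact: cf.
have [M [_ hM]] := @compact_bounded R R^o _ (continuous_compact wf cK).
exists (`|M| + 1) => [|z Kz]; first by rewrite addr_ge0.
by apply: (hM (`|M| + 1)); [rewrite (le_lt_trans (ler_norm _))// ltrDl|exists z].
Qed.

Lemma continuous_rcoord i : continuous (@rcoord R N i).
Proof.
move=> z; case: i => i [].
  exact: (@cvg_ImCoord R N _ (nbhs z) _ id z i (@cvg_id _ _)).
exact: (@cvg_ReCoord R N _ (nbhs z) _ id z i (@cvg_id _ _)).
Qed.

Lemma hausdorff_CV : hausdorff_space 'CV[R]_N.
Proof. exact: norm_hausdorff. Qed.

Lemma compact_closed_CV K : compact K -> closed K.
Proof. by apply: compact_closed; exact: hausdorff_CV. Qed.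

Lemma measurable_open_CV Om : open Om -> measurable (Om : set X).
Proof. by move=> oOm; exact: sub_sigma_algebra. Qed.

Lemma measurable_compact_CV K : compact K -> measurable (K : set X).
Proof.
move=> /compact_closed_CV cK; rewrite -(setCK K); apply: measurableC.
by apply: measurable_open_CV; exact: closed_openC.
Qed.

Definition box (M : R) : set 'CV[R]_N := [set z | forall i, `|rcoord i z| <= M].

Lemma box_finite M : (mu (box M) < +oo)%E.
Proof.
pose A (i : 'I_N * bool) : set (measurableTypeR R) := [set` `[- M, M]].
rewrite (_ : box M = [set z | forall i, A i (rcoord i z)]); last first.
  by apply/seteqP; split => z h i; have := h i; rewrite /A /= in_itv/= ler_norml.
rewrite /mu /lebesgueCV lebs_box; [|exact: enum_uniq|by move=> i; exact: measurable_itv].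
set P := (\prod_i _)%E; suff : (0 <= P < +oo)%E by case/andP.
rewrite {}/P; elim/big_ind: _ => [|x y /andP[x0 x1] /andP[y0 y1]|i _]; first by rewrite lee01 ltry.
  by rewrite mule_ge0//= lte_mul_pinfty// ge0_fin_numE.
rewrite mem_enum inE measure_ge0 /= lebesgue_measure_itv/=.
by case: ifP => // _; rewrite -EFinB ltry.
Qed.

Lemma measurable_box M : measurable (box M : set X).
Proof.
rewrite (_ : box M = \big[setI/setT]_i ((fun z : X => rcoord i z) @^-1` [set` `[- M, M]])).
  apply: bigsetI_measurable => i _; rewrite -[X in measurable X]setTI.
  by apply: measurable_rcoord => //; exact: measurable_itv.
apply/seteqP; split => z /=.
  move=> hz; elim/big_ind: _ => [//|B C Bz Cz|j _]; [by split|].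
  by rewrite /= in_itv/= -ler_norml; exact: hz.
by move=> hz i; move: hz; rewrite (bigD1 i)//= => -[]; rewrite /= in_itv/= -ler_norml.
Qed.

Lemma compact_box K : compact K -> exists2 M, 0 <= M & K `<=` box M.
Proof.
move=> cK.
pose C i := cid2 (compact_fbound cK (fun z _ => @continuous_rcoord i z)).
pose M i := s2val (C i).
have hM i : 0 <= M i /\ forall z, K z -> `|rcoord i z| <= M i.
  by split; [exact: (s2valP (C i))|exact: (s2valP' (C i))].
exists (\sum_i M i) => [|z Kz i]; first by rewrite sumr_ge0// => i _; exact: (hM i).1.
rewrite (bigD1 i)//= (le_trans ((hM i).2 _ Kz))// lerDl sumr_ge0// => j _.
exact: (hM j).1.
Qed.

Lemma compact_finite K : compact K -> (mu K < +oo)%E.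
Proof.
move=> cK; have [M _ KM] := compact_box cK.
apply: le_lt_trans (box_finite M); apply: le_measure => //; rewrite inE.
  exact: measurable_compact_CV.
exact: measurable_box.
Qed.

Lemma integrable_on_compact Om K f : open Om -> (forall z, Om z -> {for z, continuous f}) ->
  compact K -> K `<=` Om -> mu.-integrable K (EFin \o (f : X -> R)).
Proof.
move=> oOm cf cK KOm.
have [M M0 hM] := compact_fbound cK (fun z Kz => cf z (KOm _ Kz)).
apply: measurable_bounded_integrable.
- exact: measurable_compact_CV.
- exact: compact_finite.
- apply: measurable_funS (continuous_on_measurable oOm cf) => //.
  exact: measurable_open_CV.
- exists M; split; first exact: num_real.
  by move=> x Mx z Kz; exact: (le_trans (hM z Kz) (ltW Mx)).
Qed.

Definition csupp Om h := (forall z, {for z, continuous h}) /\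
  exists K, [/\ compact K, K `<=` Om & forall z, ~ K z -> h z = 0].

Lemma csupp_integrable Om h : open Om -> csupp Om h -> mu.-integrable Om (EFin \o (h : X -> R)).
Proof.
move=> oOm [ch [K [cK KOm h0]]].
have iK := integrable_on_compact openT (fun z _ => ch z) cK (@subsetT _ _).
have mK := measurable_compact_CV cK.
have mOm := measurable_open_CV oOm.
apply/(integrable_mkcond _ mOm).
move/(integrable_mkcond _ mK) : iK; apply: eq_integrable => // z _.
rewrite /patch; case: ifPn => [/set_mem Kz|].
  by rewrite mem_set//; exact: KOm.
rewrite notin_setE => nKz; case: ifP => // _.
by rewrite /= h0.
Qed.

Lemma csupp_RintegralT Om h : open Om -> csupp Om h ->
  Rintegral mu Om (h : X -> R) = Rintegral mu setT (h : X -> R).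
Proof.
move=> oOm [ch [K [cK KOm h0]]]; rewrite Rintegral_mkcond; apply: eq_Rintegral => z _.
rewrite /patch; case: ifPn => //; rewrite notin_setE => nOz; rewrite h0// => /KOm.
exact: nOz.
Qed.

End CompactSupport.

Section IntegrationByParts.
Context {R : realType} {N : nat}.
Let X := borelCV R N.
Let mu := @lebesgueCV R N.
Implicit Types (f g h : 'CV[R]_N -> R) (K Om : set 'CV[R]_N).

Lemma integral_shift i s h : mu.-integrable setT (EFin \o (h : X -> R)) ->
  mu.-integrable setT (EFin \o ((fun z => h (line z (rvec i) s)) : X -> R)) /\
  (\int[mu]_z (h (line z (rvec i) s))%:E = \int[mu]_z (h z)%:E)%E.
Proof.
move=> ih.
have mphi := @measurable_shiftCV R N (rvec i) s.
pose m := measure_function_pushforward__canonical__measure_function_Measure mu mphi.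
have mE (A : set X) : measurable A -> m A = mu A.
  by move=> mA; rewrite /m /= /pushforward; exact: lebesgueCV_shift.
have ihm : m.-integrable setT (EFin \o (h : X -> R)).
  move/integrableP : ih => [mh fh]; apply/integrableP; split => //.
  apply: le_lt_trans fh; rewrite (@eq_measure_integral _ _ _ _ mu)// => A mA _.
  exact: mE.
have mh : measurable_fun setT (EFin \o (h : X -> R)) by case/integrableP : ih.
have ihs : mu.-integrable setT (EFin \o ((fun z => h (line z (rvec i) s)) : X -> R)).
  apply/integrableP; split.
    exact: (measurableT_comp mh mphi).
  move/integrableP : ihm => [_]; rewrite ge0_integral_pushforward//.
  exact: measurableT_comp.
split => //.
transitivity (\int[m]_z (h z)%:E)%E.
  apply/esym; rewrite (integral_pushforward mphi)//=.
by apply: eq_measure_integral => A mA _; exact: mE.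
Qed.

Lemma dirD_supp h v K z : closed K -> (forall z, ~ K z -> h z = 0) -> ~ K z -> dirD v h z = 0.
Proof.
move=> cK h0 nKz; rewrite -(dirD_cst (R := R) (N := N) 0 v z).
by apply: (@dirD_eq_on _ _ (~` K)) => //; exact: closed_openC.
Qed.

(** By translation invariance every difference quotient of [h] has integral 0. The quotients
    converge to the derivative and, by the mean value theorem, are bounded by one constant on one
    box; dominated convergence concludes. *)
Lemma integral_dirD0 h i : csupp setT h -> Ck setT 1 h ->
  Rintegral mu setT (dirD (rvec i) h : X -> R) = 0.
Proof.
move=> sh hh; have [ch [K [cK _ h0]]] := sh.
set v := rvec i; pose D := dirD v h.
have D0 z : ~ K z -> D z = 0 by apply: dirD_supp => //; exact: compact_closed_CV.
have cD z : {for z, continuous D}.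
  exact: (Ck_cont (CkS_dirD v hh) I).
have [C C0 hC'] := compact_fbound cK (fun z _ => cD z).
have hC z : `|D z| <= C.
  by have [Kz|nKz] := pselect (K z); [exact: hC'|rewrite D0// normr0].
have [M M0 KM] := compact_box cK.
have mvt z s : 0 < s -> `|h (line z v s) - h z| <= C * s.
  move=> s0.
  have h1 x : 0 <= x <= s -> is_derive x (1 : R) (fun x => h (line z v x)) (D (line z v x)).
    move=> _; rewrite -real_lineE; apply: isD_shift.
    by have [] := CkS_derive v hh (I : setT (line z v x)).
  have [c _] := MVT_line s0 h1; rewrite line0 => ->.
  by rewrite normrM (gtr0_norm s0) ler_wpM2r// ltW.
(* The steps are at most 1, so all difference quotients vanish outside [box (M + 1)]. *)
pose e (n : nat) : R := n.+1%:R^-1.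
have e0 n : 0 < e n by rewrite invr_gt0.
pose g n z := (e n)^-1 * (h (line z v (e n)) - h z).
have gsupp n z : ~ box (M + 1) z -> g n z = 0.
  move=> nb; rewrite /g !h0 ?subrr ?mulr0// => [Kz|Kz]; apply: nb => k.
    by rewrite (le_trans (KM _ Kz k))// lerDl.
  have := KM _ Kz k; rewrite rcoord_line => le1.
  have e1 : e n <= 1 by rewrite invf_le1 ?ler1n.
  have := le1; rewrite !ler_norml; case: (k == i); last first.
    by rewrite mulr0 addr0 => /andP[? ?]; apply/andP; split; lra.
  have := e0 n; rewrite mulr1 => e0n /andP[? ?]; apply/andP; split; lra.
have gbound n z : `|g n z| <= C.
  rewrite /g normrM gtr0_norm ?invr_gt0// ler_pdivrMl//.
  by rewrite mulrC; exact: mvt.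
have cg n z : {for z, continuous (g n)}.
  have cl : (fun z => h (line z v (e n))) @ nbhs z --> h (line z v (e n)).
    have hl : (fun z => line z v (e n)) @ nbhs z --> line z v (e n).
      exact: (@cvg_line R N _ (nbhs z) _ id (cst (e n)) z v (e n) (@cvg_id _ _) (cvg_cst _)).
    by apply: (cvg_comp _ _ hl); exact: ch.
  exact: (cvgM (cvg_cst (e n)^-1) (cvgB cl (ch z))).
have g_D z : g n z @[n --> \oo] --> D z.
  have hd : derivable (real_line h z v) 0 1.
    by have [] := CkS_derive v hh (I : setT z).
  have {}hd : s^-1 *: (real_line h z v (s *: (1 : R) + 0) - real_line h z v 0) @[s --> 0^'] --> D z.
    rewrite /D dirDE; exact: hd.
  have := proj1 (cvgr_dnbhsP _ _ _) hd e.
  have -> : (fun n => (e n)^-1 *: (real_line h z v (e n *: (1 : R) + 0) - real_line h z v 0)) = g^~ z.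
    by apply/funext => n; rewrite !real_lineE line0 addr0 [e n *: 1]mulr1.
  apply; split => [n|]; first by rewrite gt_eqF.
  exact: cvg_harmonic.
have mg n : measurable_fun setT (EFin \o (g n : X -> R)).
  by apply/measurable_EFinP; exact: (continuous_on_measurable openT (fun z _ => cg n z)).
have mD : measurable_fun setT (EFin \o (D : X -> R)).
  by apply/measurable_EFinP; exact: (continuous_on_measurable openT (fun z _ => cD z)).
have mB := @measurable_box R N (M + 1).
have ib : mu.-integrable setT (fun z : X => C%:E * (\1_(box (M + 1)) z)%:E)%E.
  apply: integrableZl => //; apply/integrableP; split.
    by apply/measurable_EFinP; exact: measurable_indic.
  under eq_integral do rewrite gee0_abs ?lee_fin//.
  by rewrite integral_indic// setIT; exact: box_finite.
have [||_ _] := @dominated_convergence _ X R mu setT measurableT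
  (fun n => EFin \o (g n : X -> R)) (EFin \o (D : X -> R)) _ mg mD _ ib.
- by apply: aeW => z _; apply: cvg_EFin; [exact: nearW|exact: g_D].
- apply: aeW => z n _ /=; rewrite lee_fin indicE.
  have [zB|] := boolP (_ \in _); first by rewrite mulr1; exact: gbound.
  by rewrite notin_setE => /gsupp ->; rewrite normr0 mulr0.
have ih : mu.-integrable setT (EFin \o (h : X -> R)) by exact: csupp_integrable openT sh.
have g0 n : (\int[mu]_z (g n z)%:E = 0)%E.
  have [is1 isE] := integral_shift i (e n) ih.
  transitivity (\int[mu]_z ((e n)^-1%:E * ((h (line z v (e n)))%:E - (h z)%:E)))%E.
    by apply: eq_integral => z _; rewrite /g EFinM EFinB.
  rewrite integralZl//; last exact: integrableB.
  rewrite integralB// [X in (X - _)%E]isE subee ?mule0//.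
  exact: integrable_fin_num.
move=> hlim; rewrite /Rintegral.
suff -> : (\int[mu]_z (D z)%:E = 0)%E by [].
apply: (cvg_unique _ hlim) => //.
rewrite (_ : [sequence _]_n = cst 0%E); first exact: cvg_cst.
by apply/funext => n /=; exact: g0.
Qed.

Section OnOpen.
Variable Om : set 'CV[R]_N.
Hypothesis oOm : open Om.
Implicit Types (F G : 'CV[R]_N -> cplx R) (c s : cplx R).

Lemma Ck_setU (U V : set 'CV[R]_N) k h : Ck U k h -> Ck V k h -> U `|` V = setT -> Ck setT k h.
Proof.
move=> hU hV UV.
have UVz z : U z \/ V z by have : setT z by []; rewrite -UV.
elim: k h hU hV => [|k IH] h hU hV.
  split => // z _.
  by have [Uz|Vz] := UVz z; [exact: Ck_cont hU Uz|exact: Ck_cont hV Vz].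
split => [z _|v].
  by have [Uz|Vz] := UVz z; [exact: Ck_cont hU Uz|exact: Ck_cont hV Vz].
split=> [z _|]; last by apply: IH; exact: CkS_dirD.
by have [Uz|Vz] := UVz z; [have [] := CkS_derive v hU Uz|have [] := CkS_derive v hV Vz].
Qed.

Definition CcC F := CinfC setT F /\
  exists K, [/\ compact K, K `<=` Om & forall z, ~ K z -> F z = 0].

(** [Om] and the complement of [K] are open and cover the space, and [F] is zero on the second one.
    Smoothness on [Om] thus extends to the whole space. *)
Lemma CcC_of F K : compact K -> K `<=` Om -> (forall z, ~ K z -> F z = 0) -> CinfC Om F -> CcC F.
Proof.
move=> cK KOm F0 [h1 h2]; split; last by exists K.
have oK : open (~` K) by apply: closed_openC; exact: compact_closed_CV.
have UV : Om `|` ~` K = setT.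
  by apply/seteqP; split => // z _; have [/KOm|] := pselect (K z); [left|right].
split=> k.
  apply: Ck_setU (h1 k) _ UV; apply: (Ck_ext oK _ (Ck_cst oK k 0)) => z nK.
  by rewrite F0.
apply: Ck_setU (h2 k) _ UV; apply: (Ck_ext oK _ (Ck_cst oK k 0)) => z nK.
by rewrite F0.
Qed.

Lemma Ck_sub (U V : set 'CV[R]_N) k h : V `<=` U -> Ck U k h -> Ck V k h.
Proof.
move=> VU; elim: k h => [|k IH] h [ch dh]; first by split => // z /VU; exact: ch.
split => [z /VU|v]; first exact: ch.
have [dv Cv] := dh v; split; last exact: IH.
by move=> z /VU; exact: dv.
Qed.

Lemma CcC_CinfC F : CcC F -> CinfC Om F.
Proof. by move=> [[h1 h2] _]; split=> k; apply: Ck_sub; [exact: subsetT|exact: h1| exact: subsetT|exact: h2]. Qed.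

Lemma CcCM G F : CinfC Om G -> CcC F -> CcC (fun z => G z * F z).
Proof.
move=> hG hF; have [_ [K [cK KOm F0]]] := hF.
apply: (CcC_of cK KOm) => [z nK|]; first by rewrite F0// mulr0.
by apply: CinfCM => //; exact: CcC_CinfC.
Qed.

Lemma CcC_wd s d F : CcC F -> CcC (wd s d F).
Proof.
move=> hF; have [hT [K [cK KOm F0]]] := hF.
apply: (CcC_of cK KOm) => [z nK|]; last by apply: CinfC_wd => //; exact: CcC_CinfC.
rewrite -[RHS](wd_cst s d 0 z); apply: (@wd_ext _ _ (~` K)) => //.
by apply: closed_openC; exact: compact_closed_CV.
Qed.

Lemma CcC_csupp F : CcC F -> csupp Om (fun z => ReC (F z)) /\ csupp Om (fun z => ImC (F z)).
Proof.
move=> [[h1 h2] [K [cK KOm F0]]]; split; split.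
- by move=> z; exact: Ck_cont (h1 0%N) I.
- by exists K; split => // z nK; rewrite F0.
- by move=> z; exact: Ck_cont (h2 0%N) I.
- by exists K; split => // z nK; rewrite F0.
Qed.

Lemma test_CcC f : test_function Om f -> CcC (fun z => RtoC (f z)).
Proof.
move=> [cf [K [cK KOm f0]]]; split; last by exists K; split => // z nK; rewrite f0.
by apply: (CinfC_RtoC openT) => k; exact: Cclass_Ck.
Qed.

Lemma eq_Cintegral F G : (forall z, Om z -> F z = G z) -> Cintegral mu Om F = Cintegral mu Om G.
Proof.
by move=> FG; congr mkC; apply: eq_Rintegral => z /set_mem Oz; rewrite FG.
Qed.

Lemma CintegralD F G : CcC F -> CcC G ->
  Cintegral mu Om (fun z => F z + G z) = Cintegral mu Om F + Cintegral mu Om G.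
Proof.
move=> /CcC_csupp[f1 f2] /CcC_csupp[g1 g2].
have mOm := measurable_open_CV oOm.
apply: cplx_eq; rewrite ?ReCD ?ImCD /= -RintegralD//; try exact: csupp_integrable.
  by apply: eq_Rintegral => z _; rewrite ReCD.
by apply: eq_Rintegral => z _; rewrite ImCD.
Qed.

Lemma CintegralZ c F : CcC F -> Cintegral mu Om (fun z => c * F z) = c * Cintegral mu Om F.
Proof.
move=> /CcC_csupp[f1 f2].
have mOm := measurable_open_CV oOm.
have i1 := csupp_integrable oOm f1; have i2 := csupp_integrable oOm f2.
apply: cplx_eq; rewrite ?ReCM ?ImCM /= -!RintegralZl//.
  rewrite -RintegralB//; [|exact: (integrableZl _ _ i1)|exact: (integrableZl _ _ i2)].
  by apply: eq_Rintegral => z _; rewrite ReCM.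
rewrite -RintegralD//; [|exact: (integrableZl _ _ i2)|exact: (integrableZl _ _ i1)].
by apply: eq_Rintegral => z _; rewrite ImCM.
Qed.

Lemma Cintegral0 : Cintegral mu Om (fun _ => 0) = 0.
Proof. by congr mkC; rewrite /Rintegral integral0. Qed.

Lemma CcC0 : CcC (fun _ => 0).
Proof.
split; first exact: (CinfC_cst openT).
by exists set0; split => //; exact: compact0.
Qed.

Lemma CcCD F G : CcC F -> CcC G -> CcC (fun z => F z + G z).
Proof.
move=> [hF [K [cK KOm F0]]] [hG [L [cL LOm G0]]].
split; first exact: (CinfCD openT hF hG).
exists (K `|` L); split; [exact: compactU|by move=> z [/KOm|/LOm]|].
by move=> z /not_orP[nK nL]; rewrite F0// G0// addr0.
Qed.

Lemma CcC_sum I (r : seq I) (F : I -> 'CV[R]_N -> cplx R) :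
  (forall i, CcC (F i)) -> CcC (fun z => \sum_(i <- r) F i z).
Proof.
move=> hF; elim: r => [|i r IH].
  rewrite (_ : (fun _ => _) = fun=> 0); first exact: CcC0.
  by apply/funext => z; rewrite big_nil.
rewrite (_ : (fun _ => _) = fun z => F i z + \sum_(i <- r) F i z); first exact: CcCD.
by apply/funext => z; rewrite big_cons.
Qed.

Lemma Cintegral_sum I (r : seq I) (F : I -> 'CV[R]_N -> cplx R) :
  (forall i, CcC (F i)) ->
  Cintegral mu Om (fun z => \sum_(i <- r) F i z) = \sum_(i <- r) Cintegral mu Om (F i).
Proof.
move=> hF; elim: r => [|i r IH].
  by rewrite big_nil -[RHS]Cintegral0; apply: eq_Cintegral => z _; rewrite big_nil.
rewrite big_cons -IH -CintegralD//; last exact: CcC_sum.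
by apply: eq_Cintegral => z _; rewrite big_cons.
Qed.

Lemma CcC_cder v F : CcC F -> CcC (cder v F).
Proof.
move=> hF; have [hT [K [cK KOm F0]]] := hF.
apply: (CcC_of cK KOm) => [z nK|]; last by apply: CinfC_cder; exact: CcC_CinfC.
rewrite -[RHS](cder_cst 0 v z); apply: (@cder_ext _ _ (~` K)) => //.
by apply: closed_openC; exact: compact_closed_CV.
Qed.

Lemma Cintegral_cder0 i F : CcC F -> Cintegral mu Om (cder (rvec i) F) = 0.
Proof.
move=> hF; have [s1 s2] := CcC_csupp hF.
have [d1 d2] := CcC_csupp (CcC_cder (rvec i) hF).
have [[h1 h2] _] := hF.
have sT h : csupp Om h -> csupp setT h.
  by move=> [ch [K [cK KOm h0]]]; split => //; exists K.
congr mkC; rewrite csupp_RintegralT//.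
  move: (integral_dirD0 i (sT _ s1) (h1 1%N)); apply: etrans.
  by rewrite [cder]unlock.
move: (integral_dirD0 i (sT _ s2) (h2 1%N)); apply: etrans.
by rewrite [cder]unlock.
Qed.

Lemma Cintegral_wd0 s j F : CcC F -> Cintegral mu Om (wd s (ej j) F) = 0.
Proof.
move=> hF.
have h1 := CcC_cder (ej j).1 hF; have h2 := CcC_cder (ej j).2 hF.
have h3 := CcCM (CinfC_cst oOm s) h2.
rewrite /wd (CintegralZ _ (CcCD h1 h3)) (CintegralD h1 h3) (CintegralZ _ h2).
have -> := Cintegral_cder0 (j, false) hF.
have -> := Cintegral_cder0 (j, true) hF.
by rewrite mulr0 addr0 mulr0.
Qed.

End OnOpen.

End IntegrationByParts.

(** * Monge-Ampere currents of smooth functions *)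

Section RowDeterminant.
Variables (K : comNzRingType) (N : nat).
Implicit Types (A B t : seq 'rV[K]_N) (a b v : 'rV[K]_N).

(** The rows come as a list, so that [contr] can put a further vector in front. *)
Definition detR A : K := \det (\matrix_(i < N) nth 0 A i).

Lemma detR_swap t a b A : size (t ++ a :: b :: A) = N ->
  detR (t ++ a :: b :: A) = - detR (t ++ b :: a :: A).
Proof.
rewrite size_cat /= => sN.
have h1 : (size t < N)%N by lia.
have h2 : ((size t).+1 < N)%N by lia.
pose i1 := Ordinal h1; pose i2 := Ordinal h2.
rewrite /detR.
set M := \matrix_i _; set M' := \matrix_i _.
have -> : M = row_perm (tperm i1 i2) M'.
  apply/matrixP => i j; rewrite !mxE !nth_cat.
  case: tpermP => [->|->|] /=.
  - by rewrite ltnn subnn ltnNge leqnSn /= subSnn.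
  - by rewrite ltnn subnn ltnNge leqnSn /= subSnn.
  - move=> /eqP; rewrite -val_eqE /= => ni1 /eqP; rewrite -val_eqE /= => ni2.
    case: ltnP => // ti; case E : (i - size t)%N => [|[|k]] //.
      by move: ni1; rewrite eqn_leq ti -subn_eq0 E.
    move: ni2; rewrite -(subnK ti) E add1n eqxx; by [].
by rewrite row_permE det_mulmx det_perm odd_tperm (_ : i1 != i2) ?expr1 ?mulN1r// -val_eqE /= neq_ltn ltnSn.
Qed.

Lemma detR_expand t v B : (size t < N)%N ->
  detR (t ++ v :: B) = \sum_k v 0 k * detR (t ++ delta_mx 0 k :: B).
Proof.
move=> h; pose i := Ordinal h.
rewrite /detR (expand_det_row _ i).
have ci w j : cofactor (\matrix_(i < N) nth 0 (t ++ v :: B) i) i j =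
   cofactor (\matrix_(i < N) nth 0 (t ++ w :: B) i) i j.
  rewrite /cofactor; congr (_ * \det _); apply/matrixP => x y; rewrite !mxE !nth_cat.
  case: ltnP => // tx; case E : (_ - _)%N => [|//].
  by have := neq_lift i x; rewrite -val_eqE /= eqn_leq tx -subn_eq0 E.
apply: eq_bigr => k _; rewrite !mxE nth_cat /= ltnn subnn /=; congr (_ * _).
rewrite (expand_det_row _ i) (bigD1 k)//= big1 ?addr0 => [|j jk].
  by rewrite !mxE nth_cat /= ltnn subnn /= mxE !eqxx mul1r; exact: ci.
by rewrite !mxE nth_cat /= ltnn subnn /= mxE eqxx (negbTE jk) mul0r.
Qed.

End RowDeterminant.

Section Contraction.
Variables (K : comNzRingType) (N : nat).
Implicit Types (A B t : seq 'rV[K]_N) (a b v : 'rV[K]_N) (U : 'M[K]_N).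

(* Contraction of [d] copies of the form [U] with the product of the two
   volume forms, the remaining slots being filled by [A] and [B]. *)
Fixpoint contr (d : nat) U A B : K :=
  if d is d'.+1 then
    \sum_j \sum_k U j k * contr d' U (delta_mx 0 j :: A) (delta_mx 0 k :: B)
  else detR A * detR B.

Lemma contr_swapl d U t a b A B : (size (t ++ a :: b :: A) + d)%N = N ->
  contr d U (t ++ a :: b :: A) B = - contr d U (t ++ b :: a :: A) B.
Proof.
elim: d t B => [|d IH] t B /= h.
  by rewrite detR_swap ?mulNr//; lia.
rewrite -sumrN; apply: eq_bigr => j _; rewrite -sumrN; apply: eq_bigr => k _.
by rewrite -mulrN -cat_cons IH//= addSnnS.
Qed.

Lemma contr_swapr d U t a b A B : (size (t ++ a :: b :: B) + d)%N = N ->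
  contr d U A (t ++ a :: b :: B) = - contr d U A (t ++ b :: a :: B).
Proof.
elim: d t A => [|d IH] t A /= h.
  by rewrite [in LHS]detR_swap ?mulrN//; lia.
rewrite -sumrN; apply: eq_bigr => j _; rewrite -sumrN; apply: eq_bigr => k _.
by rewrite -mulrN -cat_cons IH//= addSnnS.
Qed.

Lemma contr_expandr d U t A v B : (size t + d < N)%N ->
  contr d U A (t ++ v :: B) = \sum_k v 0 k * contr d U A (t ++ delta_mx 0 k :: B).
Proof.
elim: d t A => [|d IH] t A h /=.
  rewrite detR_expand ?mulr_sumr; last by lia.
  by apply: eq_bigr => k _; rewrite mulrCA.
under eq_bigr => j _.
  under eq_bigr => k _.
    rewrite -cat_cons IH; last by rewrite /=; lia.
    rewrite mulr_sumr.
    over.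
  rewrite exchange_big.
  over.
rewrite exchange_big /=; apply: eq_bigr => k _; rewrite mulr_sumr.
apply: eq_bigr => j _; rewrite mulr_sumr; apply: eq_bigr => k' _.
by rewrite mulrCA.
Qed.

Lemma contr_row d U A B : (d < N)%N ->
  contr d.+1 U A B = \sum_j contr d U (delta_mx 0 j :: A) (row j U :: B).
Proof.
move=> h; apply: eq_bigr => j _.
rewrite (@contr_expandr d U [::]) //=.
by apply: eq_bigr => k _; rewrite mxE.
Qed.

(** Once all sums over the second index are absorbed by multilinearity, each remaining term is
    indexed by a list [js] and contains the determinant of the rows of [U] selected by [js]. That
    matrix is a selection matrix times [U], so the term has the factor [\det U]. The statement [H]
    has part of [js] already chosen. *)
Lemma contr_det0 U : \det U = 0 -> contr N U [::] [::] = 0.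
Proof.
move=> U0.
suff H d (js : seq 'I_N) : (size js + d)%N = N ->
    contr d U [seq delta_mx 0 j | j <- js] [seq row j U | j <- js] = 0.
  exact: (H N [::]).
elim: d js => [|d IH] js h.
  rewrite /= [X in _ * X](_ : _ = detR [seq delta_mx 0 j | j <- js] * \det U).
    by rewrite U0 !mulr0.
  rewrite /detR -det_mulmx; congr (\det _); apply/row_matrixP => i.
  rewrite row_mul !rowK.
  have si : (i < size js)%N by have := ltn_ord i; lia.
  by rewrite !(nth_map i)// -rowE.
rewrite contr_row; last by lia.
by rewrite big1// => j _; apply: (IH (j :: js)); rewrite /=; lia.
Qed.

End Contraction.

(** * Closedness of the powers of dd^c u *)

Section Currents.
Context {R : realType} {n : nat}.
Let N := n.+1.
Let mu := @lebesgueCV R N.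
Let X := borelCV R N.
Variable Om : set 'CV[R]_N.
Hypothesis oOm : open Om.
Variable u : 'CV[R]_N -> R.
Hypothesis uC : Cinf Om u.

(** The operator with [Ci] is outermost, in contrast to [ddc]: integration by parts moves the
    derivative in z_j from the test function to [u] first, and the derivative in the conjugate of
    z_k second. *)
Definition levi_form : 'CV[R]_N -> 'M[cplx R]_N := fun z =>
  \matrix_(j, k) (4 * wd Ci (ej k) (wd (- Ci) (ej j) (fun z => RtoC (u z))) z).

Let U j k z := levi_form z j k.

Lemma CinfC_u : CinfC Om (fun z => RtoC (u z)).
Proof. exact: CinfC_RtoC. Qed.

Lemma CinfC_U j k : CinfC Om (U j k).
Proof.
apply: (CinfC_ext oOm (F := fun z => 4 * wd Ci (ej k) (wd (- Ci) (ej j) (fun z => RtoC (u z))) z)).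
  by move=> z _; rewrite /U mxE.
apply: CinfCM => //; first exact: CinfC_cst.
by apply: CinfC_wd => //; apply: CinfC_wd => //; exact: CinfC_u.
Qed.

Lemma wd_U s d j k z : Om z ->
  wd s d (U j k) z = 4 * wd s d (wd Ci (ej k) (wd (- Ci) (ej j) (fun z => RtoC (u z)))) z.
Proof.
move=> Oz; rewrite -(wdMl oOm) //; last first.
  by apply: CinfC_wd => //; apply: CinfC_wd => //; exact: CinfC_u.
by apply: (wd_ext oOm) => // x _; rewrite /U mxE.
Qed.

(** In coordinates, this and the next symmetry express that dd^c u is closed. *)
Lemma wd_U_sym j l k z : Om z -> wd (- Ci) (ej l) (U j k) z = wd (- Ci) (ej j) (U l k) z.
Proof.
move=> Oz; rewrite !wd_U//; congr (_ * _).
have cu := CinfC_u.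
have c1 i := CinfC_wd oOm (- Ci) (ej i) cu.
rewrite !(wd_comm oOm (- Ci) Ci)//.
by apply: (wd_ext oOm) => // x Ox; rewrite (wd_comm oOm (- Ci) (- Ci)).
Qed.

Lemma wdbar_U_sym j k l z : Om z -> wd Ci (ej l) (U j k) z = wd Ci (ej k) (U j l) z.
Proof.
move=> Oz; rewrite !wd_U//; congr (_ * _).
have cu := CinfC_u.
by rewrite (wd_comm oOm Ci Ci)//; exact: (CinfC_wd oOm (- Ci) (ej j) cu).
Qed.

Definition ccoef d A B : 'CV[R]_N -> cplx R := fun z => contr d (levi_form z) A B.

Lemma ccoefS d A B z : ccoef d.+1 A B z =
  \sum_j \sum_k U j k z * ccoef d (delta_mx 0 j :: A) (delta_mx 0 k :: B) z.
Proof. by []. Qed.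

Lemma CinfC_ccoef d A B : CinfC Om (ccoef d A B).
Proof.
elim: d A B => [|d IH] A B; first exact: CinfC_cst.
apply: (CinfC_ext oOm (fun z _ => esym (ccoefS d A B z))).
apply: CinfC_sum => // j; apply: CinfC_sum => // k.
by apply: CinfCM => //; exact: CinfC_U.
Qed.

Lemma wd_ccoefS s e d A B z : Om z -> wd s e (ccoef d.+1 A B) z =
  \sum_j \sum_k (wd s e (U j k) z * ccoef d (delta_mx 0 j :: A) (delta_mx 0 k :: B) z +
    U j k z * wd s e (ccoef d (delta_mx 0 j :: A) (delta_mx 0 k :: B)) z).
Proof.
move=> Oz; rewrite (wd_ext oOm s e (fun z _ => ccoefS d A B z) Oz).
have h j k : CinfC Om (fun z => U j k z * ccoef d (delta_mx 0 j :: A) (delta_mx 0 k :: B) z).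
  by apply: CinfCM => //; [exact: CinfC_U|exact: CinfC_ccoef].
rewrite (wd_sum oOm) => [|j|//]; last exact: CinfC_sum.
apply: eq_bigr => j _; rewrite (wd_sum oOm)//.
apply: eq_bigr => k _; rewrite (wdM oOm)//; [exact: CinfC_U|exact: CinfC_ccoef].
Qed.

Lemma alt_sum0 (F G : 'I_N -> 'I_N -> cplx R) : (forall i j, F i j = F j i) ->
  (forall i j, G i j = - G j i) -> \sum_i \sum_j F i j * G i j = 0.
Proof.
move=> hF hG; set S := \sum_i _.
have : S = - S.
  rewrite {1}/S exchange_big /= -sumrN; apply: eq_bigr => i _; rewrite -sumrN.
  by apply: eq_bigr => j _; rewrite hF hG mulrN.
by move/eqP; rewrite -addr_eq0 -mulr2n mulrn_eq0 /= => /eqP.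
Qed.

(** The product rule gives two sums. If the derivative hits an entry of the Levi form, the result is
    symmetric in the two inner indices, while the remaining coefficient is antisymmetric in them. If
    it hits the coefficient, the newest pair of vectors is exchanged with the pair before it; the
    signs from [A] and from [B] cancel, and the induction hypothesis applies. *)
Lemma ccoef_closed d k A B z : (size A + d.+1)%N = N -> size A = size B -> Om z ->
  \sum_j wd (- Ci) (ej j) (ccoef d (delta_mx 0 j :: A) (delta_mx 0 k :: B)) z = 0.
Proof.
elim: d k A B => [|d IH] k A B sA sB Oz.
  by rewrite big1// => j _; rewrite wd_cst.
under eq_bigr => j _ do rewrite wd_ccoefS//.
rewrite (eq_bigr _ (fun j _ => eq_bigr _ (fun j' _ => big_split _ _ _ _ _))) /=.
rewrite (eq_bigr _ (fun j _ => big_split _ _ _ _ _)) big_split /=.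
rewrite [X in X + _](_ : _ = 0) ?add0r; last first.
  under eq_bigr => j _ do rewrite exchange_big /=.
  rewrite exchange_big big1//= => k' _; apply: alt_sum0 => i j.
    exact: wd_U_sym.
  by apply: (@contr_swapl _ N _ _ [::]); apply: etrans _ sA; rewrite /= !addnS !addSn.
under eq_bigr => j _ do rewrite exchange_big /=.
rewrite exchange_big big1//= => k' _; rewrite exchange_big big1//= => j' _.
rewrite -mulr_sumr.
rewrite [X in _ * X](_ : _ = \sum_j wd (- Ci) (ej j) (ccoef d (delta_mx 0 j :: delta_mx 0 j' :: A) (delta_mx 0 k :: delta_mx 0 k' :: B)) z).
  by rewrite IH ?mulr0//= ?sB//; apply: etrans _ sA; rewrite sB /= !addnS !addSn.
apply: eq_bigr => j _; apply: (wd_ext oOm) => // x _.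
rewrite /ccoef (@contr_swapl _ N _ _ [::])/=; last by apply: etrans _ sA; rewrite /= !addnS !addSn.
rewrite (@contr_swapr _ N _ _ [::])/= ?opprK//.
by apply: etrans _ sA; rewrite /= -sB !addnS !addSn.
Qed.

Lemma ccoef_coclosed d j A B z : (size A + d.+1)%N = N -> size A = size B -> Om z ->
  \sum_k wd Ci (ej k) (ccoef d (delta_mx 0 j :: A) (delta_mx 0 k :: B)) z = 0.
Proof.
elim: d j A B => [|d IH] j A B sA sB Oz.
  by rewrite big1// => k _; rewrite wd_cst.
under eq_bigr => k _ do rewrite wd_ccoefS//.
rewrite (eq_bigr _ (fun j _ => eq_bigr _ (fun j' _ => big_split _ _ _ _ _))) /=.
rewrite (eq_bigr _ (fun j _ => big_split _ _ _ _ _)) big_split /=.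
rewrite [X in X + _](_ : _ = 0) ?add0r; last first.
  rewrite exchange_big big1//= => j' _; apply: alt_sum0 => i k.
    exact: wdbar_U_sym.
  by apply: (@contr_swapr _ N _ _ [::]); apply: etrans _ sA; rewrite /= -sB !addnS !addSn.
rewrite exchange_big big1//= => j' _; rewrite exchange_big big1//= => k' _.
rewrite -mulr_sumr.
rewrite [X in _ * X](_ : _ = \sum_k wd Ci (ej k) (ccoef d (delta_mx 0 j :: delta_mx 0 j' :: A) (delta_mx 0 k :: delta_mx 0 k' :: B)) z).
  by rewrite IH ?mulr0//= ?sB//; apply: etrans _ sA; rewrite sB /= !addnS !addSn.
apply: eq_bigr => k _; apply: (wd_ext oOm) => // x _.
rewrite /ccoef (@contr_swapl _ N _ _ [::])/=; last by apply: etrans _ sA; rewrite /= !addnS !addSn.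
rewrite (@contr_swapr _ N _ _ [::])/= ?opprK//.
by apply: etrans _ sA; rewrite /= -sB !addnS !addSn.
Qed.

End Currents.

(** Subscripts stand for derivatives, [c] for the coefficient of the current and [a] for 4. The
    second line holds a derivative of [uu c fk] minus a derivative of [uj c f], which integrate to
    0; the last line holds the derivatives of [c], whose sums vanish by closedness. *)
Lemma green_subproof (K : comPzRingType) (a uu uj c cj ck f fk fjk ukj : K) :
  uu * (a * fjk) * c = f * (a * ukj * c) +
    (a * (((uj * c + uu * cj) * fk + (uu * c) * fjk) +
          (-1) * ((ukj * c + uj * ck) * f + (uj * c) * fk)) +
    (a * (uj * f) * ck + (- (a * (uu * fk))) * cj)).
Proof. by ring. Qed.

(** * The Bedford-Taylor recursion for smooth functions *)

Section MongeAmpereZero.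
Context {R : realType} {n : nat}.
Let N := n.+1.
Let mu := @lebesgueCV R N.
Variable Om : set 'CV[R]_N.
Hypothesis oOm : open Om.
Variable u : 'CV[R]_N -> R.
Hypothesis uC : Cinf Om u.

Let dl (j : 'I_N) : 'CV[R]_N := delta_mx 0 j.

(** The density with respect to Lebesgue measure of (dd^c u)^(N-p) wedged with the blocks b_{jk}
    listed in [s]: each factor dd^c u fills one slot on either side, and [s] fills the others. *)
Definition tcoef p (s : p.-tuple ('I_N * 'I_N)) : 'CV[R]_N -> cplx R :=
  ccoef u (N - p) [seq dl x.1 | x <- s] [seq dl x.2 | x <- s].

Lemma tcoef_integrable p s : Clocally_integrable Om mu (@tcoef p s).
Proof.
move=> K cK KOm; have [h1 h2] := CinfC_ccoef oOm uC (N - p) [seq dl x.1 | x <- s] [seq dl x.2 | x <- s].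
by split; apply: integrable_on_compact KOm => // z Oz; [exact: Ck_cont (h1 0%N) Oz|exact: Ck_cont (h2 0%N) Oz].
Qed.

Definition ddc_power p : current Om p :=
  @Current R N Om p mu (@tcoef p) (fun K cK _ => compact_finite cK) (@tcoef_integrable p).

(** This is S = dd^c (u T) tested on [f], by two integrations by parts. [P] and [Q] are the
    functions whose derivatives are thrown away; the terms that differentiate the coefficient of T
    disappear by [ccoef_closed] and [ccoef_coclosed]. *)
Lemma green_identity d (A B : seq 'CV[R]_N) f : (size A + d.+1)%N = N -> size A = size B ->
  test_function Om f ->
  Cintegral mu Om (fun z => RtoC (f z) * ccoef u d.+1 A B z) =
  \sum_j \sum_k Cintegral mu Om
    (fun z => RtoC (u z) * ddc f j k z * ccoef u d (dl j :: A) (dl k :: B) z).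
Proof.
move=> sA sB tf.
have hF := test_CcC tf.
have hFO := CcC_CinfC hF.
have hU := CinfC_RtoC oOm uC.
pose F z := RtoC (f z); pose Uu z := RtoC (u z).
pose c j k := ccoef u d (dl j :: A) (dl k :: B).
have hc j k : CinfC Om (c j k) by exact: CinfC_ccoef.
pose P j k z := (Uu z * c j k z) * wd Ci (ej k) F z.
pose Q j k z := (wd (- Ci) (ej j) Uu z * c j k z) * F z.
have hfk k : CcC Om (wd Ci (ej k) F) by exact: CcC_wd.
have huj j : CinfC Om (wd (- Ci) (ej j) Uu) by exact: CinfC_wd.
have h1 j k : CinfC Om (fun z => Uu z * c j k z) by exact: CinfCM.
have h2 j k : CinfC Om (fun z => wd (- Ci) (ej j) Uu z * c j k z) by exact: CinfCM.
have hP j k : CcC Om (P j k) by exact: CcCM.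
have hQ j k : CcC Om (Q j k) by exact: CcCM.
have hdP j k : CcC Om (wd (- Ci) (ej j) (P j k)) by exact: CcC_wd.
have hdQ j k : CcC Om (wd Ci (ej k) (Q j k)) by exact: CcC_wd.
have hdQ' j k : CcC Om (fun z => (-1) * wd Ci (ej k) (Q j k) z).
  by apply: CcCM => //; exact: CinfC_cst.
have hD j k : CcC Om (fun z => 4 * (wd (- Ci) (ej j) (P j k) z + (-1) * wd Ci (ej k) (Q j k) z)).
  by apply: CcCM => //; [exact: CinfC_cst|exact: CcCD].
have ddcE j k z : ddc f j k z = 4 * wd (- Ci) (ej j) (wd Ci (ej k) F) z.
  rewrite /ddc dzE; congr (_ * wd _ _ _ z); apply/funext => x; exact: dzbarE.
have hT j k : CcC Om (fun z => Uu z * ddc f j k z * c j k z).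
  rewrite (_ : (fun z => _) = fun z => (Uu z * c j k z * 4) * wd (- Ci) (ej j) (wd Ci (ej k) F) z).
    apply: CcCM => //; last exact: CcC_wd.
    by apply: CinfCM => //; exact: CinfC_cst.
  apply/funext => z; rewrite ddcE (mulrAC (Uu z)) !mulrA; congr (_ * _).
(* The added double sum consists of derivatives of compactly supported smooth functions, so it does
   not change the integral. *)
transitivity (Cintegral mu Om (fun z => F z * ccoef u d.+1 A B z + \sum_j \sum_k
    4 * (wd (- Ci) (ej j) (P j k) z + (-1) * wd Ci (ej k) (Q j k) z))).
  rewrite CintegralD//; last by apply: CcC_sum => // j; exact: CcC_sum.
    rewrite -[LHS]addr0; congr (_ + _).
    rewrite Cintegral_sum => [|//|j]; last exact: CcC_sum.
    rewrite big1// => j _; rewrite Cintegral_sum// big1// => k _.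
    rewrite CintegralZ//; last exact: CcCD.
    rewrite CintegralD// (CintegralZ oOm (-1) (hdQ j k)).
    have -> : Cintegral mu Om (fun z => wd (- Ci) (ej j) (P j k) z) = 0 by exact: Cintegral_wd0.
    have -> : Cintegral mu Om (fun z => wd Ci (ej k) (Q j k) z) = 0 by exact: Cintegral_wd0.
    by rewrite mulr0 addr0 mulr0.
  rewrite (_ : (fun z => _) = fun z => ccoef u d.+1 A B z * F z); last first.
    by apply/funext => z; rewrite mulrC.
  by apply: CcCM => //; exact: CinfC_ccoef.
rewrite -(eq_bigr _ (fun j _ => Cintegral_sum oOm _ (hT j))).
rewrite -Cintegral_sum => [|//|j]; last exact: CcC_sum.
apply: eq_Cintegral => z Oz.
have E j k : Uu z * ddc f j k z * c j k z =
    F z * (levi_form u z j k * c j k z) +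
    (4 * (wd (- Ci) (ej j) (P j k) z + (-1) * wd Ci (ej k) (Q j k) z) +
    (4 * (wd (- Ci) (ej j) Uu z * F z) * wd Ci (ej k) (c j k) z +
     (- (4 * (Uu z * wd Ci (ej k) F z))) * wd (- Ci) (ej j) (c j k) z)).
  have -> : wd (- Ci) (ej j) (P j k) z =
     (wd (- Ci) (ej j) Uu z * c j k z + Uu z * wd (- Ci) (ej j) (c j k) z) * wd Ci (ej k) F z +
     (Uu z * c j k z) * wd (- Ci) (ej j) (wd Ci (ej k) F) z.
    rewrite -(wdM oOm (- Ci) (ej j) hU (hc j k) Oz).
    exact: (wdM oOm (- Ci) (ej j) (h1 j k) (CcC_CinfC (hfk k)) Oz).
  have -> : wd Ci (ej k) (Q j k) z =
     (wd Ci (ej k) (wd (- Ci) (ej j) Uu) z * c j k z + wd (- Ci) (ej j) Uu z * wd Ci (ej k) (c j k) z) * F z +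
     (wd (- Ci) (ej j) Uu z * c j k z) * wd Ci (ej k) F z.
    rewrite -(wdM oOm Ci (ej k) (huj j) (hc j k) Oz).
    exact: (wdM oOm Ci (ej k) (h2 j k) hFO Oz).
  rewrite ddcE mxE; exact: green_subproof.
under [RHS]eq_bigr => j _ do under eq_bigr => k _ do rewrite E.
rewrite (eq_bigr _ (fun j _ => big_split _ _ _ _ _)) big_split /=; congr (_ + _).
  by rewrite ccoefS mulr_sumr; apply: eq_bigr => j _; rewrite mulr_sumr.
rewrite (eq_bigr _ (fun j _ => big_split _ _ _ _ _)) big_split /=.
rewrite -[LHS]addr0; congr (_ + _).
rewrite (eq_bigr _ (fun j _ => big_split _ _ _ _ _)) big_split /=.
rewrite [X in X + _]big1 ?add0r => [|j _]; last first.
  by rewrite -mulr_sumr (ccoef_coclosed oOm uC j sA sB Oz) mulr0.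
rewrite exchange_big big1//= => k _.
by rewrite -mulr_sumr (ccoef_closed oOm uC k sA sB Oz) mulr0.
Qed.

Lemma levi_civitaE (js : N.-tuple 'I_N) :
  RtoC (levi_civita (R := R) js) = detR [seq dl j | j <- js].
Proof.
rewrite /levi_civita /detR.
transitivity (\det (map_mx (real_complex R) (\matrix_(a < N, b < N) (tnth js a == b)%:R)) : cplx R).
  by rewrite det_map_mx.
congr (\det _); apply/matrixP => a b; rewrite !mxE.
rewrite (nth_map ord0) ?size_tuple//.
by rewrite mxE eqxx /= (tnth_nth ord0) eq_sym rmorph_nat.
Qed.

Lemma monge_ampere0 : (forall z, Om z -> \det (levi_form u z) = 0) -> is_monge_ampere Om u mzero.
Proof.
move=> det0; exists ddc_power; split.
- split; first exact: is_lebesgueCV_lebesgueCV.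
  move=> s z; rewrite /= /tcoef /ccoef subnn /=.
  transitivity (RtoC (levi_civita (R := R) [tuple of map fst s]) *
     RtoC (levi_civita (R := R) [tuple of map snd s]) : cplx R).
    by rewrite !levi_civitaE -!map_comp.
  by apply: cplx_eq; rewrite ?ReCM ?ImCM /= ?mulr0 ?mul0r ?subr0 ?addr0.
- move=> p pN s f tf; rewrite /ceval /= /tcoef.
  have -> : (N - p = (N - p.+1).+1)%N by lia.
  rewrite green_identity ?size_map// size_tuple -/N; lia.
- by move=> K _ _ /=; rewrite ltry.
- move=> f tf; rewrite /ceval /=.
  have -> : Rintegral (mzero : {measure set (borelCV R N) -> \bar R}) Om f = 0.
    by rewrite /Rintegral integral_measure_zero.
  rewrite -[RHS](@Cintegral0 R N Om); apply: eq_Cintegral => z Oz.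
  by rewrite /tcoef subn0 /ccoef contr_det0 ?mulr0// det0.
Qed.

End MongeAmpereZero.

(** * The potential on the Siegel domain *)

Lemma is_derive_affine {R : realType} (a b x : R) : is_derive x (1 : R) (fun t => a + b * t) b.
Proof.
have h := is_deriveD (is_derive_cst a x (1 : R)) (is_deriveZ b (is_derive_id x (1 : R))).
by apply: is_derive_eq h _; rewrite add0r; exact: mulr1.
Qed.

(** * The critical equation in real variables *)

Section Implicit.
Context {R : realType}.
Variable c : R.
Hypothesis c01 : 0 < c < 1.
Implicit Types (E q y : R).

(** This is (1 + E)^2 times the derivative of [E * mass E]. As [mass] has derivative - (1 - c) / (1
    + E)^2, [slope] is the function s of the critical equation. *)
Definition denom E : R := (1 - c) + c * ((1 + E) * (1 + E)).
Definition slope E : R := (1 - c) * (denom E)^-1.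
Definition dslope E : R := - 2 * ((1 - c) * (c * ((1 + E) * ((denom E)^-1 * (denom E)^-1)))).
Definition mass E : R := c + (1 - c) * (1 + E)^-1.
(** A closed form of [mass E * (1 + E * slope E)]. On a leaf, log (q / E) = - s(E) (y - E), so the
    function to be maximized has the value [weight E * (E - y)]. *)
Definition weight E : R := (1 + c * E) * (1 + c * E) * (denom E)^-1.

(* The hypersurface [q = leaf E y] meets the boundary [q = y] of the Siegel domain
   along [q = y = E]. *)
Definition leaf E y : R := E * expR (- (slope E * (y - E))).
(** The derivative of [leaf^~ y] stripped of its exponential factor; its sign decides whether the
    critical equation determines E. *)
Definition kappa E y : R := 1 + E * slope E - E * dslope E * (y - E).
Definition dleaf E y : R := expR (- (slope E * (y - E))) * kappa E y.

Let c0 : 0 < c. Proof. by case/andP: c01. Qed.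
Let c1 : 0 < 1 - c. Proof. by case/andP: c01; rewrite subr_gt0. Qed.

Lemma denom_gt0 E : 0 < denom E.
Proof. by rewrite ltr_pwDl// mulr_ge0 ?(ltW c0)// -expr2 sqr_ge0. Qed.

Let dn0 E : denom E != 0. Proof. by rewrite gt_eqF ?denom_gt0. Qed.

Lemma slope_gt0 E : 0 < slope E.
Proof. by rewrite mulr_gt0// invr_gt0 denom_gt0. Qed.

Lemma dslope_le0 E : 0 <= E -> dslope E <= 0.
Proof.
move=> E0; rewrite /dslope mulNr oppr_le0 !mulr_ge0 ?(ltW c1) ?(ltW c0) ?ler0n ?addr_ge0//.
all: by rewrite invr_ge0 ltW// denom_gt0.
Qed.

(** [slope] is positive and nonincreasing, so both terms added to 1 are nonnegative. *)
Lemma kappa_gt0 E y : 0 <= E <= y -> 0 < kappa E y.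
Proof.
move=> /andP[E0 Ey].
have h1 : 0 <= E * slope E by rewrite mulr_ge0// ltW// slope_gt0.
have h2 : 0 <= E * (- dslope E) * (y - E).
  by rewrite !mulr_ge0 ?oppr_ge0 ?dslope_le0 ?subr_ge0.
have -> : kappa E y = 1 + (E * slope E + E * (- dslope E) * (y - E)).
  by rewrite /kappa; ring.
by rewrite ltr_pwDl// addr_ge0.
Qed.

Lemma is_derive_denom E : is_derive E (1 : R) denom (2 * (c * (1 + E))).
Proof.
have h : is_derive E (1 : R) (fun x => 1 + x) 1.
  have := is_derive_affine 1 1 E; congr (is_derive _ _ _ _).
  by apply/funext => x; rewrite mul1r.
have h2 := is_deriveM h h.
have h3 := is_deriveZ c h2.
have h4 := is_deriveD (is_derive_cst (1 - c : R) E (1 : R)) h3.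
apply: is_derive_eq h4 _.
by rewrite /= add0r /GRing.scale /=; ring.
Qed.

Lemma is_derive_slope E : is_derive E (1 : R) slope (dslope E).
Proof.
have h := is_deriveV (dn0 E) (is_derive_denom E).
have h2 := is_deriveZ (1 - c) h.
apply: is_derive_eq h2 _.
by rewrite /dslope /GRing.scale /= -exprVn expr2; ring.
Qed.

(** Solving s = - m' / (E m)' for m' yields this form, which does not mention [c] and feeds the
    later cancellations. *)
Lemma is_derive_mass E : 0 <= E -> is_derive E (1 : R) mass (- (slope E * mass E * (1 + E * slope E)^-1)).
Proof.
move=> E0.
have h : is_derive E (1 : R) (fun x => 1 + x) 1.
  have := is_derive_affine 1 1 E; congr (is_derive _ _ _ _).
  by apply/funext => x; rewrite mul1r.
have n0 : 1 + E != 0 by rewrite gt_eqF// ltr_pwDl.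
have h2 := is_deriveV n0 h.
have h3 := is_deriveZ (1 - c) h2.
have h4 := is_deriveD (is_derive_cst (c : R) E (1 : R)) h3.
apply: is_derive_eq h4 _.
rewrite /= add0r /GRing.scale /= mulr1 /mass /slope.
have n1 : 1 + c * E != 0 by rewrite gt_eqF// ltr_pwDl// mulr_ge0// ltW.
have := dn0 E.
have -> : 1 + E * ((1 - c) / denom E) = (1 + E) * (1 + c * E) / denom E.
  by rewrite /denom; field; exact: dn0.
move=> dE; rewrite -exprVn /denom in dE *; field.
by rewrite dE n1 n0.
Qed.

Lemma weightE E : 0 <= E -> weight E = mass E * (1 + E * slope E).
Proof.
move=> E0; have n0 : 1 + E != 0 by rewrite gt_eqF// ltr_pwDl.
rewrite /weight /mass /slope; have := dn0 E; rewrite /denom => dE.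
by field; rewrite dE n0.
Qed.

Lemma is_derive_weight E : 0 <= E -> is_derive E (1 : R) weight (mass E * dslope E * E).
Proof.
move=> E0.
have n0 : 1 + E != 0 by rewrite gt_eqF// ltr_pwDl.
have h := is_derive_affine 1 c E.
have h2 := is_deriveM (is_deriveM h h) (is_deriveV (dn0 E) (is_derive_denom E)).
apply: is_derive_eq h2 _.
rewrite /mass /dslope /GRing.scale /= -exprVn; have := dn0 E; rewrite /denom => dE; rewrite ?fctE.
by field; rewrite dE n0.
Qed.

Lemma is_derive_leaf E y : is_derive E (1 : R) (leaf^~ y) (dleaf E y).
Proof.
have h : is_derive E (1 : R) (fun x => y - x) (-1).
  have := is_derive_affine y (-1) E; congr (is_derive _ _ _ _).
  by apply/funext => x; rewrite mulN1r.
have h2 := is_deriveN (is_deriveM (is_derive_slope E) h).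
have h3 := @is_derive1_comp _ expR (fun x => - (slope x * (y - x))) E _ _ (is_derive_expR _) h2.
have h4 := is_deriveM (is_derive_id E (1 : R)) h3.
apply: is_derive_eq h4 _.
by rewrite /dleaf /kappa /GRing.scale /=; ring.
Qed.

Lemma leaf_continuous_l y : continuous (leaf^~ y).
Proof.
move=> E; have [+ _] := is_derive_leaf E y.
by move=> /derivable1_diffP/differentiable_continuous.
Qed.

Lemma leaf_mono y E F : 0 <= E -> E < F -> F <= y -> leaf E y < leaf F y.
Proof.
move=> E0 EF Fy.
have h1 x : x \in `]E, F[ -> is_derive x (1 : R) (leaf^~ y) (dleaf x y).
  by move=> _; exact: is_derive_leaf.
have h2 : {within `[E, F], continuous (leaf^~ y)}.
  by apply: continuous_subspaceT; exact: leaf_continuous_l.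
have [x] := MVT EF h1 h2; rewrite in_itv/= => /andP[Ex xF] E1.
rewrite -subr_gt0 E1 mulr_gt0 ?subr_gt0// mulr_gt0 ?expR_gt0// kappa_gt0//.
by rewrite (le_trans E0 (ltW Ex)) (le_trans (ltW xF)).
Qed.

Definition solE q y : R := xget 0 [set E | 0 <= E < y /\ leaf E y = q].

(** The intermediate value theorem between [leaf 0 y = 0] and [leaf y y = y]; the latter also
    excludes the endpoint E = y. *)
Lemma solEP q y : 0 <= q < y -> 0 <= solE q y < y /\ leaf (solE q y) y = q.
Proof.
move=> /andP[q0 qy].
have y0 : 0 < y by exact: le_lt_trans qy.
have l0 : leaf 0 y = 0 by rewrite /leaf mul0r.
have ly : leaf y y = y by rewrite /leaf subrr mulr0 oppr0 expR0 mulr1.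
have [E Ei Eq] : exists2 E, E \in `[0, y] & leaf E y = q.
  apply: (IVT (ltW y0)); first by apply: continuous_subspaceT; exact: leaf_continuous_l.
  rewrite l0 ly min_l ?max_r ?(ltW y0)// q0 ltW//.
apply: (@xgetPex _ 0 [set E | 0 <= E < y /\ leaf E y = q]); exists E; split => //.
move: Ei; rewrite in_itv/= => /andP[-> Ey] /=; rewrite lt_neqAle Ey andbT.
by apply: contra_ltN qy => /eqP Ey'; rewrite -Eq Ey' ly.
Qed.

Section Convergence.
Variables (T : Type) (F : set_system T).
Context {FF : Filter F}.

Lemma cvg_slope (e : T -> R) (E : R) : e @ F --> E -> slope (e x) @[x --> F] --> slope E.
Proof.
move=> eE; have [+ _] := is_derive_slope E.
move=> /derivable1_diffP/differentiable_continuous h.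
exact: (cvg_comp _ _ eE h).
Qed.

Lemma cvg_leaf (e y : T -> R) (E Y : R) : e @ F --> E -> y @ F --> Y ->
  leaf (e x) (y x) @[x --> F] --> leaf E Y.
Proof.
move=> eE yY; apply: cvgM => //.
have h : - (slope (e x) * (y x - e x)) @[x --> F] --> - (slope E * (Y - E)).
  by apply: cvgN; apply: cvgM; [exact: cvg_slope|exact: cvgB].
by apply: (cvg_comp _ _ h); exact: continuous_expR.
Qed.

Lemma cvg_dleaf (e y : T -> R) (E Y : R) : e @ F --> E -> y @ F --> Y ->
  dleaf (e x) (y x) @[x --> F] --> dleaf E Y.
Proof.
move=> eE yY.
have h : - (slope (e x) * (y x - e x)) @[x --> F] --> - (slope E * (Y - E)).
  by apply: cvgN; apply: cvgM; [exact: cvg_slope|exact: cvgB].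
have e1 : 1 + e x @[x --> F] --> 1 + E by apply: cvgD => //; exact: cvg_cst.
have hd : (denom (e x))^-1 @[x --> F] --> (denom E)^-1.
  apply: cvgV; first exact: dn0.
  apply: cvgD; first exact: cvg_cst.
  by apply: cvgM; [exact: cvg_cst|exact: cvgM].
have hs : dslope (e x) @[x --> F] --> dslope E.
  apply: cvgM; first exact: cvg_cst.
  apply: cvgM; first exact: cvg_cst.
  apply: cvgM; first exact: cvg_cst.
  by apply: cvgM => //; exact: cvgM.
apply: cvgM.
  by apply: (cvg_comp _ _ h); exact: continuous_expR.
apply: cvgB; last by apply: cvgM; [exact: cvgM|exact: cvgB].
by apply: cvgD; [exact: cvg_cst|apply: cvgM => //; exact: cvg_slope].
Qed.

(** The root is trapped by monotonicity. At a level slightly above the limit, [leaf] strictly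
    exceeds [q], and this persists for nearby data, so the root stays below that level; the lower
    bound is similar. *)
Lemma cvg_solE (q y : T -> R) (Q Y : R) : 0 <= Q < Y -> q @ F --> Q -> y @ F --> Y ->
  (\forall x \near F, 0 <= q x < y x) -> solE (q x) (y x) @[x --> F] --> solE Q Y.
Proof.
move=> QY qQ yY qy; have [/andP[E0 EY] EQ] := solEP QY.
set E := solE Q Y in E0 EY EQ *.
apply/cvgrPdist_lt => e e0.
have up : \forall x \near F, solE (q x) (y x) < E + e.
  (* The second term keeps [b] below [Y], within the range where [leaf] is known to increase. *)
  pose b := Order.min (E + e) ((E + Y) / 2).
  have Eb : E < b by rewrite lt_min ltrDl e0/= ltr_pdivlMr// mulrDr mulr1 ltrD2l.
  have bY : b < Y.
    by rewrite gt_min; apply/orP; right; rewrite ltr_pdivrMr// mulrDr mulr1 ltrD2r.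
  have Qb : Q < leaf b Y by rewrite -EQ leaf_mono// ltW.
  have lb : leaf b (y x) - q x @[x --> F] --> leaf b Y - Q.
    by apply: cvgB => //; apply: cvg_leaf => //; exact: cvg_cst.
  near=> x.
  have qyx : 0 <= q x < y x by near: x.
  have [/andP[S0 Sy] Sq] := solEP qyx.
  have h1 : 0 < leaf b (y x) - q x.
    by near: x; apply: (cvgr_gt _ lb); rewrite subr_gt0.
  have bE : b <= E + e by rewrite ge_min lexx.
  rewrite (lt_le_trans _ bE)// ltNge; apply/negP => bS.
  have : leaf b (y x) <= leaf (solE (q x) (y x)) (y x).
    move: bS; rewrite le_eqVlt => /predU1P[->//|bS].
    by apply/ltW/leaf_mono => //; [exact: ltW (le_lt_trans E0 Eb)|exact: ltW].
  by rewrite Sq leNgt -subr_gt0 h1.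
have dn : \forall x \near F, E - e < solE (q x) (y x).
  have [a0|a0] := ltP (E - e) 0.
    near=> x.
    have qyx : 0 <= q x < y x by near: x.
    by have [/andP[S0 Sy] Sq] := solEP qyx; exact: lt_le_trans S0.
  set a := E - e in a0 *.
  have aE : a < E by rewrite ltrBlDr ltrDl.
  have aQ : leaf a Y < Q by rewrite -EQ leaf_mono// ltW.
  have lb : q x - leaf a (y x) @[x --> F] --> Q - leaf a Y.
    by apply: cvgB => //; apply: cvg_leaf => //; exact: cvg_cst.
  near=> x.
  have qyx : 0 <= q x < y x by near: x.
  have [/andP[S0 Sy] Sq] := solEP qyx.
  have h1 : 0 < q x - leaf a (y x).
    by near: x; apply: (cvgr_gt _ lb); rewrite subr_gt0.
  have ay : a <= y x by near: x; apply: (cvgr_ge _ yY); exact: lt_trans EY.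
  rewrite ltNge; apply/negP => Sa.
  have : leaf (solE (q x) (y x)) (y x) <= leaf a (y x).
    move: Sa; rewrite le_eqVlt => /predU1P[->//|Sa].
    by apply/ltW/leaf_mono.
  by rewrite Sq leNgt -subr_gt0 h1.
near=> x; rewrite distrC ltr_distl; apply/andP; split; near: x => //.
Unshelve. all: by end_near. Qed.

End Convergence.

Lemma is_derive_leafr E y : is_derive y (1 : R) (leaf E) (- (E * slope E * expR (- (slope E * (y - E))))).
Proof.
have h := is_derive_affine (slope E * E) (- slope E) y.
have h2 := @is_derive1_comp _ expR (fun t => slope E * E + - slope E * t) y _ _ (is_derive_expR _) h.
have h3 := is_deriveZ E h2.
have <- : E \*: (expR \o (fun t => slope E * E + - slope E * t)) = leaf E.
  apply/funext => t; rewrite /leaf /GRing.scale /=; congr (_ * expR _); ring.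
apply: is_derive_eq h3 _; rewrite /GRing.scale /=.
rewrite (_ : slope E * E + - slope E * y = - (slope E * (y - E))); ring.
Qed.

(** The intermediate point is returned as data, so that it can become a function of the parameter;
    the distance bound makes it converge together with [b]. *)
Lemma mvt_between (f df : R -> R) a b : (forall x, is_derive x (1 : R) f (df x)) ->
  {x | `|a - x| <= `|a - b| & f b - f a = df x * (b - a)}.
Proof.
move=> fdf; apply: cid2.
have cf A : {within A, continuous f}.
  apply: continuous_subspaceT => x; have [+ _] := fdf x.
  by move=> /derivable1_diffP/differentiable_continuous.
have [ab|ba] := leP a b.
  have [x] := MVT_segment ab (fun x _ => fdf x) (cf _).
  rewrite in_itv/= => /andP[ax xb] E; exists x => //.
  by rewrite ler0_norm ?subr_le0// ler0_norm ?subr_le0//; lra.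
have [x] := MVT_segment (ltW ba) (fun x _ => fdf x) (cf _).
rewrite in_itv/= => /andP[bx xa] E; exists x.
  by rewrite ger0_norm ?subr_ge0// ger0_norm ?subr_ge0 ?(ltW ba)//; lra.
by apply: oppr_inj; rewrite opprB E -mulrN opprB.
Qed.

(** Implicit differentiation by hand. By the mean value theorem, [e t - E] times [dleaf] at an
    intermediate point equals [r t], the difference of [q t] and [leaf E (y t)], where E is frozen.
    This [r] is differentiable by the chain rule, and the other factor tends to the positive number
    [dleaf E (y 0)]. *)
Lemma is_derive_solE (q y : R -> R) dq dy :
  is_derive 0 (1 : R) q dq -> is_derive 0 (1 : R) y dy ->
  (\forall t \near 0, 0 <= q t < y t) ->
  let E := solE (q 0) (y 0) in
  is_derive 0 (1 : R) (fun t => solE (q t) (y t))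
    ((kappa E (y 0))^-1 * (expR (slope E * (y 0 - E)) * dq + E * slope E * dy)).
Proof.
move=> hq hy qy E.
have qy0 : 0 <= q 0 < y 0 by exact: nbhs_singleton qy.
have [/andP[E0 Ey] Eq] := solEP qy0; rewrite -/E in E0 Ey Eq.
have cq : q @ nbhs 0 --> q 0.
  by have [+ _] := hq; move=> /derivable1_diffP/differentiable_continuous.
have cy : y @ nbhs 0 --> y 0.
  by have [+ _] := hy; move=> /derivable1_diffP/differentiable_continuous.
pose e t := solE (q t) (y t).
have ce : e @ nbhs 0 --> E by exact: (cvg_solE qy0 cq cy qy).
pose X t := mvt_between E (e t) (fun x => is_derive_leaf x (y t)).
pose x t := s2val (X t).
have x1 t : `|E - x t| <= `|E - e t| by exact: (s2valP (X t)).
have x2 t : leaf (e t) (y t) - leaf E (y t) = dleaf (x t) (y t) * (e t - E).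
  exact: (s2valP' (X t)).
have cx : x @ nbhs 0 --> E.
  apply/cvgrPdist_lt => d d0; near=> t; apply: le_lt_trans (x1 t) _; near: t.
  by move/cvgrPdist_lt : ce; apply.
have cd : dleaf (x t) (y t) @[t --> nbhs 0] --> dleaf E (y 0) by exact: cvg_dleaf.
have d0 : 0 < dleaf E (y 0) by rewrite mulr_gt0 ?expR_gt0// kappa_gt0// E0 ltW.
pose r t := q t - leaf E (y t).
have hr := is_deriveB hq (@is_derive1_comp _ (leaf E) y 0 _ _ (is_derive_leafr E (y 0)) hy).
set dr := (X in is_derive _ _ _ X) in hr.
have r0 : r 0 = 0 by rewrite /r Eq subrr.
have lr : h^-1 *: (r (h *: 1 + 0) - r 0) @[h --> 0^'] --> dr.
  by have [h1 <-] := hr; exact: h1.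
have sub0 : nbhs (0 : R)^' `=>` nbhs (0 : R) by exact: nbhs_dnbhs.
have dnear := cvgr_gt _ cd _ d0.
have lim : h^-1 *: (e (h *: 1 + 0) - e 0) @[h --> 0^'] --> dr * (dleaf E (y 0))^-1.
  have cd' : (dleaf (x h) (y h))^-1 @[h --> 0^'] --> (dleaf E (y 0))^-1.
    apply: cvgV; first by rewrite gt_eqF.
    by move=> A /cd; exact: sub0.
  apply: cvg_trans (cvgM lr cd').
  apply: near_eq_cvg; near=> h.
  rewrite /= !addr0 [h *: 1]mulr1 r0 subr0.
  have qyh : 0 <= q h < y h by near: h; exact: sub0.
  have dh : 0 < dleaf (x h) (y h).
    by near: h; apply: sub0; exact: dnear.
  have -> : r h = dleaf (x h) (y h) * (e h - E).
    by rewrite -x2 /r; have [_ ->] := solEP qyh.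
  rewrite /GRing.scale /=; set D := dleaf _ _ in dh *; set a := h^-1.
  have D0 : D != 0 by rewrite gt_eqF.
  by rewrite -[e 0]/E; field.
have hd : is_derive 0 (1 : R) e (dr * (dleaf E (y 0))^-1).
  by apply: DeriveDef; [exact: cvgP lim|exact: cvg_lim lim].
apply: is_derive_eq hd _.
rewrite /dr /dleaf expRN.
have g0 : expR (slope E * (y 0 - E)) != 0 by rewrite gt_eqF ?expR_gt0.
have k0 : kappa E (y 0) != 0 by rewrite gt_eqF// kappa_gt0// E0 ltW.
by field; rewrite g0 k0.
Unshelve. all: by end_near. Qed.

End Implicit.

(** * Smoothness and first derivatives of the potential *)

Section Potential.
Context {R : realType} {M : nat}.
Variable c : R.
Hypothesis c01 : 0 < c < 1.
Variable Om : set 'CV[R]_M.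
Hypothesis oOm : open Om.
Variables q Y : 'CV[R]_M -> R.
Hypotheses (qC : Cinf Om q) (YC : Cinf Om Y).
Hypothesis qY : forall z, Om z -> 0 <= q z < Y z.
Implicit Types (z v : 'CV[R]_M).

Definition hgt z := solE c (q z) (Y z).
(** The quotient E / q, in a form that stays smooth on q = 0; compare [hgtE]. *)
Definition gain z := expR (slope c (hgt z) * (Y z - hgt z)).
Definition pot z := weight c (hgt z) * (hgt z - Y z).
Let s z := slope c (hgt z).
Let k z := kappa c (hgt z) (Y z).
Let m z := mass c (hgt z).
Let t z := dslope c (hgt z) * (Y z - hgt z) - s z.

Lemma hgtP z : Om z -> 0 <= hgt z < Y z /\ leaf c (hgt z) (Y z) = q z.
Proof. by move=> Oz; exact: (solEP c01 (qY Oz)). Qed.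

Lemma hgtE z : Om z -> hgt z = q z * gain z.
Proof.
move=> Oz; have [_ <-] := hgtP Oz.
by rewrite /leaf /gain -mulrA -expRD addNr expR0 mulr1.
Qed.

Lemma k_gt0 z : Om z -> 0 < k z.
Proof. by move=> Oz; have [/andP[h1 h2] _] := hgtP Oz; apply: kappa_gt0 => //; rewrite h1 ltW. Qed.

Lemma Ck_denom j f : Ck Om j f -> Ck Om j (fun z => (denom c (f z))^-1).
Proof.
move=> hf; apply: CkV => [//|z _|]; first by rewrite gt_eqF// denom_gt0.
have h1 : Ck Om j (fun z => 1 + f z) by apply: CkD => //; exact: Ck_cst.
apply: CkD => //; first exact: Ck_cst.
by apply: CkM => //; [exact: Ck_cst|exact: CkM].
Qed.

Lemma Ck_slope j f : Ck Om j f -> Ck Om j (fun z => slope c (f z)).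
Proof. by move=> hf; apply: CkM => //; [exact: Ck_cst|exact: Ck_denom]. Qed.

Lemma Ck_dslope j f : Ck Om j f -> Ck Om j (fun z => dslope c (f z)).
Proof.
move=> hf; have hd := Ck_denom hf.
have h1 : Ck Om j (fun z => 1 + f z) by apply: CkD => //; exact: Ck_cst.
apply: CkM => //; first exact: Ck_cst.
apply: CkM => //; first exact: Ck_cst.
apply: CkM => //; first exact: Ck_cst.
by apply: CkM => //; exact: CkM.
Qed.

Lemma is_derive_hgt z v : Om z -> is_derive (0 : R) (1 : R) (real_line hgt z v)
  ((k z)^-1 * (gain z * dirD v q z + hgt z * s z * dirD v Y z)).
Proof.
move=> Oz.
have h1 := CkS_derive v (qC 1%N) Oz; have h2 := CkS_derive v (YC 1%N) Oz.
have h3 : \forall t \near 0, 0 <= real_line q z v t < real_line Y z v t.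
  near=> r; rewrite !real_lineE; apply: qY; near: r; exact: near_line.
have := is_derive_solE c01 h1 h2 h3.
by rewrite !real_lineE line0.
Unshelve. all: by end_near. Qed.

(** Bootstrapping: the derivative of [hgt] is a smooth expression in [hgt], [q], [Y] and the first
    derivatives of [q] and [Y], so each order of regularity of [hgt] yields the next. *)
Lemma Cinf_hgt : Cinf Om hgt.
Proof.
have ch z : Om z -> {for z, continuous hgt}.
  move=> Oz; apply: (@cvg_solE R c c01 _ (nbhs z) _ q Y (q z) (Y z)).
  - exact: qY.
  - exact: (Ck_cvg (qC 0%N) Oz).
  - exact: (Ck_cvg (YC 0%N) Oz).
  - by apply: filterS (open_nbhs_nbhs (conj oOm Oz)) => x; exact: qY.
elim=> [|j IH]; first by split.
apply: (CkSI oOm) => // v.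
exists (fun z => (k z)^-1 * (gain z * dirD v q z + hgt z * s z * dirD v Y z)); split.
  by move=> z; exact: is_derive_hgt.
have hs := Ck_slope IH.
have hYe : Ck Om j (fun z => Y z - hgt z).
  apply: (Ck_ext oOm (f := fun z => Y z + (-1) * hgt z)) => [z _|]; first by rewrite mulN1r.
  by apply: CkD => //; apply: CkM => //; exact: Ck_cst.
have hk : Ck Om j (fun z => (k z)^-1).
  apply: CkV => // [z Oz|]; first by rewrite gt_eqF// k_gt0.
  apply: (Ck_ext oOm (f := fun z => 1 + hgt z * s z + (-1) * (hgt z * dslope c (hgt z) * (Y z - hgt z)))).
    by move=> z _; rewrite mulN1r.
  apply: CkD => //; first by apply: CkD => //; [exact: Ck_cst|exact: CkM].
  apply: CkM => //; first exact: Ck_cst.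
  by apply: CkM => //; apply: CkM => //; exact: Ck_dslope.
have hg : Ck Om j gain by apply: (Ck_expR oOm); exact: CkM.
apply: CkM => //; apply: CkD => //; apply: CkM => //; first exact: CkS_dirD (qC j.+1).
  exact: CkM.
exact: CkS_dirD (YC j.+1).
Qed.

Lemma Cinf_slope : Cinf Om s. Proof. by move=> j; apply: Ck_slope; exact: Cinf_hgt. Qed.

Lemma Cinf_gain : Cinf Om gain.
Proof.
apply: Cinf_expR => //; apply: CinfM => //; first exact: Cinf_slope.
by apply: CinfB => //; exact: Cinf_hgt.
Qed.

Lemma hgt1_neq0 z : Om z -> 1 + hgt z != 0.
Proof. by move=> Oz; have [/andP[h _] _] := hgtP Oz; rewrite gt_eqF// ltr_pwDl. Qed.

Lemma Cinf_mass : Cinf Om m.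
Proof.
have he := Cinf_hgt.
apply: CinfD => //; first exact: Cinf_cst.
apply: CinfM => //; first exact: Cinf_cst.
apply: CinfV => // [z Oz|]; first exact: hgt1_neq0.
by apply: CinfD => //; exact: Cinf_cst.
Qed.

Lemma Cinf_pot : Cinf Om pot.
Proof.
have he := Cinf_hgt.
apply: CinfM => //; last exact: CinfB.
apply: CinfM => //; last by move=> j; exact: Ck_denom.
have h : Cinf Om (fun z => 1 + c * hgt z).
  by apply: CinfD => //; [exact: Cinf_cst|apply: CinfM => //; exact: Cinf_cst].
exact: CinfM.
Qed.

Lemma dirD_hgt v z : Om z ->
  dirD v hgt z = (k z)^-1 * (gain z * dirD v q z + hgt z * s z * dirD v Y z).
Proof. by move=> Oz; apply: isD_dirD; exact: is_derive_hgt. Qed.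

Lemma dirD_Yhgt v z : Om z -> dirD v (fun z => Y z - hgt z) z = dirD v Y z - dirD v hgt z.
Proof. by move=> Oz; apply: (dirDB _ YC Cinf_hgt Oz). Qed.

Lemma dirD_gain v z : Om z ->
  dirD v gain z = gain z * (t z * dirD v hgt z + s z * dirD v Y z).
Proof.
move=> Oz; have he := Cinf_hgt.
have h1 : Cinf Om (fun z => s z * (Y z - hgt z)).
  by apply: CinfM => //; [exact: Cinf_slope|exact: CinfB].
rewrite (dirD_comp v (h1 1%N) Oz (is_derive_expR _)); congr (_ * _).
rewrite (dirDM v (Cinf_slope 1%N) (CinfB oOm YC he 1%N) Oz) dirD_Yhgt//.
rewrite (dirD_comp v (he 1%N) Oz (is_derive_slope c01 _)) /t; ring.
Qed.

Lemma dirD_mass v z : Om z ->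
  dirD v m z = - (s z * m z * (1 + hgt z * s z)^-1) * dirD v hgt z.
Proof.
move=> Oz; have [/andP[h0 _] _] := hgtP Oz.
by rewrite (dirD_comp v (Cinf_hgt 1%N) Oz (is_derive_mass c01 h0)).
Qed.

(** The envelope theorem: at a critical E the derivative of E drops out. What remains are the
    partial derivatives m E / q and - m of the maximized function in q and y. *)
Lemma dirD_pot v z : Om z -> dirD v pot z = m z * gain z * dirD v q z - m z * dirD v Y z.
Proof.
move=> Oz; have [/andP[h0 _] _] := hgtP Oz; have he := Cinf_hgt.
have hw : Cinf Om (fun z => weight c (hgt z)).
  have h : Cinf Om (fun z => 1 + c * hgt z).
    by apply: CinfD => //; [exact: Cinf_cst|apply: CinfM => //; exact: Cinf_cst].
  by apply: CinfM => //; [exact: CinfM|move=> j; exact: Ck_denom].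
rewrite (dirDM v (hw 1%N) (CinfB oOm he YC 1%N) Oz) (dirDB v he YC Oz).
rewrite (dirD_comp v (he 1%N) Oz (is_derive_weight c01 h0)) (weightE c01 h0).
rewrite dirD_hgt//; have := k_gt0 Oz; rewrite /k /kappa -/(s z) -/(m z) => k0.
by field; rewrite gt_eqF.
Qed.

Lemma mass_ge0 z : Om z -> 0 <= m z.
Proof.
move=> Oz; have [/andP[h0 _] _] := hgtP Oz.
case/andP: c01 => c0 c1; rewrite /m /mass addr_ge0 ?(ltW c0)// mulr_ge0 ?subr_ge0 ?(ltW c1)//.
by rewrite invr_ge0 addr_ge0.
Qed.

(* The coefficient of [b_j conj(b_k)] in the Levi form of [pot]. *)
Definition levi_coef z := m z * gain z / (k z * (1 + hgt z * s z)).

Lemma levi_coef_ge0 z : Om z -> 0 <= levi_coef z.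
Proof.
move=> Oz; have [/andP[h0 _] _] := hgtP Oz; have m0 := mass_ge0 Oz.
rewrite /levi_coef divr_ge0 ?mulr_ge0 ?expR_ge0// ?ltW ?k_gt0//.
by rewrite ltr_pwDl// mulr_ge0// ltW// slope_gt0.
Qed.

(** The coefficients do not depend on [v], so they pass to complex derivatives by [wd_lin]. Their
    values are those that complete the square in [levi_subproof]. *)
Lemma dirD_mass_coef z : Om z -> exists alpha beta : R,
  [/\ forall v, dirD v m z = alpha * dirD v q z + beta * dirD v Y z,
      alpha = - (s z * levi_coef z) & beta = - (s z * s z * q z * levi_coef z)].
Proof.
move=> Oz; have [/andP[h0 _] _] := hgtP Oz; have kn : k z != 0 by rewrite gt_eqF// k_gt0.
have en : 1 + hgt z * s z != 0.
  by rewrite gt_eqF// ltr_pwDl// mulr_ge0// ltW// slope_gt0.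
do 2 eexists; split; [|reflexivity|reflexivity] => v.
rewrite dirD_mass// dirD_hgt// /levi_coef; move: en; rewrite (hgtE Oz) => en.
by field; rewrite kn en.
Qed.

(** [alpha] is described only through the sum that ends up multiplying the products of first
    derivatives of zeta_1 in the Levi form. *)
Lemma dirD_gain_coef z : Om z -> exists alpha beta : R,
  [/\ forall v, dirD v (fun z => m z * gain z) z = alpha * dirD v q z + beta * dirD v Y z,
      alpha * q z + m z * gain z = levi_coef z & beta = levi_coef z * s z].
Proof.
move=> Oz; have [/andP[h0 _] _] := hgtP Oz.
have kE : k z = 1 - hgt z * t z by rewrite /k /kappa /t -/(s z); ring.
have kn : k z != 0 by rewrite gt_eqF// k_gt0.
have en : 1 + hgt z * s z != 0.
  by rewrite gt_eqF// ltr_pwDl// mulr_ge0// ltW// slope_gt0.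
exists (- (s z * m z * (1 + hgt z * s z)^-1) * gain z * gain z / k z + m z * gain z * t z * gain z / k z).
exists (- (s z * m z * (1 + hgt z * s z)^-1) * gain z * hgt z * s z / k z +
   m z * gain z * (t z * hgt z * s z / k z + s z)).
rewrite /levi_coef; split=> [v||].
- rewrite (dirDM v (Cinf_mass 1%N) (Cinf_gain 1%N) Oz) dirD_mass// dirD_gain// dirD_hgt//.
  by field; rewrite kn en.
- move: en kn; rewrite kE (hgtE Oz) => en kn.
  by field; rewrite kn en.
- move: kn; rewrite kE => kn.
  by field; rewrite kn en.
Qed.

End Potential.

(** Completing the square. Here [z] is zeta_1, [cj] and [yj] are the derivatives of zeta_1 and Y in
    z_j, a final [b] marks conjugates, and [- S] is the Levi form of Y. The four hypotheses are what
    makes the terms in [cj], [yj], [ckb], [ykb] a single product. *)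
Lemma levi_subproof (K : comPzRingType) (A1 B1 A2 B2 a s m mg z zb cj ckb yj ykb S : K) :
  A1 * (z * zb) + mg = a -> B1 = a * s -> A2 = - (s * a) -> B2 = - (s * s * (z * zb) * a) ->
  (A1 * (z * ckb) + B1 * ykb) * (zb * cj) + mg * (ckb * cj)
  - ((A2 * (z * ckb) + B2 * ykb) * yj + m * - S) =
  a * (cj + s * z * yj) * (ckb + s * zb * ykb) + m * S.
Proof.
move=> h1 -> -> ->; have -> : mg = a - A1 * (z * zb) by rewrite -h1; ring.
by ring.
Qed.

Lemma wd_lin_subproof (K : comPzRingType) (h s a b x1 x2 y1 y2 : K) :
  h * ((a * x1 + b * y1) + s * (a * x2 + b * y2)) =
  a * (h * (x1 + s * x2)) + b * (h * (y1 + s * y2)).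
Proof. by ring. Qed.

(** * The Levi form of the potential *)

Section LeviForm.
Context {R : realType} {M p : nat}.
Variable c : R.
Hypothesis c01 : 0 < c < 1.
Variable Om : set 'CV[R]_M.
Hypothesis oOm : open Om.
Implicit Types (F G : 'CV[R]_M -> cplx R) (z : 'CV[R]_M).

Definition holo F := CinfC Om F /\ forall k z, Om z -> wd Ci (ej k) F z = 0.

Variables (zeta : 'I_p.+1 -> 'CV[R]_M -> cplx R) (omega : 'CV[R]_M -> cplx R).
Hypotheses (hz : forall l, holo (zeta l)) (ho : holo omega).

Definition hq z := normC2 (zeta ord0 z).
Definition hY z := ReC (omega z) - \sum_(l < p) normC2 (zeta (lift ord0 l) z).
Hypothesis qY : forall z, Om z -> hq z < hY z.

Lemma Cinf_hq : Cinf Om hq.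
Proof. exact: (CinfC_normC2 oOm (hz ord0).1). Qed.

Lemma Cinf_hY : Cinf Om hY.
Proof.
apply: CinfB => //; first exact: ho.1.1.
by apply: Cinf_sum => // l; exact: (CinfC_normC2 oOm (hz _).1).
Qed.

Lemma qY0 z : Om z -> 0 <= hq z < hY z.
Proof. by move=> Oz; rewrite qY// normC2_ge0. Qed.

Lemma RtoCD (x y : R) : RtoC (x + y) = RtoC x + RtoC y :> cplx R.
Proof. by apply: cplx_eq; rewrite ?ReCD ?ImCD /= ?addr0. Qed.
Lemma RtoCM (x y : R) : RtoC (x * y) = RtoC x * RtoC y :> cplx R.
Proof. by apply: cplx_eq; rewrite ?ReCM ?ImCM /= ?mulr0 ?mul0r ?subr0 ?addr0. Qed.
Lemma RtoCN (x : R) : RtoC (- x) = - RtoC x :> cplx R.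
Proof. by apply: cplx_eq; rewrite ?ReCN ?ImCN /= ?oppr0. Qed.

Lemma wd_lin s d (f g h : 'CV[R]_M -> R) al be z :
  (forall v, dirD v f z = al * dirD v g z + be * dirD v h z) ->
  wd s d (fun z => RtoC (f z)) z =
  RtoC al * wd s d (fun z => RtoC (g z)) z + RtoC be * wd s d (fun z => RtoC (h z)) z.
Proof.
move=> fE.
have E (f' : 'CV[R]_M -> R) v : cder v (fun z => RtoC (f' z)) z = RtoC (dirD v f' z).
  by rewrite [cder]unlock /dirDC /= dirD_cst.
have Ev v : cder v (fun z => RtoC (f z)) z = RtoC al * cder v (fun z => RtoC (g z)) z +
    RtoC be * cder v (fun z => RtoC (h z)) z.
  rewrite (E f v) (E g v) (E h v) (fE v).
  exact: etrans (RtoCD _ _) (congr2 +%R (RtoCM _ _) (RtoCM _ _)).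
rewrite /wd (Ev d.1) (Ev d.2); exact: wd_lin_subproof.
Qed.

Lemma cj_RtoC (x : R) : cj (RtoC x) = RtoC x.
Proof. by apply: cplx_eq; rewrite /= ?oppr0. Qed.

Lemma cj_Ci : cj (Ci : cplx R) = - Ci.
Proof. by apply: cplx_eq; rewrite ?ReCN ?ImCN /= ?oppr0. Qed.

Lemma cj_NCi : cj (- Ci : cplx R) = Ci.
Proof. by rewrite cjN cj_Ci opprK. Qed.

Lemma wdbar_real d f z : Cinf Om f -> Om z ->
  wd Ci d (fun z => RtoC (f z)) z = cj (wd (- Ci) d (fun z => RtoC (f z)) z).
Proof.
move=> hf Oz; have := wd_cj Ci d (CinfC_RtoC oOm hf) Oz; rewrite cj_Ci => <-.
by apply: (wd_ext oOm) => // x _; rewrite cj_RtoC.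
Qed.

Lemma wdbar_cj k F z : CinfC Om F -> Om z ->
  wd Ci (ej k) (fun z => cj (F z)) z = cj (wd (- Ci) (ej k) F z).
Proof. by move=> hF Oz; rewrite (wd_cj Ci (ej k) hF Oz) cj_Ci. Qed.

Lemma wd_cj0 j F z : holo F -> Om z -> wd (- Ci) (ej j) (fun z => cj (F z)) z = 0.
Proof.
move=> [hF F0] Oz; rewrite (wd_cj (- Ci) (ej j) hF Oz) cj_NCi F0//.
by apply: cplx_eq; rewrite /= ?oppr0.
Qed.

Lemma wdbar_wd0 j k F z : holo F -> Om z -> wd Ci (ej k) (wd (- Ci) (ej j) F) z = 0.
Proof.
move=> [hF F0] Oz; rewrite (wd_comm oOm)// -[RHS](wd_cst (- Ci) (ej j) 0 z).
by apply: (wd_ext oOm) => // x Ox; rewrite F0.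
Qed.

Lemma wd_normC2 j F z : holo F -> Om z ->
  wd (- Ci) (ej j) (fun z => RtoC (normC2 (F z))) z = cj (F z) * wd (- Ci) (ej j) F z.
Proof.
move=> hF Oz; have hFc := CinfC_cj oOm hF.1.
rewrite -[RHS]addr0 -(mulr0 (F z)) -(wd_cj0 j hF Oz) [X in X + _]mulrC.
rewrite -(wdM oOm (- Ci) (ej j) hF.1 hFc Oz).
by apply: (wd_ext oOm) => // x _; rewrite mulC_cj.
Qed.

Lemma levi_normC2 j k F z : holo F -> Om z ->
  wd Ci (ej k) (wd (- Ci) (ej j) (fun z => RtoC (normC2 (F z)))) z =
  cj (wd (- Ci) (ej k) F z) * wd (- Ci) (ej j) F z.
Proof.
move=> hF Oz; have hFc := CinfC_cj oOm hF.1.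
have hFj := CinfC_wd oOm (- Ci) (ej j) hF.1.
rewrite (wd_ext oOm Ci (ej k) (fun x Ox => wd_normC2 j hF Ox) Oz).
by rewrite (wdM oOm Ci (ej k) hFc hFj Oz) (wdbar_wd0 _ _ hF Oz) mulr0 addr0 (wdbar_cj k hF.1 Oz).
Qed.

Let RY z := RtoC (hY z).
Let Dz l j := wd (- Ci) (ej j) (zeta (lift ord0 l)).

Lemma wd_hY j z : Om z -> wd (- Ci) (ej j) RY z =
  2^-1 * wd (- Ci) (ej j) omega z - \sum_l cj (zeta (lift ord0 l) z) * Dz l j z.
Proof.
move=> Oz.
have h1 : CinfC Om (fun z => 2^-1 * omega z) by apply: CinfCM => //; [exact: CinfC_cst|exact: ho.1].
have h2 : CinfC Om (fun z => 2^-1 * cj (omega z)).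
  by apply: CinfCM => //; [exact: CinfC_cst|exact: CinfC_cj ho.1].
have h3 l : CinfC Om (fun z => RtoC (normC2 (zeta (lift ord0 l) z))).
  by apply: CinfC_RtoC => //; exact: CinfC_normC2 (hz _).1.
have h4 : CinfC Om (fun z => \sum_l RtoC (normC2 (zeta (lift ord0 l) z))) by exact: CinfC_sum.
have E x : RY x = (2^-1 * omega x + 2^-1 * cj (omega x)) + - (\sum_l RtoC (normC2 (zeta (lift ord0 l) x))).
  rewrite /RY /hY RtoCD RtoCN (big_morph (@RtoC R) RtoCD erefl); congr (_ + _).
  have -> : RtoC (ReC (omega x)) = 2^-1 * (omega x + cj (omega x)).
    apply: (mulfI (_ : (2 : cplx R) != 0)); first by rewrite pnatr_eq0.
    rewrite mulrA mulfV ?pnatr_eq0// mul1r mulr_natl.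
    by apply: cplx_eq; rewrite mulr2n ?ReCD ?ImCD /= ?subrr ?addr0.
  by rewrite mulrDr.
rewrite (wd_ext oOm (- Ci) (ej j) (fun x _ => E x) Oz).
rewrite (wdD oOm (- Ci) (ej j) (CinfCD oOm h1 h2) (CinfCN oOm h4) Oz).
rewrite (wdD oOm (- Ci) (ej j) h1 h2 Oz) (wdN oOm (- Ci) (ej j) h4 Oz).
rewrite (wdMl oOm (- Ci) (ej j) 2^-1 ho.1 Oz).
rewrite (wdMl oOm (- Ci) (ej j) 2^-1 (CinfC_cj oOm ho.1) Oz) (wd_cj0 j ho Oz) mulr0 addr0.
congr (_ - _); rewrite (wd_sum oOm (- Ci) (ej j) _ _ h3 Oz).
by apply: eq_bigr => l _; exact: (wd_normC2 j (hz _) Oz).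
Qed.

(** Re omega is pluriharmonic and contributes nothing. The minus sign is compensated by the
    coefficient - m of dY in the derivative of the potential. *)
Lemma levi_hY j k z : Om z -> wd Ci (ej k) (wd (- Ci) (ej j) RY) z =
  - \sum_l Dz l j z * cj (Dz l k z).
Proof.
move=> Oz.
have h1 := CinfC_wd oOm (- Ci) (ej j) ho.1.
have h2 l : CinfC Om (fun z => cj (zeta (lift ord0 l) z)) by exact: CinfC_cj (hz _).1.
have h3 l : CinfC Om (Dz l j) by apply: CinfC_wd => //; exact: (hz _).1.
have h4 l : CinfC Om (fun z => cj (zeta (lift ord0 l) z) * Dz l j z) by exact: CinfCM.
have h5 : CinfC Om (fun z => \sum_l cj (zeta (lift ord0 l) z) * Dz l j z) by exact: CinfC_sum.
have h6 : CinfC Om (fun z => 2^-1 * wd (- Ci) (ej j) omega z).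
  by apply: CinfCM => //; exact: CinfC_cst.
rewrite (wd_ext oOm Ci (ej k) (fun x Ox => wd_hY j Ox) Oz).
rewrite (wdD oOm Ci (ej k) h6 (CinfCN oOm h5) Oz) (wdN oOm Ci (ej k) h5 Oz).
rewrite (wdMl oOm Ci (ej k) 2^-1 h1 Oz) (wdbar_wd0 j k ho Oz) mulr0 add0r; congr (- _).
rewrite (wd_sum oOm Ci (ej k) _ _ h4 Oz); apply: eq_bigr => l _.
rewrite (wdM oOm Ci (ej k) (h2 l) (h3 l) Oz) (wdbar_wd0 j k (hz _) Oz) mulr0 addr0.
by rewrite (wdbar_cj k (hz _).1 Oz) mulrC.
Qed.

Let u := pot c hq hY.
Let sl z := slope c (hgt c hq hY z).
Let bb j z := wd (- Ci) (ej j) (zeta ord0) z + RtoC (sl z) * zeta ord0 z * wd (- Ci) (ej j) RY z.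

Lemma levi_pot j k z : Om z ->
  wd Ci (ej k) (wd (- Ci) (ej j) (fun z => RtoC (u z))) z =
  RtoC (levi_coef c hq hY z) * bb j z * cj (bb k z) +
  RtoC (mass c (hgt c hq hY z)) * \sum_l Dz l j z * cj (Dz l k z).
Proof.
move=> Oz.
have qC := Cinf_hq; have YC := Cinf_hY.
pose m z := mass c (hgt c hq hY z); pose g z := gain c hq hY z.
have mC : Cinf Om m := Cinf_mass c01 oOm qC YC qY0.
have gC : Cinf Om g := Cinf_gain c01 oOm qC YC qY0.
have mgC : Cinf Om (fun z => m z * g z) by exact: CinfM.
pose mgc z := RtoC (m z * g z); pose mc z := RtoC (m z).
have mgcC : CinfC Om mgc by exact: CinfC_RtoC.
have mcC : CinfC Om mc by exact: CinfC_RtoC.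
pose qc z := RtoC (hq z).
have qcC : CinfC Om qc by exact: CinfC_RtoC.
have YcC : CinfC Om RY by exact: CinfC_RtoC.
have qj := CinfC_wd oOm (- Ci) (ej j) qcC.
have Yj := CinfC_wd oOm (- Ci) (ej j) YcC.
have E x : Om x -> wd (- Ci) (ej j) (fun z => RtoC (u z)) x =
    mgc x * wd (- Ci) (ej j) qc x + - (mc x * wd (- Ci) (ej j) RY x).
  move=> Ox; rewrite (wd_lin (- Ci) (ej j) (f := u) (g := hq) (h := hY) (al := m x * g x) (be := - m x)).
    by rewrite RtoCN mulNr.
  by move=> v; rewrite mulNr; exact: (dirD_pot c01 oOm qC YC qY0 v Ox).
have [A1 [B1 [h1 hA1 hB1]]] := dirD_gain_coef c01 oOm qC YC qY0 Oz.
have [A2 [B2 [h2 hA2 hB2]]] := dirD_mass_coef c01 oOm qC YC qY0 Oz.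
rewrite (wd_ext oOm Ci (ej k) E Oz).
rewrite (wdD oOm Ci (ej k) (CinfCM oOm mgcC qj) (CinfCN oOm (CinfCM oOm mcC Yj)) Oz).
rewrite (wdN oOm Ci (ej k) (CinfCM oOm mcC Yj) Oz).
rewrite (wdM oOm Ci (ej k) mgcC qj Oz) (wdM oOm Ci (ej k) mcC Yj Oz).
rewrite (wd_lin Ci (ej k) h1) (wd_lin Ci (ej k) h2).
rewrite (wdbar_real (ej k) qC Oz) (wdbar_real (ej k) YC Oz).
rewrite (levi_hY j k Oz) (levi_normC2 j k (hz ord0) Oz).
rewrite (wd_normC2 j (hz ord0) Oz) (wd_normC2 k (hz ord0) Oz).
rewrite /bb cjD !cjM cjK cj_RtoC.
apply: levi_subproof.
- by rewrite mulC_cj -hA1 -RtoCM -RtoCD.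
- by rewrite hB1 RtoCM.
- by rewrite hA2 RtoCN RtoCM.
- by rewrite hB2 mulC_cj RtoCN !RtoCM.
Qed.

End LeviForm.

(** * Circle means of subharmonic functions *)

Section CircleMean.
Context {R : realType}.
Let leb := @lebesgue_measure R.
Implicit Types (f : 'CV[R]_1 -> R) (x y r t : R).

(** The variable tau is kept as a vector of C^1, so that the calculus on open subsets of C^N applies
    to it. *)
Definition pt x y : 'CV[R]_1 := \row_(j < 1) mkC x y.

Lemma cvg_pt (T : Type) (F : set_system T) (FF : Filter F) (g h : T -> R) x y :
  g @ F --> x -> h @ F --> y -> (fun s => pt (g s) (h s)) @ F --> pt x y.
Proof.
move=> gx hy; apply: cvg_rV => j.
rewrite mxE; under eq_fun do rewrite mxE.
exact: cvg_mkC.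
Qed.

Definition e1 : 'CV[R]_1 := (ej ord0).1.
Definition e2 : 'CV[R]_1 := (ej ord0).2.

Lemma line_e1 x y t : line (pt x y) e1 t = pt (x + t) y.
Proof.
apply/rowP => j; rewrite lineE /e1 [ej]unlock /= !mxE !ord1 !eqxx /=.
by apply: cplx_eq; rewrite ?ReCD ?ImCD ?ReCM ?ImCM /= ?mulr0 ?mul0r ?mulr1 ?subr0 ?addr0.
Qed.

Lemma line_e2 x y t : line (pt x y) e2 t = pt x (y + t).
Proof.
apply/rowP => j; rewrite lineE /e2 [ej]unlock /= !mxE !ord1 !eqxx /= mulr1.
by apply: cplx_eq; rewrite ?ReCD ?ImCD ?ReCM ?ImCM /= ?mulr0 ?mul0r ?mulr1 ?subr0 ?addr0.
Qed.

Definition half : set 'CV[R]_1 := [set z | ReC (z 0 0) < 0].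

Lemma half_pt x y : half (pt x y) = (x < 0) :> Prop.
Proof. by rewrite /half /= mxE. Qed.

Lemma open_half : open half.
Proof.
rewrite openE => z hz.
have FF : Filter (nbhs z) by exact: nbhs_filter.
have h : ReC (x 0 0) @[x --> nbhs z] --> ReC (z 0 0).
  exact: (@cvg_ReCoord R 1 _ (nbhs z) FF id z 0 (@cvg_id _ _)).
apply: (h [set x : R | x < 0]).
by apply: open_nbhs_nbhs; split => //; exact: open_lt.
Qed.

Lemma is_derive_pt1 f x y : Ck half 1 f -> x < 0 ->
  is_derive x (1 : R) (fun x => f (pt x y)) (dirD e1 f (pt x y)).
Proof.
move=> hf x0.
have E : real_line f (pt 0 y) e1 = fun x => f (pt x y).
  by apply/funext => s; rewrite real_lineE line_e1 add0r.
rewrite -E -[pt x y](_ : line (pt 0 y) e1 x = _); last by rewrite line_e1 add0r.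
apply: isD_shift; rewrite line_e1 add0r.
have h : half (pt x y) by rewrite half_pt.
by have [] := CkS_derive e1 hf h.
Qed.

Lemma is_derive_pt2 f x y : Ck half 1 f -> x < 0 ->
  is_derive y (1 : R) (fun y => f (pt x y)) (dirD e2 f (pt x y)).
Proof.
move=> hf x0.
have E : real_line f (pt x 0) e2 = fun y => f (pt x y).
  by apply/funext => s; rewrite real_lineE line_e2 add0r.
rewrite -E -[pt x y](_ : line (pt x 0) e2 y = _); last by rewrite line_e2 add0r.
apply: isD_shift; rewrite line_e2 add0r.
have h : half (pt x y) by rewrite half_pt.
by have [] := CkS_derive e2 hf h.
Qed.

Lemma continuous_pt2 f x : Ck half 0 f -> x < 0 -> continuous (fun y => f (pt x y)).
Proof.
move=> hf x0 y.
have h : half (pt x y) by rewrite half_pt.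
have h1 : (fun y => pt x y) @ nbhs y --> pt x y.
  by apply: cvg_pt; [exact: cvg_cst|exact: cvg_id].
exact: (cvg_comp _ _ h1 (Ck_cvg hf h)).
Qed.

Let I : set R := `[0, 2 * pi].

Definition cmean f x : R := \int[leb]_(y in I) f (pt x y).

Lemma pi2_gt0 : 0 < 2 * pi :> R.
Proof. by rewrite mulr_gt0// pi_gt0. Qed.

Lemma cmean_integrable f x : Ck half 0 f -> x < 0 ->
  leb.-integrable I (EFin \o (fun y => f (pt x y))).
Proof.
move=> hf x0; apply: continuous_compact_integrable; first exact: segment_compact.
by apply: continuous_subspaceT; exact: continuous_pt2.
Qed.

Lemma is_derive_cmean f x : Ck half 1 f -> x < 0 ->
  is_derive x (1 : R) (cmean f) (cmean (dirD e1 f) x).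
Proof.
move=> hf x0.
have x2 : x / 2 < 0 by rewrite pmulr_llt0.
(* As x < 0, the interval from x - 1 to x / 2 surrounds x and stays away from 0. On the compact set
   [K] the derivative has the uniform bound that differentiation under the integral requires. *)
pose K := (fun s : R * R => pt s.1 s.2) @` (`[x - 1, x / 2] `*` I).
have cK : compact K.
  apply: continuous_compact; last by apply: compact_setX; exact: segment_compact.
  apply: continuous_subspaceT => -[s1 s2].
  apply: (@cvg_pt _ (nbhs (s1, s2)) _ (fun s => s.1) (fun s => s.2)); [exact: cvg_fst|exact: cvg_snd].
have [C C0 hC] : exists2 C, 0 <= C & forall z, K z -> `|dirD e1 f z| <= C.
  apply: compact_fbound cK _ => _ [[s1 s2] [/= h1 h2] <-].
  apply: (Ck_cont (CkS_dirD e1 hf)); rewrite half_pt.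
  by move: h1; rewrite in_itv/= => /andP[_ h1]; exact: le_lt_trans x2.
have Ix : `]x - 1, x / 2[%classic x.
  by rewrite /= in_itv/= ltrBlDr ltrDl ltr01 /=; lra.
have hx y : `]x - 1, x / 2[%classic y -> y < 0.
  by rewrite /= in_itv/= => /andP[_ h]; exact: lt_trans x2.
have intf y : `]x - 1, x / 2[%classic y -> leb.-integrable I (EFin \o (fun t => f (pt y t))).
  by move=> /hx y0; apply: cmean_integrable => //; exact: Ck_pred.
have derf y t : `]x - 1, x / 2[%classic y -> I t -> derivable ((fun y t => f (pt y t))^~ t) y 1.
  by move=> /hx y0 _; have [] := is_derive_pt1 t hf y0.
have iG : leb.-integrable I (EFin \o (fun=> C : R)).
  apply: continuous_compact_integrable; first exact: segment_compact.
  by apply: continuous_subspaceT => ?; exact: cvg_cst.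
have Gub y t : `]x - 1, x / 2[%classic y -> I t ->
    `|partial1of2 (fun y t => f (pt y t)) y t| <= C.
  move=> hy It; have h := is_derive_pt1 t hf (hx _ hy).
  rewrite partial1of2E derive_val; apply: hC; exists (y, t) => //; split => //=.
  by move: hy; rewrite /= !in_itv/= => /andP[? ?]; rewrite !ltW.
have mI : measurable I by exact: measurable_itv.
have d1 := @derivable_under_integral R _ _ leb (fun y t => f (pt y t)) I mI x (x - 1) (x / 2) Ix intf derf (fun=> C) (fun=> C0) iG Gub.
have d2 := @differentiation_under_integral R _ _ leb (fun y t => f (pt y t)) I mI x (x - 1) (x / 2) Ix intf derf (fun=> C) (fun=> C0) iG Gub.
apply: DeriveDef; first exact: d1.
rewrite -derive1E; apply: etrans d2 _; apply: eq_Rintegral => t _.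
have h := is_derive_pt1 t hf x0.
by rewrite partial1of2E derive_val.
Qed.

Lemma cmean_dirD2 f x : Ck half 1 f -> x < 0 -> f (pt x 0) = f (pt x (2 * pi)) ->
  cmean (dirD e2 f) x = 0.
Proof.
move=> hf x0 fp; rewrite /cmean /Rintegral.
have cf y : (fun y => f (pt x y)) @ nbhs y --> f (pt x y).
  exact: (continuous_pt2 (Ck_pred hf) x0).
rewrite (@continuous_FTC2 R _ (fun y => f (pt x y))) ?pi2_gt0//.
- by rewrite fp -EFinB subrr.
- by apply: continuous_subspaceT; apply: continuous_pt2 => //; exact: CkS_dirD.
- split => [y _||]; first by have [] := is_derive_pt2 y hf x0.
    exact: cvg_at_right_filter (cf _).
  exact: cvg_at_left_filter (cf _).
- by move=> y _; have h := is_derive_pt2 y hf x0; rewrite derive1E derive_val.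
Qed.

Lemma cmean_le C f x : Ck half 0 f -> x < 0 -> (forall y, I y -> `|f (pt x y)| <= C) ->
  `|cmean f x| <= C * (2 * pi).
Proof.
move=> hf x0 fC.
have mI : measurable I by exact: measurable_itv.
have i1 := cmean_integrable hf x0.
have i2 : leb.-integrable I (EFin \o (fun=> C : R)).
  apply: continuous_compact_integrable; first exact: segment_compact.
  by apply: continuous_subspaceT => ?; exact: cvg_cst.
have LI : leb I = (2 * pi)%:E.
  by rewrite /leb lebesgue_measure_itv/= lte_fin pi2_gt0 oppr0 adde0.
have CE : \int[leb]_(y in I) C = C * (2 * pi).
  rewrite Rintegral_cst//; congr (_ * _); exact: (congr1 fine LI).
have h1 : `|cmean f x| <= \int[leb]_(y in I) `|f (pt x y)| by exact: le_normr_Rintegral.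
apply: (le_trans h1); rewrite -CE; apply: le_Rintegral => //.
exact: integrable_norm.
Qed.

Section Subharmonic.
Variables (f : 'CV[R]_1 -> R) (C : R).
Hypotheses (fC : Cinf half f)
  (lap : forall z, half z -> 0 <= dirD e1 (dirD e1 f) z + dirD e2 (dirD e2 f) z)
  (per : forall x y, f (pt x (y + 2 * pi)) = f (pt x y))
  (bnd : forall x y, x < 0 -> I y -> `|f (pt x y)| <= C).

(** The second derivative in y has integral 0 by periodicity, so the integral of the Laplacian is
    the second derivative of the circle mean. *)
Lemma cmean_convex x : x < 0 -> 0 <= cmean (dirD e1 (dirD e1 f)) x.
Proof.
move=> x0; have mI : measurable I by exact: measurable_itv.
have c1 : Ck half 0 (dirD e1 (dirD e1 f)) by exact: (CkS_dirD e1 (CkS_dirD e1 (fC 2%N))).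
have c2 : Ck half 0 (dirD e2 (dirD e2 f)) by exact: (CkS_dirD e2 (CkS_dirD e2 (fC 2%N))).
have z2 : cmean (dirD e2 (dirD e2 f)) x = 0.
  apply: (cmean_dirD2 (f := dirD e2 f) (CkS_dirD e2 (fC 2%N)) x0).
  have E : real_line f (pt x 0) e2 = real_line f (pt x (2 * pi)) e2.
    apply/funext => t; rewrite !real_lineE !line_e2 add0r addrC.
    by rewrite per.
  exact: (congr1 (fun g => derive1 g 0) E).
have E : cmean (dirD e1 (dirD e1 f)) x + cmean (dirD e2 (dirD e2 f)) x =
    \int[leb]_(y in I) (dirD e1 (dirD e1 f) (pt x y) + dirD e2 (dirD e2 f) (pt x y)).
  symmetry; apply: RintegralD; first exact: mI.
    exact: (cmean_integrable c1 x0).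
  exact: (cmean_integrable c2 x0).
have h0 : 0 <= \int[leb]_(y in I) (dirD e1 (dirD e1 f) (pt x y) + dirD e2 (dirD e2 f) (pt x y)).
  by apply: Rintegral_ge0 => y _; apply: lap; rewrite half_pt.
have h1 := etrans (esym (addr0 (cmean (dirD e1 (dirD e1 f)) x))) (etrans (congr1 _ (esym z2)) E).
exact: (eq_ind_r (fun t => 0 <= t) h0 h1).
Qed.

Let M := cmean f.
Let M' := cmean (dirD e1 f).

Lemma MVT_neg (g dg : R -> R) a b : (forall x, x < 0 -> is_derive x (1 : R) g (dg x)) ->
  a < b -> b < 0 -> exists2 x, a < x < b & g b - g a = dg x * (b - a).
Proof.
move=> gd ab b0.
have h1 x : x \in `]a, b[ -> is_derive x (1 : R) g (dg x).
  by rewrite in_itv/= => /andP[_ xb]; apply: gd; exact: lt_trans b0.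
have h2 : {within `[a, b], continuous g}.
  apply: derivable_within_continuous => x; rewrite in_itv/= => /andP[_ xb].
  by have [] := gd x (le_lt_trans xb b0).
by have [x] := MVT ab h1 h2; rewrite in_itv/=; exists x.
Qed.

(** If a convex function on the negative half-line had a negative slope at x, it would grow at least
    linearly towards minus infinity, against its boundedness. *)
Lemma cmean_dirD_ge0 x : x < 0 -> 0 <= M' x.
Proof.
move=> x0; rewrite leNgt; apply/negP => Mx.
have dM y : y < 0 -> is_derive y (1 : R) M (M' y) by exact: is_derive_cmean (fC 1%N).
have dM' y : y < 0 -> is_derive y (1 : R) M' (cmean (dirD e1 (dirD e1 f)) y).
  exact: is_derive_cmean (CkS_dirD e1 (fC 2%N)).
have MC y : y < 0 -> `|M y| <= C * (2 * pi).
  by move=> y0; apply: (cmean_le (fC 0%N) y0) => t; exact: bnd.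
(* Over this length the mean would drop by at least twice its bound plus 1. *)
pose k := (2 * (C * (2 * pi)) + 1) / - M' x.
have C0 : 0 <= C * (2 * pi) by exact: le_trans (MC _ x0).
have k0 : 0 < k by rewrite divr_gt0 ?oppr_gt0// ltr_pwDr// mulr_ge0.
have [y /andP[ky yx] E] : exists2 y, x - k < y < x & M x - M (x - k) = M' y * (x - (x - k)).
  by apply: (MVT_neg dM _ x0); rewrite ltrBlDr ltrDl.
have My : M' y <= M' x.
  have [w /andP[yw wx] Ew] := MVT_neg dM' yx x0.
  by rewrite -subr_ge0 Ew mulr_ge0 ?subr_ge0 ?(ltW yx)// cmean_convex// (lt_trans wx).
have xk0 : x - k < 0 by rewrite (lt_trans _ x0)// ltrBlDr ltrDl.
have h1 := MC _ x0; have h2 := MC _ xk0.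
have h3 : M' y * (x - (x - k)) <= M' x * k.
  by rewrite opprB addrCA subrr addr0 ler_wpM2r// ltW.
have h4 : M' x * k = - (2 * (C * (2 * pi)) + 1).
  rewrite /k; have : M' x != 0 by rewrite lt_eqF.
  by move: (2 * _ + 1) (M' x) => A B B0; field.
have h5 := eq_ind_r (fun t => t <= M' x * k) h3 E.
have h6 := le_trans h5 (eq_ind _ (fun t => M' x * k <= t) (lexx _) _ h4).
move: h1 h2 h6 C0; clear; move: (C * (2 * pi)) (M x) (M (x - k)) => A B D.
by rewrite !ler_norml => /andP[a1 a2] /andP[b1 b2] h C0; lra.
Qed.

Lemma cmean_mono x y : x <= y -> y < 0 -> M x <= M y.
Proof.
rewrite le_eqVlt => /predU1P[->//|xy] y0.
have dM (z : R) : z < 0 -> is_derive z (1 : R) M (M' z) by exact: is_derive_cmean (fC 1%N).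
have [w /andP[_ wy] E] := MVT_neg dM xy y0.
by rewrite -subr_ge0 E mulr_ge0 ?subr_ge0 ?(ltW xy)// cmean_dirD_ge0// (lt_trans wy).
Qed.

End Subharmonic.

End CircleMean.

(** * The mean value inequality on a disc *)

Section Disc.
Context {R : realType} {N : nat}.
Let leb := @lebesgue_measure R.
Let I : set R := `[0, 2 * pi].
Implicit Types (a b : 'CV[R]_N) (r t : R).

Definition disc_pt := locked_with line_key
  (fun a b r t => a + mkC (r * cos t) (r * sin t) *: b : 'CV[R]_N).

Lemma disc_ptE a b r t : disc_pt a b r t = a + mkC (r * cos t) (r * sin t) *: b.
Proof. by rewrite [disc_pt]unlock. Qed.

Lemma ReC_disc_pt a b r t j : ReC (disc_pt a b r t 0 j) =
  ReC (a 0 j) + (r * cos t * ReC (b 0 j) - r * sin t * ImC (b 0 j)).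
Proof. by rewrite disc_ptE !mxE ReCD ReCM. Qed.

Lemma ImC_disc_pt a b r t j : ImC (disc_pt a b r t 0 j) =
  ImC (a 0 j) + (r * cos t * ImC (b 0 j) + r * sin t * ReC (b 0 j)).
Proof. by rewrite disc_ptE !mxE ImCD ImCM. Qed.

Lemma cvg_disc_pt (T : Type) (F : set_system T) (FF : Filter F) (rs ts : T -> R) a b (r t : R) :
  rs @ F --> r -> ts @ F --> t -> (fun x => disc_pt a b (rs x) (ts x)) @ F --> disc_pt a b r t.
Proof.
move=> rsr tst.
have hc : rs x * cos (ts x) @[x --> F] --> r * cos t.
  by apply: cvgM => //; apply: (cvg_comp _ _ tst); exact: continuous_cos.
have hs : rs x * sin (ts x) @[x --> F] --> r * sin t.
  by apply: cvgM => //; apply: (cvg_comp _ _ tst); exact: continuous_sin.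
apply: cvg_CV => j.
  rewrite ReC_disc_pt; under eq_fun do rewrite ReC_disc_pt.
  apply: cvgD; first exact: cvg_cst.
  by apply: cvgB; apply: cvgM => //; exact: cvg_cst.
rewrite ImC_disc_pt; under eq_fun do rewrite ImC_disc_pt.
apply: cvgD; first exact: cvg_cst.
by apply: cvgD; apply: cvgM => //; exact: cvg_cst.
Qed.

Lemma disc_pt0 a b t : disc_pt a b 0 t = a.
Proof. by apply: eqCV => j; rewrite ?ReC_disc_pt ?ImC_disc_pt !mul0r ?subr0 !addr0. Qed.

Lemma normC2_polar r t : normC2 (mkC (r * cos t) (r * sin t)) = r ^+ 2.
Proof.
rewrite /normC2 /= !exprMn -mulrDr.
by rewrite addrC -[_ + _]/(sin t ^+ 2 + cos t ^+ 2) -[X in _ * X]/(sin t ^+ 2 + cos t ^+ 2) addrC cos2Dsin2 mulr1.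
Qed.

Variables (B : set 'CV[R]_N) (u : 'CV[R]_N -> R) (a b : 'CV[R]_N).
Hypotheses (cu : forall z, B z -> {for z, continuous u})
  (aB : forall w : cplx R, normC2 w <= 1 -> B (a + w *: b)).

Lemma disc_pt_in r t : 0 <= r <= 1 -> B (disc_pt a b r t).
Proof.
by move=> /andP[r0 r1]; rewrite disc_ptE; apply: aB; rewrite normC2_polar expr_le1.
Qed.

Lemma disc_bound : exists2 C, 0 <= C & forall r t, 0 <= r <= 1 -> I t -> `|u (disc_pt a b r t)| <= C.
Proof.
pose K := (fun s : R * R => disc_pt a b s.1 s.2) @` (`[0, 1] `*` I).
have cK : compact K.
  apply: continuous_compact; last by apply: compact_setX; exact: segment_compact.
  apply: continuous_subspaceT => -[s1 s2].
  apply: (@cvg_disc_pt _ (nbhs (s1, s2)) _ (fun s => s.1) (fun s => s.2)); [exact: cvg_fst|exact: cvg_snd].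
have [C C0 hC] : exists2 C, 0 <= C & forall z, K z -> `|u z| <= C.
  apply: compact_fbound cK _ => _ [[s1 s2] [/= h1 h2] <-].
  by apply: cu; apply: disc_pt_in; move: h1; rewrite in_itv.
by exists C => // r t r01 It; apply: hC; exists (r, t) => //; split => //=; rewrite in_itv.
Qed.

Lemma circle_continuous r : 0 <= r <= 1 -> continuous (fun t => u (disc_pt a b r t)).
Proof.
move=> r01 t.
have h1 : (fun t => disc_pt a b r t) @ nbhs t --> disc_pt a b r t.
  by apply: cvg_disc_pt; [exact: cvg_cst|exact: cvg_id].
have h2 : u x @[x --> disc_pt a b r t] --> u (disc_pt a b r t) by apply: cu; exact: disc_pt_in.
exact: (cvg_comp _ _ h1 h2).
Qed.

Lemma circle_integrable r : 0 <= r <= 1 -> leb.-integrable I (EFin \o (fun t => u (disc_pt a b r t))).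
Proof.
move=> r01; apply: continuous_compact_integrable; first exact: segment_compact.
by apply: continuous_subspaceT; exact: circle_continuous.
Qed.

Lemma circle_mean_cvg (rs : nat -> R) r : (forall n, 0 <= rs n <= 1) -> 0 <= r <= 1 ->
  rs n @[n --> \oo] --> r ->
  \int[leb]_(t in I) u (disc_pt a b (rs n) t) @[n --> \oo] --> \int[leb]_(t in I) u (disc_pt a b r t).
Proof.
move=> rs01 r01 rsr; have [C C0 hC] := disc_bound.
have mI : measurable I by exact: measurable_itv.
have iG : leb.-integrable I (EFin \o (fun=> C : R)).
  apply: continuous_compact_integrable; first exact: segment_compact.
  by apply: continuous_subspaceT => ?; exact: cvg_cst.
have mf n : measurable_fun I (EFin \o (fun t => u (disc_pt a b (rs n) t))).
  by have /integrableP[] := circle_integrable (rs01 n).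
have mg : measurable_fun I (EFin \o (fun t => u (disc_pt a b r t))).
  by have /integrableP[] := circle_integrable r01.
have [||_ _ h] := @dominated_convergence _ _ R leb I mI
  (fun n => EFin \o (fun t => u (disc_pt a b (rs n) t))) (EFin \o (fun t => u (disc_pt a b r t))) _ mf mg _ iG.
- apply: aeW => t It; apply: cvg_EFin; first exact: nearW.
  have h1 : (fun n => disc_pt a b (rs n) t) @ \oo --> disc_pt a b r t.
    by apply: cvg_disc_pt => //; exact: cvg_cst.
  have h2 : u x @[x --> disc_pt a b r t] --> u (disc_pt a b r t) by apply: cu; exact: disc_pt_in.
  exact: (cvg_comp _ _ h1 h2).
- by apply: aeW => t n It /=; rewrite lee_fin; exact: hC.
apply: fine_cvg; rewrite /Rintegral fineK; first exact: h.
by apply: integrable_fin_num => //; exact: circle_integrable.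
Qed.

Definition exp_disc (z : 'CV[R]_1) : 'CV[R]_N := disc_pt a b (expR (ReC (z 0 0))) (ImC (z 0 0)).

Lemma exp_disc_pt x y : exp_disc (pt x y) = disc_pt a b (expR x) y.
Proof. by rewrite /exp_disc mxE. Qed.

(** Monotonicity is available for radii e^x in the open interval from 0 to 1. The centre and the
    unit circle are reached as limits of radii, by dominated convergence. *)
Lemma disc_mean : (forall x y, x <= y -> y < 0 -> cmean (u \o exp_disc) x <= cmean (u \o exp_disc) y) ->
  2 * pi * u a <= \int[leb]_(t in I) u (a + expi t *: b).
Proof.
move=> mono.
have cE x : cmean (u \o exp_disc) x = \int[leb]_(t in I) u (disc_pt a b (expR x) t).
  by apply: eq_Rintegral => t _ /=; rewrite exp_disc_pt.
(* Starting at 1 / 2 ensures h n <= 1 - h n, so the two radii are compared in the right order. *)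
pose h n : R := n.+2%:R^-1.
have h0 n : 0 < h n by rewrite invr_gt0.
have h1 n : h n < 1 by rewrite invf_lt1// ltr1n.
have hcvg : h n @[n --> \oo] --> (0 : R).
  have := @cvg_harmonic R; rewrite -(cvg_shiftS (@harmonic R)); exact.
have h12 n : h n <= 1 - h n.
  rewrite lerBrDr; have : h n <= 2^-1 by rewrite lef_pV2 ?posrE// ler_nat.
  by lra.
have l1 n : \int[leb]_(t in I) u (disc_pt a b (h n) t) <= \int[leb]_(t in I) u (disc_pt a b (1 - h n) t).
  have p1 : 0 < 1 - h n by rewrite subr_gt0.
  have lh : ln (h n) <= ln (1 - h n) by rewrite ler_ln ?posrE.
  have l0 : ln (1 - h n) < 0 by rewrite ln_lt0// p1 ltrBlDr ltrDl h0.
  have E s : 0 < s -> cmean (u \o exp_disc) (ln s) = \int[leb]_(t in I) u (disc_pt a b s t).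
    by move=> s0; apply: etrans (cE _) _; rewrite (lnK (s0 : s \in Num.pos)).
  exact: (eq_ind _ (fun y => y <= _) (eq_ind _ (fun y => _ <= y) (mono _ _ lh l0) _ (E _ p1)) _ (E _ (h0 n))).
have c1 : \int[leb]_(t in I) u (disc_pt a b (h n) t) @[n --> \oo] --> \int[leb]_(t in I) u (disc_pt a b 0 t).
  apply: circle_mean_cvg => // [n|]; first by rewrite !ltW.
  by rewrite lexx ler01.
have c2 : \int[leb]_(t in I) u (disc_pt a b (1 - h n) t) @[n --> \oo] --> \int[leb]_(t in I) u (disc_pt a b 1 t).
  apply: circle_mean_cvg => // [n||].
  - by rewrite subr_ge0 (ltW (h1 n)) lerBlDr lerDl ltW.
  - by rewrite lexx ler01.
  - rewrite -[X in _ --> X]subr0; apply: cvgB => //; exact: cvg_cst.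
have le01 : \int[leb]_(t in I) u (disc_pt a b 0 t) <= \int[leb]_(t in I) u (disc_pt a b 1 t).
  exact: (ler_cvg_to c1 c2 (nearW _ l1)).
have E1 : \int[leb]_(t in I) u (disc_pt a b 1 t) = \int[leb]_(t in I) u (a + expi t *: b).
  by apply: eq_Rintegral => t _; rewrite disc_ptE /expi !mul1r.
have mI : measurable I by exact: measurable_itv.
have LI : leb I = (2 * pi)%:E.
  by rewrite /leb lebesgue_measure_itv/= lte_fin pi2_gt0 oppr0 adde0.
have E0 : \int[leb]_(t in I) u (disc_pt a b 0 t) = 2 * pi * u a.
  transitivity (\int[leb]_(t in I) u a).
    by apply: eq_Rintegral => t _; rewrite disc_pt0.
  rewrite Rintegral_cst// mulrC; congr (_ * _); exact: (congr1 fine LI).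
exact: (eq_ind _ (fun y => y <= _) (eq_ind _ (fun y => _ <= y) le01 _ E1) _ E0).
Qed.

End Disc.

(** * Holomorphic functions and the Siegel coordinates *)

Lemma wd_mul_subproof (K : comPzRingType) (h s c a b : K) :
  h * (c * a + s * (c * b)) = c * (h * (a + s * b)).
Proof. by ring. Qed.

Section Holomorphic.
Context {R : realType} {M : nat}.
Variable Om : set 'CV[R]_M.
Hypothesis oOm : open Om.
Implicit Types (F G : 'CV[R]_M -> cplx R) (z v : 'CV[R]_M).

Lemma holo_cst (a : cplx R) : holo Om (fun=> a).
Proof. by split=> [|k z Oz]; [exact: CinfC_cst|exact: wd_cst]. Qed.

Lemma holoD F G : holo Om F -> holo Om G -> holo Om (fun z => F z + G z).
Proof.
move=> [F1 F2] [G1 G2]; split=> [|k z Oz]; first exact: CinfCD.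
by rewrite (wdD oOm Ci (ej k) F1 G1 Oz) F2// G2// addr0.
Qed.

Lemma holoN F : holo Om F -> holo Om (fun z => - F z).
Proof.
move=> [F1 F2]; split=> [|k z Oz]; first exact: CinfCN.
by rewrite (wdN oOm Ci (ej k) F1 Oz) F2// oppr0.
Qed.

Lemma holoM F G : holo Om F -> holo Om G -> holo Om (fun z => F z * G z).
Proof.
move=> [F1 F2] [G1 G2]; split=> [|k z Oz]; first exact: CinfCM.
by rewrite (wdM oOm Ci (ej k) F1 G1 Oz) F2// G2// mul0r mulr0 addr0.
Qed.

(** Obtained by applying the operator to the constant product of F and its inverse. *)
Lemma holoV F : (forall z, Om z -> F z != 0) -> holo Om F -> holo Om (fun z => (F z)^-1).
Proof.
move=> F0 [F1 F2]; have V1 := CinfCV oOm F0 F1; split=> // k z Oz.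
have E : wd Ci (ej k) (fun z => F z * (F z)^-1) z = 0.
  rewrite -[RHS](wd_cst Ci (ej k) (1 : cplx R) z); apply: (wd_ext oOm) => // x Ox.
  by rewrite mulfV// F0.
move: E; rewrite (wdM oOm Ci (ej k) F1 V1 Oz) F2// mul0r add0r => /eqP.
by rewrite mulf_eq0 (negbTE (F0 _ Oz)) => /eqP.
Qed.

Lemma Cinf_affine f (df : 'CV[R]_M -> R) : (forall z, {for z, continuous f}) ->
  (forall z v t, f (line z v t) = f z + t * df v) ->
  Cinf Om f /\ forall v z, dirD v f z = df v.
Proof.
move=> cf fE.
have d v z : is_derive (0 : R) (1 : R) (real_line f z v) (df v).
  have -> : real_line f z v = fun t => f z + df v * t.
    by apply/funext => t; rewrite real_lineE fE mulrC.
  exact: is_derive_affine.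
split=> [[|k]|v z]; [by split|apply: (CkSI oOm) => // v|exact: isD_dirD].
by exists (fun=> df v); split=> //; exact: Ck_cst.
Qed.

Lemma cderE v F z : cder v F z = mkC (dirD v (fun w => ReC (F w)) z) (dirD v (fun w => ImC (F w)) z).
Proof. by rewrite [cder]unlock. Qed.

Lemma holo_coord j : holo Om (fun z => z 0 j).
Proof.
have [R1 R2] : Cinf Om (fun z => ReC (z 0 j)) /\
    forall v z, dirD v (fun z => ReC (z 0 j)) z = ReC (v 0 j).
  apply: (@Cinf_affine _ (fun v => ReC (v 0 j))) => [z|z v t]; last by rewrite ReC_line.
  exact: (@cvg_ReCoord R M _ (nbhs z) (nbhs_filter z) id z j (@cvg_id _ _)).
have [I1 I2] : Cinf Om (fun z => ImC (z 0 j)) /\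
    forall v z, dirD v (fun z => ImC (z 0 j)) z = ImC (v 0 j).
  apply: (@Cinf_affine _ (fun v => ImC (v 0 j))) => [z|z v t]; last by rewrite ImC_line.
  exact: (@cvg_ImCoord R M _ (nbhs z) (nbhs_filter z) id z j (@cvg_id _ _)).
split=> [|k z Oz]; first by split.
have E v : cder v (fun z => z 0 j) z = v 0 j by rewrite cderE R2 I2 mkCK.
rewrite /wd !E [ej]unlock /= !mxE eqxx /=.
have -> : Ci * (Ci * (j == k)%:R) = - (j == k)%:R :> cplx R.
  rewrite mulrA; have -> : Ci * Ci = -1 :> cplx R.
    by apply: cplx_eq; rewrite ?ReCM ?ImCM ?ReCN ?ImCN /= ?mulr0 ?mul0r ?mulr1 ?addr0 ?sub0r ?oppr0.
  by rewrite mulN1r.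
by rewrite subrr mulr0.
Qed.

Definition expC (w : cplx R) : cplx R := mkC (expR (ReC w) * cos (ImC w)) (expR (ReC w) * sin (ImC w)).

Lemma holo_exp F : holo Om F -> holo Om (fun z => expC (F z)).
Proof.
move=> [[F1 F2] F0].
have e1 := Cinf_expR oOm F1; have c2 := Cinf_cos oOm F2; have s2 := Cinf_sin oOm F2.
have C1 : Cinf Om (fun z => expR (ReC (F z)) * cos (ImC (F z))) by exact: CinfM.
have C2 : Cinf Om (fun z => expR (ReC (F z)) * sin (ImC (F z))) by exact: CinfM.
split=> [|k z Oz]; first by split.
have E v : cder v (fun z => expC (F z)) z = expC (F z) * cder v F z.
  rewrite !cderE; apply: cplx_eq; rewrite ?ReCM ?ImCM !ReC_mk !ImC_mk.
    apply: etrans (dirDM v (e1 1%N) (c2 1%N) Oz) _.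
    rewrite (dirD_comp v (F1 1%N) Oz (is_derive_expR _)) (dirD_comp v (F2 1%N) Oz (is_derive_cos _)).
    by ring.
  apply: etrans (dirDM v (e1 1%N) (s2 1%N) Oz) _.
  rewrite (dirD_comp v (F1 1%N) Oz (is_derive_expR _)) (dirD_comp v (F2 1%N) Oz (is_derive_sin _)).
  by ring.
have h := F0 k z Oz; rewrite /wd in h; rewrite /wd (E (ej k).1) (E (ej k).2).
by rewrite wd_mul_subproof h mulr0.
Qed.

End Holomorphic.

Lemma holo_exp_disc {R : realType} {N : nat} (a b : 'CV[R]_N) j : holo half (fun z => exp_disc a b z 0 j).
Proof.
have := holoD (@open_half R) (holo_cst (@open_half R) (a 0 j)) (holoM (@open_half R) (holo_exp (@open_half R) (holo_coord (@open_half R) ord0)) (holo_cst (@open_half R) (b 0 j))).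
congr holo; apply/funext => z; rewrite /exp_disc disc_ptE !mxE; congr (_ + _ * _).
Qed.

Section Siegel.
Context {R : realType} {p : nat}.
Implicit Type z : 'CV[R]_p.+2.

(* The ball is the Siegel domain [normC2 zeta_0 + ... + normC2 zeta_p < Re omega] in
   these coordinates, with [e_1] at infinity. *)
Definition szeta (l : 'I_p.+1) z : cplx R := z 0 (lift ord0 l) * (1 - z 0 ord0)^-1.
Definition somega z : cplx R := (1 + z 0 ord0) * (1 - z 0 ord0)^-1.

Lemma ball_denom z : unit_ballCV R p.+2 z -> 1 - z 0 ord0 != 0.
Proof.
rewrite /unit_ballCV /= /normCV2 big_ord_recl => h; apply/eqP => /eqP.
rewrite subr_eq0 => /eqP E; move: h; rewrite -E /normC2 ReC1 ImC1 expr1n expr0n addr0.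
by rewrite ltNge lerDl sumr_ge0// => i _; exact: normC2_ge0.
Qed.

Lemma normC2V (w : cplx R) : w != 0 -> normC2 w^-1 = (normC2 w)^-1.
Proof.
move=> w0; apply: (mulfI (_ : normC2 w != 0)); first by rewrite normC2_eq0.
by rewrite -normC2M !mulfV ?normC2_eq0// /normC2 ReC1 ImC1 expr1n expr0n addr0.
Qed.

Lemma siegel z : unit_ballCV R p.+2 z -> hq szeta z - hY szeta somega z = poisson_kernel z.
Proof.
move=> Bz; have d0 := ball_denom Bz; have n0 : normC2 (1 - z 0 ord0) != 0 by rewrite normC2_eq0.
have zE l : normC2 (szeta l z) = normC2 (z 0 (lift ord0 l)) / normC2 (1 - z 0 ord0).
  by rewrite /szeta normC2M normC2V.
have oE : ReC (somega z) = (1 - normC2 (z 0 ord0)) / normC2 (1 - z 0 ord0).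
  rewrite /somega invC_cj//; move: n0; rewrite /normC2.
  rewrite !(ReCM, ImCM, ReCD, ImCD, ReCN, ImCN, ReC_mk, ImC_mk, ReC1, ImC1) sub0r => n0.
  by field.
rewrite /hq /hY /poisson_kernel /normCV2 !big_ord_recl oE zE.
under eq_bigr do rewrite zE.
rewrite -mulr_suml. by field.
Qed.

Lemma siegel_lt z : unit_ballCV R p.+2 z -> hq szeta z < hY szeta somega z.
Proof.
move=> Bz; rewrite -subr_lt0 siegel// oppr_lt0 divr_gt0 ?subr_gt0//.
by rewrite lt_neqAle normC2_ge0 eq_sym normC2_eq0 ball_denom.
Qed.

Section Pullback.
Context {M : nat}.
Variable Om : set 'CV[R]_M.
Hypothesis oOm : open Om.
Variable g : 'CV[R]_M -> 'CV[R]_p.+2.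
Hypotheses (hg : forall i, holo Om (fun x => g x 0 i)) (gB : forall x, Om x -> unit_ballCV R p.+2 (g x)).

Lemma holo_denom : holo Om (fun x => (1 - g x 0 ord0)^-1).
Proof.
apply: (holoV oOm) => [z Oz|]; first exact: ball_denom (gB Oz).
exact (holoD oOm (holo_cst oOm 1) (holoN oOm (hg ord0))).
Qed.

Lemma holo_zeta l : holo Om (fun x => szeta l (g x)).
Proof. exact (holoM oOm (hg (lift ord0 l)) holo_denom). Qed.

Lemma holo_omega : holo Om (fun x => somega (g x)).
Proof. exact (holoM oOm (holoD oOm (holo_cst oOm 1) (hg ord0)) holo_denom). Qed.

End Pullback.
End Siegel.

Lemma laplacian_subproof {R : realType} (x y z t : R) :
  ReC (4 * (2^-1 * (2^-1 * (RtoC x + Ci * RtoC y) +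
    - Ci * (2^-1 * (RtoC z + Ci * RtoC t))))) = x + t.
Proof.
have two0 : (2 : cplx R) != 0 by rewrite pnatr_eq0.
have -> : (4 : cplx R) = 2 * 2 by rewrite -natrM.
have -> : 2 * 2 * (2^-1 * (2^-1 * (RtoC x + Ci * RtoC y) + - Ci * (2^-1 * (RtoC z + Ci * RtoC t)))) =
    (RtoC x + Ci * RtoC y) + - Ci * (RtoC z + Ci * RtoC t) :> cplx R.
  by rewrite -mulrA mulVKf// mulrDr mulVKf// mulrCA mulVKf.
by rewrite !(ReCD, ImCD, ReCM, ImCM, ReCN, ImCN) /=; ring.
Qed.

Lemma levi_diag_ge0 {R : realType} {p : nat} (x y : R) (b : 'I_p.+1 -> cplx R) :
  0 <= x -> 0 <= y -> 0 <= ReC (4 * (RtoC x * b ord0 * cj (b ord0) +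
    RtoC y * \sum_(l < p) b (lift ord0 l) * cj (b (lift ord0 l)))).
Proof.
move=> x0 y0.
have -> : RtoC x * b ord0 * cj (b ord0) + RtoC y * \sum_(l < p) b (lift ord0 l) * cj (b (lift ord0 l)) =
  RtoC (x * normC2 (b ord0) + y * \sum_(l < p) normC2 (b (lift ord0 l))).
  rewrite RtoCD !RtoCM -mulrA mulC_cj (big_morph (@RtoC R) (@RtoCD R) erefl); congr (_ + _ * _).
  by apply: eq_bigr => l _; rewrite mulC_cj.
have -> : (4 : cplx R) = RtoC 4.
  by rewrite !mulrS !mulr0n !addr0 !RtoCD.
rewrite -RtoCM ReC_mk mulr_ge0// addr_ge0// mulr_ge0 ?normC2_ge0//.
by rewrite sumr_ge0// => l _; exact: normC2_ge0.
Qed.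

Section Laplacian.
Context {R : realType} {N : nat}.
Variable Om : set 'CV[R]_N.
Hypothesis oOm : open Om.

(** The mixed derivatives enter with the factor [Ci], so [ReC] removes them. *)
Lemma laplacian (f : 'CV[R]_N -> R) d z : Cinf Om f -> Om z ->
  ReC (4 * wd Ci d (wd (- Ci) d (fun z => RtoC (f z))) z) =
  dirD d.1 (dirD d.1 f) z + dirD d.2 (dirD d.2 f) z.
Proof.
move=> fC Oz.
have D1 := Cinf_dirD d.1 fC; have D2 := Cinf_dirD d.2 fC.
pose F (v : 'CV[R]_N) x : cplx R := RtoC (dirD v f x).
have C1 : CinfC Om (F d.1) by exact: CinfC_RtoC.
have C2 : CinfC Om (F d.2) by exact: CinfC_RtoC.
have C3 : CinfC Om (fun x => (- Ci) * F d.2 x) by apply: CinfCM => //; exact: CinfC_cst.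
have Er g v x : cder v (fun z => RtoC (g z)) x = RtoC (dirD v g x).
  by rewrite cderE; congr mkC; exact: dirD_cst.
have E x : Om x -> wd (- Ci) d (fun z => RtoC (f z)) x = 2^-1 * (F d.1 x + (- Ci) * F d.2 x).
  by move=> _; rewrite /wd !Er.
have E1 := wd_ext oOm Ci d E Oz.
have E2 := wdMl oOm Ci d 2^-1 (CinfCD oOm C1 C3) Oz.
have E3 := wdD oOm Ci d C1 C3 Oz.
have E4 := wdMl oOm Ci d (- Ci) C2 Oz.
have Ew v : wd Ci d (F v) z = 2^-1 * (RtoC (dirD d.1 (dirD v f) z) + Ci * RtoC (dirD d.2 (dirD v f) z)).
  by rewrite /wd !Er.
have E5 := etrans E1 (etrans E2 (congr1 (fun t => 2^-1 * t)
  (etrans E3 (congr2 +%R (Ew d.1) (etrans E4 (congr1 (fun t => - Ci * t) (Ew d.2))))))).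
exact: etrans (congr1 (fun t => ReC (4 * t)) E5) (laplacian_subproof _ _ _ _).
Qed.

End Laplacian.

(** * The potential on the ball and its holomorphic pullbacks *)

Section Family.
Context {R : realType} {p : nat}.
Variable c : R.
Hypothesis c01 : 0 < c < 1.
Local Notation ball := (unit_ballCV R p.+2).

Definition upot (z : 'CV[R]_p.+2) : R := pot c (hq szeta) (hY szeta somega) z.

Lemma open_ball : open ball.
Proof.
rewrite openE => z Bz.
have FF : Filter (nbhs z) by exact: nbhs_filter.
have hC : Cinf setT (fun x : 'CV[R]_p.+2 => normCV2 x).
  apply: (Cinf_sum openT) => j.
  exact: (CinfC_normC2 openT (holo_coord openT j).1).
have h : normCV2 x @[x --> nbhs z] --> normCV2 z by exact: (Ck_cvg (hC 0%N) I).
apply: (h [set x : R | x < 1]).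
by apply: open_nbhs_nbhs; split => //; exact: open_lt.
Qed.

Section Pullback.
Context {M : nat}.
Variable Om : set 'CV[R]_M.
Hypothesis oOm : open Om.
Variable g : 'CV[R]_M -> 'CV[R]_p.+2.
Hypotheses (hg : forall i, holo Om (fun x => g x 0 i)) (gB : forall x, Om x -> ball (g x)).

Let Z l x := szeta l (g x).
Let W x := somega (g x).
Let hZ l : holo Om (Z l) := holo_zeta oOm hg gB l.
Let hW : holo Om W := holo_omega oOm hg gB.
Let qY x (Ox : Om x) : hq Z x < hY Z W x := siegel_lt (gB Ox).
Let L x := levi_coef c (hq Z) (hY Z W) x.
Let m x := mass c (hgt c (hq Z) (hY Z W) x).

(** Stated for a holomorphic map [g] into the ball because it serves twice: for the identity of the
    ball and for the exponential discs. The composites of zeta and omega with [g] are again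
    holomorphic, so the Levi form along a disc comes from the same computation, in place of a
    second-order chain rule. *)
Lemma Cinf_upot : Cinf Om (upot \o g).
Proof. exact (Cinf_pot c01 oOm (Cinf_hq oOm hZ) (Cinf_hY oOm hZ hW) (qY0 qY)). Qed.

(** [b j ord0] is the component of the twisted form d zeta_1 + s zeta_1 dY; the other columns are
    the plain derivatives of the remaining zeta's. There are p + 1 columns whatever the source of
    [g]. *)
Lemma levi_upot x : Om x -> exists b : 'I_M -> 'I_p.+1 -> cplx R, forall j k,
  wd Ci (ej k) (wd (- Ci) (ej j) (fun z => RtoC (upot (g z)))) x =
  RtoC (L x) * b j ord0 * cj (b k ord0) +
  RtoC (m x) * \sum_(l < p) b j (lift ord0 l) * cj (b k (lift ord0 l)).
Proof.
move=> Ox.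
exists (fun j l => if unlift ord0 l is Some l then wd (- Ci) (ej j) (Z (lift ord0 l)) x
  else wd (- Ci) (ej j) (Z ord0) x + RtoC (slope c (hgt c (hq Z) (hY Z W) x)) * Z ord0 x *
    wd (- Ci) (ej j) (fun z => RtoC (hY Z W z)) x) => j k.
rewrite unlift_none (levi_pot c01 oOm hZ hW qY j k Ox); congr (_ + _ * _).
by apply: eq_bigr => l _; rewrite liftK.
Qed.

Lemma levi_coef_upot_ge0 x : Om x -> 0 <= L x /\ 0 <= m x.
Proof.
move=> Ox; split.
  exact: (levi_coef_ge0 c01 (qY0 qY) Ox).
exact: (mass_ge0 c01 (qY0 qY) Ox).
Qed.

Lemma laplacian_upot j x : Om x ->
  0 <= dirD (ej j).1 (dirD (ej j).1 (upot \o g)) x + dirD (ej j).2 (dirD (ej j).2 (upot \o g)) x.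
Proof.
move=> Ox; rewrite -(laplacian oOm (ej j) Cinf_upot Ox).
have [b E] := levi_upot Ox; have [L0 m0] := levi_coef_upot_ge0 Ox.
rewrite (E j j); exact: levi_diag_ge0.
Qed.

End Pullback.

Let id_holo i : holo ball (fun x => id x 0 i) := holo_coord open_ball i.

Lemma upot_cvg z : ball z -> {for z, continuous upot}.
Proof. by move=> Bz; exact: (Ck_cont (Cinf_upot open_ball id_holo (fun x h => h) 0%N) Bz). Qed.

Lemma upot_monge_ampere : is_monge_ampere ball upot mzero.
Proof.
apply: (monge_ampere0 open_ball (Cinf_upot open_ball id_holo (fun x h => h))) => z Bz.
have [b E] := levi_upot open_ball id_holo (fun x h => h) Bz.
set L := levi_coef _ _ _ _ in E; set m := mass _ _ in E.
(* The Levi matrix of size p + 2 factors through dimension p + 1, so it is singular. *)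
pose A := \matrix_(j < p.+2, l < p.+1) b j l.
pose D := \matrix_(l < p.+1, k < p.+2)
   (4 * (RtoC (if unlift ord0 l is Some _ then m else L) * cj (b k l)) : cplx R).
have -> : levi_form upot z = A *m D.
  apply/matrixP => j k; rewrite !mxE; apply: etrans (congr1 (fun t => 4 * t) (E j k)) _.
  rewrite big_ord_recl !mxE unlift_none mulrDr; congr (_ + _).
    by rewrite [RHS]mulrCA -[X in 4 * X]mulrA [X in 4 * X]mulrCA.
  rewrite !mulr_sumr; apply: eq_bigr => l _; rewrite !mxE liftK.
  by rewrite [RHS]mulrCA [X in 4 * X]mulrCA.
apply/eqP; apply: contraT => d0.
have : A *m D \in unitmx by rewrite unitmxE unitfE.
move=> /mxrank_unit rk; have := mulmx_max_rank A D.
by rewrite rk ltnn.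
Qed.

End Family.

(** * Comparison with the Poisson kernel *)

Section Bounds.
Context {R : realType}.
Implicit Types (c q y : R).

Lemma mass_ge c E : 0 < c < 1 -> 0 <= E -> c <= mass c E.
Proof.
case/andP=> c0 c1 E0.
by rewrite lerDl mulr_ge0 ?subr_ge0 ?(ltW c1)// invr_ge0 addr_ge0.
Qed.

Lemma weight_le1 c E : 0 < c < 1 -> weight c E <= 1.
Proof.
move=> c01; rewrite ler_pdivrMr ?denom_gt0// mul1r /denom.
case/andP: c01 => c0 c1; rewrite -subr_ge0.
have -> : 1 - c + c * ((1 + E) * (1 + E)) - (1 + c * E) * (1 + c * E) = c * (1 - c) * E ^+ 2 by ring.
by apply: mulr_ge0; [rewrite mulr_ge0 ?subr_ge0 ?ltW|exact: sqr_ge0].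
Qed.

Lemma solE_gt c q y : 0 < c < 1 -> 0 < q < y -> q < solE c q y.
Proof.
move=> c01 /andP[q0 qy]; have qy' : 0 <= q < y by rewrite ltW.
have [/andP[E0 Ey]] := solEP c01 qy'; set E := solE _ _ _ in E0 Ey *.
rewrite /leaf => Eq.
have x0 : - (slope c E * (y - E)) < 0 by rewrite oppr_lt0 mulr_gt0 ?slope_gt0 ?subr_gt0.
have E1 : 0 < E.
  rewrite lt_neqAle E0 andbT; apply: contraTneq q0 => E00.
  by rewrite -Eq -E00 mul0r ltxx.
by rewrite -{1}Eq gtr_pMr// expR_lt1.
Qed.

Lemma solE0 c y : 0 < c < 1 -> 0 < y -> solE c 0 y = 0.
Proof.
move=> c01 y0; have qy : 0 <= (0 : R) < y by rewrite lexx.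
have [_ /eqP] := solEP c01 qy; rewrite /leaf mulf_eq0 [X in _ || X]gt_eqF ?expR_gt0// orbF.
by move=> /eqP.
Qed.

Lemma pot_gt c q y : 0 < c < 1 -> 0 < q < y ->
  q - y < weight c (solE c q y) * (solE c q y - y).
Proof.
move=> c01 qy; have qE := solE_gt c01 qy; have /andP[q0 qy1] := qy.
have [/andP[E0 Ey] _] := solEP c01 (introT andP (conj (ltW q0) qy1)).
move: qE E0 Ey; set E := solE _ _ _ => qE E0 Ey.
have h : q - y < E - y by rewrite ltrD2r.
apply: (lt_le_trans h); rewrite -subr_ge0 -{2}[E - y]mul1r -mulrBl.
by rewrite nmulr_lge0 ?subr_lt0// subr_le0 weight_le1.
Qed.

(** From 1 + x <= exp x one gets E + E log (q / E) <= q, so the potential is at most m(E) (q - y);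
    then c <= m(E) is used with q - y negative. *)
Lemma pot_le c q y : 0 < c < 1 -> 0 <= q < y ->
  weight c (solE c q y) * (solE c q y - y) <= c * (q - y).
Proof.
move=> c01 qy; have [/andP[E0 Ey]] := solEP c01 qy; have /andP[q0 qy1] := qy.
move: E0 Ey; set E := solE _ _ _ => E0 Ey Eq.
have h1 : E * (1 - slope c E * (y - E)) <= q by rewrite -Eq ler_wpM2l// expR_ge1Dx.
have -> : weight c E * (E - y) = mass c E * (E * (1 - slope c E * (y - E)) - y).
  by rewrite (weightE c01 E0); ring.
have mc := mass_ge c01 E0; have c0 : 0 <= c by case/andP: c01 => /ltW.
apply: (@le_trans _ _ (mass c E * (q - y))).
  by rewrite ler_wpM2l ?lerD2r// (le_trans c0).
by rewrite ler_wnM2r// subr_le0 ltW.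
Qed.

(** The difference of the two sides is a square times a nonnegative factor. Multiplied by the
    negative number E - y, the inequality says that the solution E does at least as well as any
    other height F: it is the only trace of the maximum in the proof. *)
Lemma weight_tangent c E F : 0 < c < 1 -> 0 <= E -> 0 <= F ->
  weight c E <= mass c F * (1 + F * slope c E).
Proof.
move=> c01 E0 F0; have d0 := denom_gt0 c01 E; have F1 : 0 < 1 + F by rewrite ltr_pwDl.
have /andP[c0 c1] := c01.
have -> : mass c F * (1 + F * slope c E) =
    weight c E + (F - E) ^+ 2 * c * slope c E / (1 + F).
  rewrite /weight /mass /slope; move: d0; rewrite /denom => d0.
  by field; rewrite !gt_eqF.
rewrite lerDl divr_ge0 ?(ltW F1)//; apply: mulr_ge0; last by rewrite ltW// slope_gt0.
by apply: mulr_ge0; [exact: sqr_ge0|exact: ltW].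
Qed.

(* If [F] is the height for [d], then L = F + F log (q / F) - y is negative and the
   potential of [d] is mass d F * L < mass c F * L, which is at most the maximum over
   all heights, the potential of [c]. *)
Lemma pot_lt c d q y : 0 < c -> c < d -> d < 1 -> 0 < q < y ->
  weight d (solE d q y) * (solE d q y - y) < weight c (solE c q y) * (solE c q y - y).
Proof.
move=> c0 cd d1 qy.
have c01 : 0 < c < 1 by rewrite c0 (lt_trans cd).
have d01 : 0 < d < 1 by rewrite d1 (lt_trans c0).
have /andP[q0 qy1] := qy; have qy' : 0 <= q < y by rewrite ltW.
have [/andP[E0 Ey]] := solEP c01 qy'; have [/andP[F0 Fy]] := solEP d01 qy'.
have qF := solE_gt d01 qy.
move: E0 Ey F0 Fy qF; set E := solE c _ _; set F := solE d _ _ => E0 Ey F0 Fy qF.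
rewrite /leaf; set x := slope c E * (y - E); set x' := slope d F * (y - F) => Fq Eq.
have F1 : 0 < F by exact: lt_trans qF.
have x0 : 0 < x' by rewrite mulr_gt0 ?slope_gt0 ?subr_gt0.
have EF : F * (1 + (x - x')) <= E.
  have -> : E = F * expR (x - x').
    have -> : E = q * expR x by rewrite -Eq -mulrA -expRD addNr expR0 mulr1.
    by rewrite -Fq -mulrA -expRD addrC.
  by rewrite ler_wpM2l// expR_ge1Dx.
have -> : weight d F * (F - y) = mass d F * (F * (1 - x') - y).
  by rewrite (weightE d01 F0) /x'; ring.
have L0 : F * (1 - x') - y < 0.
  have : 0 < F * x' by rewrite mulr_gt0.
  by move: Fy; clear; set t := F * x' => h1 h2; rewrite mulrBr mulr1 -/t; lra.
have md : mass c F < mass d F.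
  rewrite -subr_gt0; have -> : mass d F - mass c F = (d - c) * F / (1 + F).
    by rewrite /mass; field; rewrite gt_eqF// ltr_pwDl.
  by rewrite divr_gt0 ?mulr_gt0 ?subr_gt0// ltr_pwDl.
have m0 : 0 <= mass c F by apply: le_trans (mass_ge c01 F0); exact: ltW.
apply: (@lt_le_trans _ _ (mass c F * (F * (1 - x') - y))); first by rewrite ltr_nM2r.
have h1 : F * (1 - x') - y <= (1 + F * slope c E) * (E - y).
  have -> : (1 + F * slope c E) * (E - y) = E - y - F * x by rewrite /x; ring.
  by move: EF; clear; rewrite !mulrDr !mulr1 mulrN; lra.
apply: le_trans (ler_wpM2l m0 h1) _.
by rewrite mulrA ler_wnM2r ?subr_le0 ?(ltW Ey)// weight_tangent.
Qed.

End Bounds.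

(** * Plurisubharmonicity and comparison on the ball *)

Section Subharmonic.
Context {R : realType} {p : nat}.
Variable c : R.
Hypothesis c01 : 0 < c < 1.
Local Notation ball := (unit_ballCV R p.+2).
Let leb := @lebesgue_measure R.
Let I : set R := `[0, 2 * pi].
Implicit Types (a b z : 'CV[R]_p.+2).

(** [exp_disc] covers the punctured disc by the left half-plane; there the pulled-back potential has
    nonnegative Laplacian, is periodic in the imaginary direction and, by compactness of the closed
    disc, is bounded. *)
Lemma upot_submean a b : (forall w : cplx R, normC2 w <= 1 -> ball (a + w *: b)) ->
  2 * pi * upot c a <= \int[leb]_(t in I) upot c (a + expi t *: b).
Proof.
move=> aB; have [C C0 hC] := disc_bound (upot_cvg c01) aB.
have gB (z : 'CV[R]_1) : half z -> ball (exp_disc a b z).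
  by move=> z0; apply: (disc_pt_in aB); rewrite expR_ge0 /= -expR0 ler_expR ltW.
have VC : Cinf half (upot c \o exp_disc a b) := Cinf_upot c01 (@open_half R) (holo_exp_disc a b) gB.
apply: (disc_mean (upot_cvg c01) aB) => x y xy y0.
apply: (@cmean_mono R (upot c \o exp_disc a b) C VC _ _ _ x y xy y0).
- move=> z hz; exact: (laplacian_upot c01 (@open_half R) (holo_exp_disc a b) gB ord0 hz).
- move=> s t; rewrite /= !exp_disc_pt !disc_ptE mulr_natl.
  by rewrite cosD2pi sinD2pi.
- move=> s t s0 It; rewrite /= exp_disc_pt; apply: hC => //.
  by rewrite expR_ge0 /= -expR0 ler_expR ltW.
Qed.

Lemma upot_psh : plurisubharmonic ball (fun z => (upot c z)%:E).
Proof.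
split=> [z _|z Bz d|a b aB]; first exact: ltry.
  rewrite lte_fin => ud.
  have uz : upot c w @[w --> nbhs z] --> upot c z by exact: (upot_cvg c01 Bz).
  have h : nbhs z [set w | upot c w < d].
    apply: (uz [set x : R | x < d]).
    by apply: open_nbhs_nbhs; split => //; exact: open_lt.
  by apply: filterS h => w; rewrite /= lte_fin.
have i1 : leb.-integrable I (EFin \o (fun t => upot c (a + expi t *: b))).
  have := circle_integrable (upot_cvg c01) aB (r := 1).
  rewrite lexx ler01 => /(_ isT); congr (leb.-integrable I (EFin \o _)).
  by apply/funext => t; rewrite disc_ptE !mul1r.
have h := upot_submean aB.
have E : (\int[leb]_(t in I) (upot c (a + expi t *: b))%:E =
   (\int[leb]_(t in I) upot c (a + expi t *: b))%:E)%E.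
  have fE : (\int[leb]_(t in I) (upot c (a + expi t *: b))%:E)%E \is a fin_num.
    by apply: integrable_fin_num; [exact: measurable_itv|exact: i1].
  exact: (esym (fineK fE)).
apply: (eq_ind_r (fun t => ((upot c a)%:E <= ((2 * pi)^-1)%:E * t)%E) _ E).
rewrite -EFinM lee_fin -(ler_pM2l (@pi2_gt0 R)) mulrA mulfV ?mul1r//.
by rewrite gt_eqF// pi2_gt0.
Qed.

Lemma hq_szeta_ge0 z : ball z -> 0 <= hq szeta z < hY szeta somega z.
Proof. by move=> Bz; rewrite siegel_lt// normC2_ge0. Qed.

Lemma upot_gt z : 0 < hq szeta z < hY szeta somega z -> hq szeta z - hY szeta somega z < upot c z.
Proof. by rewrite /upot /pot /hgt; exact: pot_gt. Qed.

Lemma upot_bounds z : ball z -> poisson_kernel z <= upot c z <= c * poisson_kernel z.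
Proof.
move=> Bz; have qY := hq_szeta_ge0 Bz; rewrite -siegel//; apply/andP; split; last exact: pot_le.
have := normC2_ge0 (szeta ord0 z); rewrite le_eqVlt -/(hq szeta z) => /predU1P[q0|q0].
  have y0 : 0 < hY szeta somega z by have /andP[_] := qY; rewrite -q0.
  rewrite /upot /pot /hgt -q0 solE0// !sub0r mulrN lerN2 ler_piMl ?(ltW y0)//.
  exact: weight_le1.
by apply/ltW/upot_gt; rewrite q0; case/andP: qY.
Qed.

Lemma normCV2_0 : normCV2 (0 : 'CV[R]_p.+2) = 0.
Proof. by rewrite /normCV2 big1// => j _; rewrite mxE /normC2 ReC0 ImC0 expr0n addr0. Qed.

Lemma ball0 : ball 0.
Proof. by rewrite /unit_ballCV /= normCV2_0. Qed.

Lemma poisson0 : poisson_kernel (0 : 'CV[R]_p.+2) = -1.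
Proof.
by rewrite /poisson_kernel normCV2_0 mxE !subr0 /normC2 ReC1 ImC1 expr1n expr0n addr0 divr1.
Qed.

Lemma hq0 : hq szeta (0 : 'CV[R]_p.+2) = 0.
Proof. by rewrite /hq /szeta mxE mul0r /normC2 ReC0 ImC0 expr0n addr0. Qed.

Lemma upot0 : upot c (0 : 'CV[R]_p.+2) = -1.
Proof.
have /andP[h1 h2] := hq_szeta_ge0 ball0.
have E := siegel ball0; move: h2; rewrite hq0 => y0.
rewrite poisson0 hq0 sub0r in E.
rewrite /upot /pot /hgt hq0 solE0// sub0r E /weight /denom.
by rewrite !mulr0 !addr0 !mulr1 subrK invr1 !mul1r.
Qed.

(** Half the second unit vector: a point with q > 0, where the comparisons are strict. It separates
    different parameters, and each potential from the Poisson kernel. *)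
Definition test_point : 'CV[R]_p.+2 := RtoC 2^-1 *: delta_mx 0 (lift ord0 ord0).

Lemma test_point_ball : ball test_point.
Proof.
rewrite /unit_ballCV /= /normCV2 !big_ord_recl big1 => [|j _].
  rewrite !mxE /= mulr0 mulr1 /normC2 ReC0 ImC0 /= !expr0n !addr0 add0r.
  by rewrite expr_lt1 ?invf_lt1 ?ltr1n// invr_ge0.
by rewrite !mxE /= mulr0 /normC2 ReC0 ImC0 expr0n addr0.
Qed.

Lemma test_point_hq : 0 < hq szeta test_point < hY szeta somega test_point.
Proof.
apply/andP; split; last exact: siegel_lt test_point_ball.
rewrite lt_neqAle normC2_ge0 eq_sym normC2_eq0 andbT.
apply: mulf_neq0; last by rewrite invr_eq0; exact: ball_denom test_point_ball.
rewrite /test_point !mxE /= mulr1.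
by rewrite -normC2_eq0 /normC2 /= expr0n addr0 expf_eq0 /= invr_eq0 pnatr_eq0.
Qed.

End Subharmonic.

Lemma upot_lt {R : realType} {p : nat} (c d : R) (z : 'CV[R]_p.+2) : 0 < c -> c < d -> d < 1 ->
  0 < hq szeta z < hY szeta somega z -> upot d z < upot c z.
Proof. by rewrite /upot /pot /hgt; exact: pot_lt. Qed.

Theorem theorem1p2 (R : realType) (n : nat) (n_ge1 : (1 <= n)%N) :
  exists u : R -> 'CV[R]_n.+1 -> R,
    [/\ forall l : R, 0 < l < 1 ->
          {within unit_ballCV R n.+1, continuous (u l)} /\
          plurisubharmonic (unit_ballCV R n.+1) (fun z => (u l z)%:E),
        forall l m : R, 0 < l < 1 -> 0 < m < 1 -> l != m ->
          exists2 z, unit_ballCV R n.+1 z & u l z != u m z,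
        forall l : R, 0 < l < 1 ->
          is_monge_ampere (unit_ballCV R n.+1) (u l) mzero /\
          forall z, unit_ballCV R n.+1 z ->
            poisson_kernel z <= u l z <= expR (- l) * poisson_kernel z
      & forall l : R, 0 < l < 1 ->
          ~ exists c : R, forall z, unit_ballCV R n.+1 z ->
              u l z = c * poisson_kernel z].
Proof.
(* The dimension becomes [p.+2], which leaves a coordinate besides z_1 to define zeta_1. *)
case: n n_ge1 => // p _.
have c01 (l : R) : 0 < l < 1 -> 0 < expR (- l) < 1.
  by move=> /andP[l0 _]; rewrite expR_gt0 expR_lt1 oppr_lt0.
have mono (l m : R) : 0 < l < 1 -> 0 < m < 1 -> l < m ->
    upot (expR (- l)) (@test_point R p) < upot (expR (- m)) (@test_point R p).
  move=> l01 m01 lm; have /andP[_ l1] := c01 l l01.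
  have ml : expR (- m) < expR (- l) by rewrite ltr_expR ltrN2.
  exact (upot_lt (expR_gt0 _) ml l1 test_point_hq).
exists (fun l => upot (expR (- l))); split=> [l l01|l m l01 m01 lm|l l01|l l01 [c cE]].
- split; last exact: upot_psh (c01 l l01).
  apply: continuous_in_subspaceT => z /set_mem Bz; exact: (upot_cvg (c01 l l01) Bz).
- exists test_point; first exact: test_point_ball.
  move: lm; rewrite neq_lt => /orP[/(mono l m l01 m01)/lt_eqF|/(mono m l m01 l01)/gt_eqF] h;
    exact: negbT h.
- split; first exact: upot_monge_ampere (c01 l l01).
  by move=> z; exact: upot_bounds (c01 l l01) z.
(* At the origin q = 0 and both functions equal -1, which forces the factor to be 1; equality at
   [test_point] then contradicts the strict inequality there. *)
- have := cE _ ball0; rewrite poisson0 (upot0 (c01 l l01)) mulrN1 => /oppr_inj c1.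
  have := cE _ test_point_ball; rewrite -c1 mul1r -(siegel test_point_ball) => E.
  have h : hq szeta (@test_point R p) - hY szeta somega (@test_point R p) < upot (expR (- l)) (@test_point R p).
    exact (upot_gt (c01 l l01) test_point_hq).
  by move: h; rewrite E ltxx.
Qed.
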